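(* Let $0<\alpha\le 1$ and $1<p<\infty$. Suppose that $\Theta$ is a growth function satisfying the doubling condition with doubling constant $1\le D(\Theta)<2^n$. Then there is a constant $C>0$ such that for every sequence $\vec f=(f_1,f_2,\ldots)$ of locally integrable functions on $\mathbb R^n$, $$\bigg\|\bigg(\sum_{j}\big|\mathcal S_\alpha(f_j)\big|^2\bigg)^{1/2}\bigg\|_{L^{p,\Theta}}\leq C \bigg\|\bigg(\sum_{j}|f_j|^2\bigg)^{1/2}\bigg\|_{L^{p,\Theta}}.$$
   Context: Intrinsic square function: for $0<\alpha\le1$ let $\mathcal C_\alpha$ be the family of functions $\varphi:\mathbb R^n\to\mathbb R$ supported in $\{|x|\le1\}$ with $\int_{\mathbb R^n}\varphi\,dx=0$ and $|\varphi(x)-\varphi(x')|\le|x-x'|^\alpha$ for all $x,x'\in\mathbb R^n$. Put $\varphi_t(y)=t^{-n}\varphi(y/t)$, $\Gamma(x)=\{(y,t)\in\mathbb R^n\times(0,\infty):|x-y|<t\}$, and for $f\in L^1_{loc}(\mathbb R^n)$ $$\mathcal S_\alpha(f)(x)=\left(\iint_{\Gamma(x)}\Big(\sup_{\varphi\in\mathcal C_\alpha}\Big|\int_{\mathbb R^n}\varphi_t(y-z)f(z)\,dz\Big|\Big)^2\frac{dy\,dt}{t^{n+1}}\right)^{1/2}.$$ Growth function: a positive increasing function $\Theta$ on $(0,+\infty)$ (increasing in the weak sense) satisfying the doubling condition $\Theta(2r)\le D\,\Theta(r)$ for all $r>0$, where $D=D(\Theta)\ge1$ is a constant independent of $r$.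 Generalized Morrey norm: $\|f\|_{L^{p,\Theta}}=\sup_{x_0\in\mathbb R^n,\,r>0}\big(\frac1{\Theta(r)}\int_{B(x_0,r)}|f(x)|^p\,dx\big)^{1/p}$, where $B(x_0,r)$ is the open ball of center $x_0$ and radius $r$. *)

(* Defs.v *)
From HB Require Import structures.
From mathcomp Require Import all_boot all_order all_algebra.
From mathcomp Require Import all_classical all_reals all_analysis.

Set Implicit Arguments.
Unset Strict Implicit.
Unset Printing Implicit Defensive.

Import Order.TTheory GRing.Theory Num.Theory.
Import numFieldNormedType.Exports.

Local Open Scope classical_set_scope.
Local Open Scope ring_scope.

Section lebesgue_outer_measure.
Context {R : realType} {n : nat}.
Implicit Types (A : set 'rV[R]_n) (q : 'rV[R]_n * 'rV[R]_n)
  (Q : set ('rV[R]_n * 'rV[R]_n)).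

Definition box q : set 'rV[R]_n :=
  [set x | forall i, q.1 ord0 i < x ord0 i <= q.2 ord0 i].

Definition box_volume q : \bar R :=
  (\prod_i Num.max 0 (q.2 ord0 i - q.1 ord0 i))%:E.

Definition box_cover A Q := countable Q /\ A `<=` \bigcup_(q in Q) box q.

(* The families Q are countable but possibly finite or empty, so that the
   empty set has measure zero also when n = 0. *)
Definition lebesgue_outer A : \bar R :=
  ereal_inf [set (\esum_(q in Q) box_volume q)%E | Q in box_cover A].

Local Open Scope ereal_scope.

Let box_volume_ge0 q : 0 <= box_volume q.
Proof.
by rewrite lee_fin; apply: prodr_ge0 => i _; rewrite le_max lexx.
Qed.

Let lebesgue_outer_ge0 A : 0 <= lebesgue_outer A.
Proof. by apply: le_ereal_inf_tmp => _ [Q _ <-]; exact: esum_ge0. Qed.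

Let lebesgue_outer0 : lebesgue_outer set0 = 0.
Proof.
apply/eqP; rewrite eq_le lebesgue_outer_ge0 andbT.
by apply: ereal_inf_lbound; exists set0; [split | rewrite esum_set0].
Qed.

Let le_lebesgue_outer : {homo lebesgue_outer : A B / A `<=` B >-> A <= B}.
Proof.
move=> A B AB; apply: ereal_inf_le_tmp => _ [Q [cQ BQ] <-].
by exists Q => //; split => //; exact: subset_trans BQ.
Qed.

Let le_esum_bigcup (Q : nat -> set ('rV[R]_n * 'rV[R]_n)) :
  \esum_(q in \bigcup_k Q k) box_volume q <=
  \sum_(k <oo) \esum_(q in Q k) box_volume q.
Proof.
rewrite nneseries_esumT; last by move=> k; exact: esum_ge0.
rewrite esum_esum//.
have /choice[h hP] (q : 'rV[R]_n * 'rV[R]_n) :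
    exists k, (\bigcup_k Q k) q -> Q k q.
  by have [[k _ Qkq]|nQ] := pselect ((\bigcup_k Q k) q);
    [exists k | exists 0%N].
have hinj : set_inj (\bigcup_k Q k) (fun q => (h q, q)).
  by move=> q q' _ _ [].
rewrite -(@esum_image _ _ _ _ _ (fun k => box_volume k.2) hinj).
rewrite esum_mkcond [leRHS]esum_mkcond; apply: le_esum => -[k q] _ /=.
case: ifPn => [|_]; last by case: ifPn.
rewrite inE/= => -[q' Qq' [<- <-]]; rewrite mem_set//=.
by split => //=; exact: hP.
Qed.

Let lebesgue_outer_sigma_subadditive : sigma_subadditive lebesgue_outer.
Proof.
move=> A; have [[i ioo]|] := pselect (exists i, lebesgue_outer (A i) = +oo).
  rewrite (eseries_pinfty _ _ ioo) ?leey// => k _.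
  by rewrite -ltNye (lt_le_trans _ (lebesgue_outer_ge0 _)).
rewrite -forallNE => Aoo.
apply/lee_addgt0Pr => e e0.
rewrite (le_trans _ (epsilon_trick _ _ (ltW e0)))//.
have /choice[Q QP] k : exists Q, box_cover (A k) Q /\
    \esum_(q in Q) box_volume q <=
    lebesgue_outer (A k) + (e / (2 ^ k.+1)%:R)%:E.
  have ek0 : (0 < e / (2 ^ k.+1)%:R)%R by rewrite divr_gt0// ltr0n expn_gt0.
  have Afin : lebesgue_outer (A k) \is a fin_num.
    by rewrite ge0_fin_numE// ltey; apply/eqP; exact: Aoo.
  have [_ [Q QA <-] QS] := lb_ereal_inf_adherent ek0 Afin.
  by exists Q; split => //; exact: ltW.
apply: (@le_trans _ _ (\sum_(k <oo) \esum_(q in Q k) box_volume q)).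
  apply: le_trans (le_esum_bigcup _).
  apply: ereal_inf_lbound; exists (\bigcup_k Q k) => //; split.
    by apply: bigcup_countable => // k _; exact: (QP k).1.1.
  by move=> x [k _ /(QP k).1.2[q Qq qx]]; exists q => //; exists k.
by apply: lee_nneseries => [k _ _|k _]; [exact: esum_ge0 | exact: (QP k).2].
Qed.

HB.instance Definition _ := isOuterMeasure.Build R 'rV[R]_n lebesgue_outer
  lebesgue_outer0 lebesgue_outer_ge0 le_lebesgue_outer
  lebesgue_outer_sigma_subadditive.

End lebesgue_outer_measure.

(* 'rV[R]_n carries the sigma-algebra of Lebesgue-measurable sets (not only the
   Borel sets), obtained from the outer measure by Caratheodory's criterion. *)
HB.instance Definition _ (R : realType) (n : nat) :=
  @isMeasurable.Build (caratheodory_display (@lebesgue_outer R n)) 'rV[R]_n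
    (@lebesgue_outer R n).-caratheodory
    (caratheodory_measurable_set0 (@lebesgue_outer R n))
    (@caratheodory_measurable_setC _ _ (@lebesgue_outer R n))
    (@caratheodory_measurable_bigcup _ _ (@lebesgue_outer R n)).

Definition lebesgue {R : realType} {n : nat} : set 'rV[R]_n -> \bar R :=
  lebesgue_outer.

HB.instance Definition _ (R : realType) (n : nat) :=
  isMeasure.Build _ 'rV[R]_n R (@lebesgue R n)
    (@caratheodory_measure0 R 'rV[R]_n (@lebesgue_outer R n))
    (@caratheodory_measure_ge0 R 'rV[R]_n (@lebesgue_outer R n))
    (@caratheodory_measure_sigma_additive R 'rV[R]_n (@lebesgue_outer R n)).

Section morrey.
Context {R : realType} {n : nat}.
Implicit Types (x y : 'rV[R]_n) (f phi : 'rV[R]_n -> R).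

(* The library's norm on 'rV[R]_n is the sup norm, hence: *)
Definition enorm x : R := Num.sqrt (\sum_i x ord0 i ^+ 2).

Definition eball x (r : R) : set 'rV[R]_n := [set y | enorm (y - x) < r].

(* The n-dimensional analogue of the library's locally_integrable setT. *)
Definition locally_integrable_rV f :=
  measurable_fun setT f /\
  forall K, compact K -> (\int[lebesgue]_(x in K) `|f x|%:E < +oo)%E.

Definition test_functions (alpha : R) : set ('rV[R]_n -> R) :=
  [set phi | [/\ forall x, 1 < enorm x -> phi x = 0,
    (\int[lebesgue]_x (phi x)%:E = 0)%E &
    forall x x', `|phi x - phi x'| <= enorm (x - x') `^ alpha]].

Definition dilate phi (t : R) y : R := t ^- n * phi (t^-1 *: y).

Definition maximal_average (alpha : R) f y (t : R) : \bar R :=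
  ereal_sup
    [set (`| \int[lebesgue]_z (dilate phi t (y - z) * f z)%:E |)%E
    | phi in test_functions alpha].

Definition cone x : set ('rV[R]_n * R) :=
  [set u | 0 < u.2 /\ enorm (x - u.1) < u.2].

Definition intrinsic_square (alpha : R) f x : \bar R :=
  ((\int[lebesgue \x lebesgue_measure]_(u in cone x)
      (maximal_average alpha f u.1 u.2 ^+ 2 * (u.2 ^- n.+1)%:E)) `^ 2^-1)%E.

(* Extended-real-valued functions are allowed, since square functions and
   infinite sums may take the value +oo. *)
Definition morrey_norm (p : R) (Theta : R -> R) (g : 'rV[R]_n -> \bar R) :
    \bar R :=
  ereal_sup [set (((Theta r)^-1%:E *
      \int[lebesgue]_(y in eball x r) (`|g y| `^ p)) `^ p^-1)%E
    | x in [set: 'rV[R]_n] & r in [set r : R | 0 < r]].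

Definition l2_sum (g : nat -> 'rV[R]_n -> \bar R) x : \bar R :=
  ((\sum_(0 <= j <oo) `|g j x| ^+ 2) `^ 2^-1)%E.

End morrey.

(* Only the values of Theta on the positive half-line matter. *)
Definition growth_function {R : realType} (Theta : R -> R) :=
  (forall r, 0 < r -> 0 < Theta r) /\
  (forall r s, 0 < r -> r <= s -> Theta r <= Theta s).

Definition doubling {R : realType} (Theta : R -> R) (D : R) :=
  forall r, 0 < r -> Theta (2 * r) <= D * Theta r.

(* Main.v *)
(* Fix a ball [B(x0, r)] and the [2 ^ n] grids of dyadic subcubes, down to side
   [12 r / 2 ^ N], of the shifts of a cube of side [12 r] around it.

   At a scale [t] in [(r / 2 ^ (j + 1), r / 2 ^ j]], the support of
   [phi_t (y - .)] lies in one cube of level [j] of one of the grids.  Since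
   [phi] has mean zero and is Hoelder continuous,
   [|\int phi_t (y - z) f z dz|] is bounded, up to an error vanishing as [N]
   grows, by the sum over [j <= m < N] of [2 ^ (- alpha (m - j))] times the
   average over that cube of the martingale difference [|D_m f|].  The square
   function made of these averages is bounded on [L^p (l^2)] by maximal
   inequalities for finite martingales.

   At scales [t > r], Hoelder's inequality bounds the averages of [f] over
   balls of radius [2 ^ k r] by the Morrey norm, and [D < 2 ^ n] makes the sum
   over [k] a convergent geometric series.

   The intrinsic square function need not be known to be measurable: it is
   dominated pointwise by the lower limit in [N] of step functions on the
   grids, to which Fatou's lemma applies. *)

Require Import Defs.
From mathcomp Require Import all_boot all_order all_algebra.
From mathcomp Require Import all_classical all_reals all_analysis.
From mathcomp Require Import measurable_realfun.
From mathcomp Require Import ring lra.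
Import Order.TTheory GRing.Theory Num.Theory.
Import numFieldNormedType.Exports.
Local Open Scope classical_set_scope.
Local Open Scope ring_scope.

Set Implicit Arguments.
Unset Strict Implicit.
Unset Printing Implicit Defensive.

(** * Elementary inequalities *)

(** The martingale inequality is needed for every exponent [p > 1], with a constant that depends
    neither on the depth [N] nor on the number of functions. It is reduced to weighted energy
    estimates: martingale differences are orthogonal with respect to any weight known beforehand.
    For [p <= 2] the weights are the powers [p - 2] of the running maximum of the [l^2] norm; for
    [p > 2] they are running maxima of a power of the square function itself.

    A test function sampled on a grid has a sum that is only nearly zero; this and the sampling
    itself produce the error term. It vanishes for finitely many functions and scales at a time, so
    partial sums are bounded before any series is formed.

    The constants of the grids come from the shift by a third of the side, [4 r] out of [12 r]. As 3
    does not divide [2 ^ j], the faces of level [j] of the shifted and unshifted grids stay a third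
    of a side apart, and [12 r / 2 ^ j > 6 t] leaves room for the support of a test function at
    scale [t]. The shift is chosen separately in each coordinate. *)

Section power_inequalities.
Context {R : realType}.
Implicit Types (a b c q s x y : R).

Lemma le_powR q a b : 0 <= q -> 0 <= a -> a <= b -> a `^ q <= b `^ q.
Proof.
move=> q0 a0 ab; apply: ge0_ler_powR => //; rewrite nnegrE//.
exact: le_trans ab.
Qed.

Lemma le_powRN q a b : q <= 0 -> 0 < a -> a <= b -> b `^ q <= a `^ q.
Proof.
move=> q0 a0 ab; have b0 := lt_le_trans a0 ab.
rewrite -(opprK q) !(powRN _ (- q)) lef_pV2 ?posrE ?powR_gt0//.
by apply: le_powR => //; [rewrite oppr_ge0|exact: ltW].
Qed.

Lemma powR_mulD a q s : 0 < a -> a `^ q * a `^ s = a `^ (q + s).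
Proof. by move=> a0; rewrite powRD// (gt_eqF a0) implybT. Qed.

(** By convexity [x ^ q] lies above its tangent at [y]; this is Young's inequality for [x] and
    [y ^ (q - 1)] with exponents [q] and [q / (q - 1)]. *)
Lemma young_tangent q x y : 1 < q -> 0 <= x -> 0 <= y ->
  q * (x * y `^ (q - 1)) <= x `^ q + (q - 1) * y `^ q.
Proof.
move=> q1 x0 y0; have q0 : 0 < q by lra.
have := @conjugate_powR R x (y `^ (q - 1)) q (q / (q - 1)) x0 (powR_ge0 _ _).
have qB : q - 1 != 0 by apply/eqP; lra.
have q1' : q != 0 by apply/eqP; lra.
rewrite q0 => /(_ erefl); rewrite divr_gt0//; last lra.
move=> /(_ erefl).
have -> : q^-1 + (q / (q - 1))^-1 = 1 by field; rewrite q1' qB.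
move=> /(_ erefl).
rewrite -powRrM.
have -> : (q - 1) * (q / (q - 1)) = q by field.
move=> h; rewrite -(@ler_pM2l _ q^-1) ?invr_gt0// mulKf//.
apply: (le_trans h); rewrite le_eqVlt; apply/orP; left; apply/eqP.
by field; rewrite q1' qB.
Qed.

(** The concave power lies below its tangent. Young's inequality is applied with exponents [q^-1]
    and [(1 - q)^-1] to two factors whose product is [x ^ q]; the first exponent is why [q = 0] is
    treated apart. *)
Lemma concave_tangent q x y : 0 <= q < 1 -> 0 <= x -> 0 < y ->
  x `^ q + (q - 1) * y `^ q <= q * (x * y `^ (q - 1)).
Proof.
move=> /andP[]; rewrite le_eqVlt => /predU1P[<- _ x0 y0|q0 q1 x0 y0].
  by rewrite !powRr0; lra.
have := @conjugate_powR R (x `^ q * y `^ (q * (q - 1))) (y `^ (q * (1 - q)))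
  q^-1 (1 - q)^-1 (mulr_ge0 (powR_ge0 _ _) (powR_ge0 _ _)) (powR_ge0 _ _).
rewrite !invr_gt0 q0 subr_gt0 q1 => /(_ erefl erefl); rewrite !invrK.
rewrite subrKC => /(_ erefl).
rewrite -mulrA powR_mulD// -mulrDr.
have -> : q - 1 + (1 - q) = 0 by ring.
rewrite mulr0 powRr0 mulr1 powRM ?powR_ge0// -!powRrM.
have qN0 : q != 0 by rewrite gt_eqF.
have q1N0 : 1 - q != 0 by rewrite subr_eq0 gt_eqF.
rewrite mulfV// powRr1//.
have -> : q * (q - 1) * q^-1 = q - 1 by field.
have -> : q * (1 - q) * (1 - q)^-1 = q by field.
lra.
Qed.

(* Either [c] or [a] dominates; no need for a weighted mean inequality. *)
Lemma interpolate_le_add s a c : 0 <= s <= 1 -> 0 <= a -> 0 <= c ->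
  a `^ s * c `^ (1 - s) <= a + c.
Proof.
move=> /andP[s0 s1] a0 c0.
have [->|sN0] := eqVneq s 0.
  by rewrite powRr0 mul1r subr0 powRr1// lerDr.
have [->|sN1] := eqVneq s 1.
  by rewrite subrr powRr0 mulr1 powRr1// lerDl.
have hom b : 0 <= b -> b `^ s * b `^ (1 - s) = b.
  by move=> b0; rewrite -powRD subrKC ?powRr1// oner_eq0.
have s1' : 0 <= 1 - s by lra.
have [ac|/ltW ca] := leP a c.
  rewrite (@le_trans _ _ c)// ?lerDr// -[leRHS](hom c)//.
  by rewrite ler_wpM2r ?powR_ge0// le_powR.
rewrite (@le_trans _ _ a)// ?lerDl// -[leRHS](hom a)//.
by rewrite ler_wpM2l ?powR_ge0// le_powR.
Qed.

(** If [x <= e * y] the first term suffices, otherwise the second one does. The parameter [e] serves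
    to absorb the first term later. *)
Lemma young_eps q e x y : 1 < q -> 0 < e -> 0 <= x -> 0 <= y ->
  x * y `^ (q - 1) <= e * y `^ q + e `^ (1 - q) * x `^ q.
Proof.
move=> q1 e0 x0 y0.
have [xe|ex] := leP x (e * y).
  rewrite (@le_trans _ _ (e * y `^ q))//; last first.
    by rewrite lerDl mulr_ge0 ?powR_ge0.
  rewrite -(@mulr_powRB1 _ y q y0); last lra.
  by rewrite mulrA ler_wpM2r ?powR_ge0.
rewrite (@le_trans _ _ (e `^ (1 - q) * x `^ q))//; last first.
  by rewrite lerDr mulr_ge0 ?powR_ge0// ltW.
have -> : 1 - q = - (q - 1) by ring.
rewrite powRN [leRHS]mulrC ler_pdivlMr ?powR_gt0//.
rewrite -(@mulr_powRB1 _ x q x0); last lra.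
rewrite -mulrA -powRM ?(ltW e0)// (mulrC y) ler_wpM2l//.
by apply: le_powR; [lra|rewrite mulr_ge0// ltW|exact: ltW].
Qed.

End power_inequalities.

(** Lagrange's identity: twice the difference of the two sides is a weighted double sum of the
    squares [(a i * b j - a j * b i) ^+ 2]. *)
Lemma cauchy_schwarz_sum (R : realType) (I : Type) (r : seq I) (P : pred I)
    (w a b : I -> R) : (forall i, 0 <= w i) ->
  (\sum_(i <- r | P i) w i * (a i * b i)) ^+ 2 <=
  (\sum_(i <- r | P i) w i * a i ^+ 2) * (\sum_(i <- r | P i) w i * b i ^+ 2).
Proof.
move=> w0.
set C := \sum_(i <- r | P i) w i * (a i * b i).
set A := \sum_(i <- r | P i) w i * a i ^+ 2.
set B := \sum_(i <- r | P i) w i * b i ^+ 2.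
have : 0 <= \sum_(i <- r | P i) \sum_(j <- r | P j)
    (w i * w j * (a i * b j - a j * b i) ^+ 2).
  apply: sumr_ge0 => i _; apply: sumr_ge0 => j _.
  by rewrite mulr_ge0 ?sqr_ge0// mulr_ge0.
rewrite [leRHS](_ : _ = A * B + B * A - 2 * (C * C)); first by rewrite expr2; lra.
rewrite /A /B /C !big_distrlr/= mulr_sumr -big_split -sumrB/=.
apply: eq_bigr => i _; rewrite mulr_sumr -big_split -sumrB/=.
by apply: eq_bigr => j _; ring.
Qed.

(** * Martingales on finite sets *)

(** The classes of [c j] are the atoms of level [j], under the counting measure. [filt_card] is
    regularity: an atom exceeds its sub-atoms of the next level by at most the factor [b], which
    limits the upward jumps of nonnegative martingales. *)
Structure regular_filtration (R : realType) (Om : finType)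
    (c : nat -> rel Om) (b : R) : Prop := RegularFiltration {
  filt_equiv : forall j, equivalence_rel (c j) ;
  filt_nest : forall j x y, c j.+1 x y -> c j x y ;
  filt_card : forall j x, #|c j x|%:R <= b * #|c j.+1 x|%:R }.

Section conditional_expectation.
Context {R : realType} {Om : finType} (c : nat -> rel Om).
Implicit Types (g h w : Om -> R) (x y : Om).

Definition cexp j g x : R := (\sum_(y | c j x y) g y) / #|c j x|%:R.

Definition adapted j h := forall x y, c j x y -> h x = h y.

Context {b : R} (F : regular_filtration c b).

Lemma filt_refl j x : c j x x.
Proof. by have [+ _] := filt_equiv F j x x x. Qed.

Lemma filt_trans_eq j x y : c j x y -> c j x =1 c j y.
Proof. by move=> xy z; have [_ /(_ xy)] := filt_equiv F j x y z. Qed.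

Lemma filt_sym j x y : c j x y = c j y x.
Proof.
by apply/idP/idP => /filt_trans_eq xy; rewrite -?xy ?filt_refl// xy filt_refl.
Qed.

Lemma filt_le i j x y : (i <= j)%N -> c j x y -> c i x y.
Proof.
move=> /subnK <-; elim: (j - i)%N => [//|k IH] /(filt_nest F).
exact: IH.
Qed.

Lemma adapted_le i j h : (i <= j)%N -> adapted i h -> adapted j h.
Proof. by move=> ij hi x y /(filt_le ij)/hi. Qed.

Lemma card_class_gt0 j x : 0 < #|c j x|%:R :> R.
Proof. by rewrite ltr0n; apply/card_gt0P; exists x; exact: filt_refl. Qed.

Lemma card_class_eq j x y : c j x y -> #|c j x| = #|c j y|.
Proof. by move=> xy; apply: eq_card => z; exact: filt_trans_eq. Qed.

Lemma adapted_cexp j g : adapted j (cexp j g).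
Proof.
move=> x y xy; rewrite /cexp (card_class_eq xy); congr (_ / _).
by apply: eq_bigl => z; exact: filt_trans_eq.
Qed.

Lemma cexp_ge0 j g x : (forall y, 0 <= g y) -> 0 <= cexp j g x.
Proof. by move=> g0; rewrite divr_ge0// sumr_ge0. Qed.

Lemma cexp_gt0 j g x : (forall y, 0 < g y) -> 0 < cexp j g x.
Proof.
move=> g0; rewrite divr_gt0 ?card_class_gt0//.
rewrite (bigD1 x) ?filt_refl//= ltr_wpDr// sumr_ge0// => y _.
exact: ltW.
Qed.

Lemma le_cexp j g h x : (forall y, g y <= h y) -> cexp j g x <= cexp j h x.
Proof.
by move=> gh; rewrite ler_pM2r ?invr_gt0 ?card_class_gt0//; exact: ler_sum.
Qed.

Lemma cexp_sum j (I : Type) (r : seq I) (P : pred I) (g : I -> Om -> R) x :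
  cexp j (fun y => \sum_(i <- r | P i) g i y) x =
  \sum_(i <- r | P i) cexp j (g i) x.
Proof. by rewrite /cexp exchange_big/= mulr_suml. Qed.

Lemma cexpZ j a g x : cexp j (fun y => a * g y) x = a * cexp j g x.
Proof. by rewrite /cexp -mulr_sumr mulrA. Qed.

(** When the sums are exchanged, each [y] is met once for every [x] of its class, which cancels the
    denominator. *)
Lemma sum_cexp j w g : adapted j w ->
  \sum_x w x * cexp j g x = \sum_x w x * g x.
Proof.
move=> wj.
transitivity (\sum_x \sum_(y | c j x y) w y * g y / #|c j y|%:R).
  apply: eq_bigr => x _; rewrite /cexp mulrA mulr_sumr mulr_suml.
  by apply: eq_bigr => y xy; rewrite (wj _ _ xy) (card_class_eq xy).
rewrite (exchange_big_dep predT)//=; apply: eq_bigr => y _.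
under eq_bigl do rewrite filt_sym.
rewrite sumr_const.
by rewrite -(mulr_natr (_ / _)) divfK// gt_eqF// card_class_gt0.
Qed.

Lemma cexp_reg j g x : (forall y, 0 <= g y) -> cexp j.+1 g x <= b * cexp j g x.
Proof.
move=> g0; rewrite ler_pdivrMr ?card_class_gt0//.
rewrite (@le_trans _ _ (\sum_(y | c j x y) g y))//.
  rewrite big_mkcond [leRHS]big_mkcond/=; apply: ler_sum => y _.
  by case: ifPn => [/(filt_nest F) ->//|_]; case: ifPn.
rewrite mulrAC mulrC -mulrA ler_peMr ?sumr_ge0//.
by rewrite mulrC ler_pdivlMr ?card_class_gt0// mul1r filt_card.
Qed.

Lemma filt_bound_ge1 x : 1 <= b.
Proof.
have := filt_card F 0 x; rewrite -ler_pdivrMr ?card_class_gt0//.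
apply: le_trans; rewrite ler_pdivlMr ?card_class_gt0// mul1r ler_nat.
by apply: subset_leq_card; apply/fintype.subsetP => y; exact: (filt_nest F).
Qed.

(** Jensen's inequality for the [l^2] norm, by duality: the vector of the [cexp j (f i) x] is paired
    with itself, the pairing is moved inside the expectation and bounded there by Cauchy-Schwarz,
    and one factor [Num.sqrt s] is cancelled. *)
Lemma sum_sqr_cexp_le j (I : finType) (f : I -> Om -> R) g x :
  (forall y, \sum_i f i y ^+ 2 <= g y ^+ 2) -> (forall y, 0 <= g y) ->
  \sum_i cexp j (f i) x ^+ 2 <= cexp j g x ^+ 2.
Proof.
move=> fg g0; set s := \sum_i _.
have s0 : 0 <= s by apply: sumr_ge0 => i _; exact: sqr_ge0.
have CS y : \sum_i cexp j (f i) x * f i y <= Num.sqrt s * g y.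
  rewrite (le_trans (ler_norm _))// -[leRHS]ger0_norm ?mulr_ge0//.
  rewrite -ler_sqr ?nnegrE// !real_normK ?num_real// exprMn sqr_sqrtr//.
  have := @cauchy_schwarz_sum R I (index_enum I) xpredT (fun=> 1)
    (fun i => cexp j (f i) x) (fun i => f i y) (fun=> ler01).
  have E (h : I -> R) : \sum_i 1 * h i = \sum_i h i.
    by apply: eq_bigr => i _; rewrite mul1r.
  rewrite !E => /le_trans; apply.
  by rewrite ler_pM// ?sumr_ge0// => i _; rewrite sqr_ge0.
have : s <= Num.sqrt s * cexp j g x.
  rewrite -cexpZ; apply: le_trans (le_cexp _ _ CS).
  by rewrite cexp_sum/s; under [leRHS]eq_bigr do rewrite cexpZ -expr2.
have := sqr_sqrtr s0; move: (Num.sqrt s) (sqrtr_ge0 s) => u u0 <- uE.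
move: (cexp j g x) (cexp_ge0 j x g0) uE => v v0 uE.
by have [uv|vu] := leP u v; nra.
Qed.

End conditional_expectation.

Lemma sum_geo_ge (R : realType) (t : R) N j : 0 < t < 1 ->
  \sum_(m < N | (j <= m)%N) t ^+ (m - j) <= (1 - t)^-1.
Proof.
move=> /andP[t0 t1]; rewrite -[leRHS]mul1r ler_pdivlMr ?subr_gt0//.
suff -> : (\sum_(m < N | (j <= m)%N) t ^+ (m - j)) * (1 - t) = 1 - t ^+ (N - j).
  by rewrite gerBl exprn_ge0// ltW.
elim: N => [|N IH]; first by rewrite big_ord0 sub0n mul0r expr0 subrr.
rewrite big_mkcond big_ord_recr -big_mkcond/= mulrDl IH.
case: ifPn => [jN|]; first by rewrite subSn// exprS; ring.
rewrite -ltnNge => Nj; rewrite mul0r addr0 (eqP (ltnW Nj : (N - j == 0)%N)).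
by rewrite (eqP (Nj : (N.+1 - j == 0)%N)).
Qed.

Lemma sum_geo_le (R : realType) (t : R) N m : 0 < t < 1 ->
  \sum_(j < N | (j <= m)%N) t ^+ (m - j) <= (1 - t)^-1.
Proof.
move=> /andP[t0 t1]; rewrite -[leRHS]mul1r ler_pdivlMr ?subr_gt0//.
suff -> : (\sum_(j < N | (j <= m)%N) t ^+ (m - j)) * (1 - t) =
    t ^+ (m.+1 - N) - t ^+ m.+1.
  rewrite (@le_trans _ _ (t ^+ (m.+1 - N)))//; last first.
    by rewrite exprn_ile1// ltW.
  by rewrite gerBl exprn_ge0// ltW.
elim: N => [|N IH]; first by rewrite big_ord0 subn0 mul0r subrr.
rewrite big_mkcond big_ord_recr -big_mkcond/= mulrDl IH subSS.
case: ifPn => [Nm|]; first by rewrite subSn// !exprS; ring.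
rewrite -ltnNge => mN; rewrite mul0r addr0 (eqP (ltnW mN : (m - N == 0)%N)).
by rewrite (eqP (mN : (m.+1 - N == 0)%N)).
Qed.

(** * Maximal inequalities and energies of finite martingales *)

Section maximal_process.
Context {R : realType} {Om : finType} (c : nat -> rel Om).
Implicit Types (g h w v f : Om -> R) (x y : Om).

Fixpoint cmax j g x : R :=
  if j is i.+1 then Num.max (cmax i g x) (cexp c j g x) else cexp c 0 g x.

Definition mdiff m f x : R := cexp c m.+1 f x - cexp c m f x.

Context {b : R} (F : regular_filtration c b).

Lemma adapted_cmax j g : adapted c j (cmax j g).
Proof.
elim: j => [|j IH] x y xy /=; first exact: (adapted_cexp F).
by rewrite (adapted_cexp F g xy) (IH x y)//; exact: (filt_nest F).
Qed.

Lemma cexp_le_cmax_self j g x : cexp c j g x <= cmax j g x.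
Proof. by case: j => [|j] //=; rewrite le_max lexx orbT. Qed.

Lemma cmax_homo i j g x : (i <= j)%N -> cmax i g x <= cmax j g x.
Proof.
move=> /subnK <-; elim: (j - i)%N => [//|k IH].
by apply: (le_trans IH); rewrite addSn/= le_max lexx.
Qed.

Lemma cexp_le_cmax i j g x : (i <= j)%N -> cexp c i g x <= cmax j g x.
Proof. by move=> ij; exact: le_trans (cexp_le_cmax_self i g x) (cmax_homo _ _ _). Qed.

Lemma cmax_ge0 j g x : (forall y, 0 <= g y) -> 0 <= cmax j g x.
Proof.
by move=> g0; exact: le_trans (cexp_ge0 c j x g0) (cexp_le_cmax_self _ _ _).
Qed.

Lemma cmax_gt0 j g x : (forall y, 0 < g y) -> 0 < cmax j g x.
Proof.
by move=> g0; exact: lt_le_trans (cexp_gt0 F j x g0) (cexp_le_cmax_self _ _ _).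
Qed.

Lemma cmax_reg j g x : (forall y, 0 <= g y) -> cmax j.+1 g x <= b * cmax j g x.
Proof.
move=> g0; have b1 := filt_bound_ge1 F x; have b0 := le_trans ler01 b1.
rewrite /= ge_max ler_peMl ?cmax_ge0//=.
by rewrite (le_trans (cexp_reg F j x g0))// ler_wpM2l// cexp_le_cmax_self.
Qed.

(* The potential [G ^ q - q / (q - 1) * X * G ^ (q - 1)] is affine in [X] and
   does not increase when the running maximum [G] is updated to [max G X];
   hence it is a supermartingale. It gives Doob's inequality for [q > 1] and
   Kolmogorov's for [q < 1]. *)
Definition potential q (X G : R) : R := G `^ q - q / (q - 1) * (X * G `^ (q - 1)).

(** The decrease is the tangent inequality at the old maximum divided by [q - 1]; convexity for
    [q > 1] and concavity for [q < 1] match the sign of the divisor. *)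
Lemma potential_max q (X G : R) :
  (1 < q /\ 0 <= G) \/ (0 <= q < 1 /\ 0 < G) -> 0 <= X ->
  potential q X (Num.max G X) <= potential q X G.
Proof.
move=> qG X0; have [//|GX] := leP X G; rewrite /potential.
have Xp : X * X `^ (q - 1) = X `^ q.
  case: qG => [[q1 _]|[_ G0]]; first by rewrite mulr_powRB1//; lra.
  have X0' := lt_trans G0 GX.
  by rewrite -{1}(powRr1 X0) powR_mulD// subrKC.
rewrite Xp -subr_ge0.
have q1 : q - 1 != 0 by apply/eqP; case: qG => [[]|[]]; lra.
rewrite [leRHS](_ : _ =
  (X `^ q + (q - 1) * G `^ q - q * (X * G `^ (q - 1))) / (q - 1)).
  case: qG => [[q1' G0]|[q01 G0]].
    by rewrite divr_ge0// subr_ge0; [exact: young_tangent|exact: ltW].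
  rewrite -mulrNN mulr_ge0// ?oppr_ge0 ?subr_le0 ?concave_tangent//.
  by rewrite invr_le0; lra.
by field.
Qed.

Lemma potential_step q j g w :
  (1 < q /\ forall x, 0 <= g x) \/ (0 <= q < 1 /\ forall x, 0 < g x) ->
  adapted c j w -> (forall x, 0 <= w x) ->
  \sum_x w x * potential q (cexp c j.+1 g x) (cmax j.+1 g x) <=
  \sum_x w x * potential q (cexp c j g x) (cmax j g x).
Proof.
move=> qg wj w0; have g0 x : 0 <= g x by case: qg => [[_]|[_ /(_ x)/ltW]].
apply: (@le_trans _ _
    (\sum_x w x * potential q (cexp c j.+1 g x) (cmax j g x))).
  apply: ler_sum => x _; rewrite ler_wpM2l//; apply: potential_max.
    case: qg => [[q1 _]|[q1 g1]]; [left|right]; split => //.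
      exact: cmax_ge0.
    exact: cmax_gt0.
  exact: cexp_ge0.
(* The coefficient of the affine term is known at level [j], so the expectations of levels [j] and
   [j.+1] give the same sum against it. *)
pose u x := w x * cmax j g x `^ (q - 1).
have uj : adapted c j u.
  by move=> x y xy; rewrite /u (wj x y)// (adapted_cmax g xy).
rewrite [leLHS](_ : _ = \sum_x w x * cmax j g x `^ q -
    q / (q - 1) * \sum_x u x * cexp c j.+1 g x); last first.
  by rewrite mulr_sumr -sumrB; apply: eq_bigr => x _; rewrite /potential /u; ring.
rewrite [leRHS](_ : _ = \sum_x w x * cmax j g x `^ q -
    q / (q - 1) * \sum_x u x * cexp c j g x); last first.
  by rewrite mulr_sumr -sumrB; apply: eq_bigr => x _; rewrite /potential /u; ring.
by rewrite !(sum_cexp F)//; exact: (adapted_le F (leqnSn _)).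
Qed.

Lemma potential_le q i j g w : (i <= j)%N ->
  (1 < q /\ forall x, 0 <= g x) \/ (0 <= q < 1 /\ forall x, 0 < g x) ->
  adapted c i w -> (forall x, 0 <= w x) ->
  \sum_x w x * potential q (cexp c j g x) (cmax j g x) <=
  \sum_x w x * potential q (cexp c i g x) (cmax i g x).
Proof.
move=> /subnK <- qg wi w0; elim: (j - i)%N => [//|k IH].
rewrite addSn; apply: le_trans IH; apply: potential_step => //.
exact: (adapted_le F (leq_addl k i)).
Qed.

(** For [d < 1] the factor [d / (d - 1)] is nonpositive, so the potential dominates the power of the
    maximum at level [j]. At level [i] the martingale is at most its maximum, which leaves the
    factor [1 - d / (d - 1) = (1 - d)^-1]. The adapted weight makes this an inequality conditional
    on level [i]. *)
Lemma kolmogorov_maximal d i j g w : (i <= j)%N -> 0 <= d < 1 ->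
  (forall x, 0 < g x) -> adapted c i w -> (forall x, 0 <= w x) ->
  \sum_x w x * cmax j g x `^ d <= (1 - d)^-1 * \sum_x w x * cmax i g x `^ d.
Proof.
move=> ij d01 g0 wi w0; have g0' x : 0 <= g x by exact: ltW.
have dN0 : d / (d - 1) <= 0.
  by rewrite mulr_ge0_le0 ?invr_le0//; lra.
apply: (@le_trans _ _
    (\sum_x w x * potential d (cexp c j g x) (cmax j g x))).
  apply: ler_sum => x _; rewrite ler_wpM2l// /potential lerBrDr gerDl.
  by rewrite mulr_le0_ge0// mulr_ge0 ?powR_ge0// cexp_ge0.
apply: (le_trans (potential_le ij _ wi w0)); first by right.
rewrite mulr_sumr; apply: ler_sum => x _; rewrite mulrCA ler_wpM2l// /potential.
have G0 := cmax_gt0 i x g0.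
have : cexp c i g x * cmax i g x `^ (d - 1) <= cmax i g x `^ d.
  rewrite (@le_trans _ _ (cmax i g x * cmax i g x `^ (d - 1)))//.
    by rewrite ler_wpM2r ?powR_ge0// cexp_le_cmax_self.
  by rewrite -{1}(powRr1 (ltW G0)) powR_mulD// subrKC.
have -> : (1 - d)^-1 = 1 - d / (d - 1).
  by field; apply/andP; split; apply/eqP; lra.
by rewrite mulrBl mul1r lerD2l lerN2 => ?; rewrite ler_wnM2l.
Qed.

Lemma doob_maximal q j g : 1 < q -> (forall x, 0 <= g x) ->
  \sum_x cmax j g x `^ q <= (2 * (q / (q - 1))) `^ q * \sum_x g x `^ q.
Proof.
move=> q1 g0; set k := q / (q - 1).
have k0 : 0 < k by rewrite divr_gt0//; lra.
(* At level 0 the martingale equals its maximum, and [1 - k <= 0] makes the initial potential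
   nonpositive. *)
have : \sum_x 1 * potential q (cexp c j g x) (cmax j g x) <= 0.
  apply: (@le_trans _ _
      (\sum_x 1 * potential q (cexp c 0 g x) (cmax 0 g x))).
    by apply: potential_le => //; left.
  apply: sumr_le0 => x _; rewrite mul1r /potential /= -/k.
  rewrite mulr_powRB1 ?cexp_ge0//; last lra.
  rewrite -[X in X - _]mul1r -mulrBl mulr_le0_ge0 ?powR_ge0// subr_le0.
  by rewrite ler_pdivlMr; lra.
rewrite [leLHS](_ : _ = \sum_x cmax j g x `^ q -
    k * \sum_x (cmax j g x `^ (q - 1)) * cexp c j g x); last first.
  by rewrite mulr_sumr -sumrB; apply: eq_bigr => x _; rewrite /potential -/k; ring.
rewrite (sum_cexp F); last first.
  by move=> x y xy; rewrite (adapted_cmax g xy).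
set S := \sum_x cmax j g x `^ q; rewrite subr_le0 => SE.
(* Young's inequality with [e = (2 * k)^-1] lets half of [S] be absorbed; what remains is the
   constant [2 * k * (2 * k) ^ (q - 1)]. *)
have : \sum_x cmax j g x `^ (q - 1) * g x <=
    (2 * k)^-1 * S + (2 * k)^-1 `^ (1 - q) * \sum_x g x `^ q.
  rewrite !mulr_sumr -big_split/=; apply: ler_sum => x _.
  rewrite mulrC; apply: young_eps => //; last exact: cmax_ge0.
  by rewrite invr_gt0 mulr_gt0.
move=> /(ler_wpM2l (ltW k0)) /(le_trans SE).
rewrite mulrDr mulrA.
have -> : k * (2 * k)^-1 = 2^-1 by field; rewrite gt_eqF.
rewrite -(powR_inv1 (_ : 0 <= 2 * k)); last by rewrite mulr_ge0 ?ltW.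
rewrite -powRrM.
have -> : -1 * (1 - q) = q - 1 by ring.
rewrite -(@mulr_powRB1 _ (2 * k) q); [|by rewrite mulr_ge0 ?ltW|lra].
lra.
Qed.

(** Orthogonality of martingale differences: [w * cexp c m f] is known at level [m], so in the cross
    term [cexp c m.+1 f] may be replaced by [cexp c m f]. *)
Lemma energy_identity m f w : adapted c m w ->
  \sum_x w x * mdiff m f x ^+ 2 =
  \sum_x w x * cexp c m.+1 f x ^+ 2 - \sum_x w x * cexp c m f x ^+ 2.
Proof.
move=> wm.
have wfm : adapted c m (fun x => w x * cexp c m f x).
  by move=> x y xy; rewrite (wm x y)// (adapted_cexp F f xy).
have E : \sum_x w x * cexp c m f x * cexp c m.+1 f x =
    \sum_x w x * cexp c m f x * cexp c m f x.
  by rewrite !(sum_cexp F)//; exact: (adapted_le F (leqnSn _)).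
transitivity (\sum_x w x * cexp c m.+1 f x ^+ 2 + \sum_x w x * cexp c m f x ^+ 2
    - 2 * \sum_x w x * cexp c m f x * cexp c m.+1 f x).
  rewrite mulr_sumr -big_split -sumrB/=.
  by apply: eq_bigr => x _; rewrite /mdiff; ring.
rewrite E.
have -> : \sum_x w x * cexp c m f x ^+ 2 =
    \sum_x w x * cexp c m f x * cexp c m f x.
  by apply: eq_bigr => x _; ring.
ring.
Qed.

(** The dyadic counterpart of the squared intrinsic square function, with [t] in the role of
    [2 ^ (- alpha)]. Since absolute values of differences are averaged over coarser atoms,
    orthogonality alone is not enough: the averages have to be controlled in weighted [L^2]. *)
Definition square_function t N f x : R :=
  \sum_(j < N) (\sum_(m < N | (j <= m)%N)
    t ^+ (m - j) * cexp c j (fun y => `|mdiff m f y|) x) ^+ 2.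

Lemma square_function_ge0 t N f x : 0 <= square_function t N f x.
Proof. by apply: sumr_ge0 => j _; exact: sqr_ge0. Qed.

(** Cauchy-Schwarz in [m] with the weights [t ^ (m - j)], then summation over [j]: each of the two
    geometric series costs a factor [(1 - t)^-1]. What remains to be supplied is a bound for one
    pair of levels, uniform in [j]. *)
Lemma sum_square_function_le t N f w k (e : nat -> R) : 0 < t < 1 ->
  0 <= k -> (forall m, 0 <= e m) -> (forall x, 0 <= w x) ->
  (forall j m, (j <= m < N)%N ->
    \sum_x w x * cexp c j (fun y => `|mdiff m f y|) x ^+ 2 <= k * e m) ->
  \sum_x w x * square_function t N f x <=
    k * (1 - t) ^- 2 * \sum_(m < N) e m.
Proof.
move=> t01 k0 e0 w0 H; have /andP[t0 t1] := t01.
have t1' : 0 <= (1 - t)^-1 by rewrite invr_ge0 subr_ge0 ltW.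
pose a j m x := cexp c j (fun y => `|mdiff m f y|) x.
have CS x j : (\sum_(m < N | (j <= m)%N) t ^+ (m - j) * a j m x) ^+ 2 <=
    (1 - t)^-1 * \sum_(m < N | (j <= m)%N) t ^+ (m - j) * a j m x ^+ 2.
  have := @cauchy_schwarz_sum R _ (index_enum 'I_N) (fun m => (j <= m)%N)
    (fun m => t ^+ (m - j)) (fun=> 1) (fun m => a j m x)
    (fun m => exprn_ge0 _ (ltW t0)).
  under eq_bigr do rewrite mul1r.
  move=> /le_trans; apply; rewrite ler_wpM2r//.
    by apply: sumr_ge0 => m _; rewrite mulr_ge0 ?sqr_ge0// exprn_ge0// ltW.
  under eq_bigr do rewrite expr1n mulr1.
  exact: sum_geo_ge.
apply: (@le_trans _ _ (\sum_x \sum_(j < N) \sum_(m < N | (j <= m)%N)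
    (1 - t)^-1 * t ^+ (m - j) * (w x * a j m x ^+ 2))).
  apply: ler_sum => x _; rewrite mulr_sumr; apply: ler_sum => j _.
  rewrite (le_trans (ler_wpM2l (w0 x) (CS x j)))// !mulr_sumr.
  by apply: ler_sum => m _; rewrite le_eqVlt; apply/orP; left; apply/eqP; ring.
rewrite exchange_big/=.
apply: (@le_trans _ _ (\sum_(j < N) \sum_(m < N | (j <= m)%N)
    (1 - t)^-1 * t ^+ (m - j) * (k * e m))).
  apply: ler_sum => j _; rewrite exchange_big/=; apply: ler_sum => m jm.
  rewrite -mulr_sumr ler_wpM2l//; last by apply: H; rewrite jm/=.
  by rewrite mulr_ge0// exprn_ge0// ltW.
rewrite (exchange_big_dep predT)//= mulr_sumr; apply: ler_sum => m _.
rewrite -mulr_suml -mulr_sumr expr2 invfM.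
rewrite [leRHS](_ : _ = (1 - t)^-1 * (1 - t)^-1 * (k * e m)); last by ring.
rewrite ler_wpM2r ?mulr_ge0// ler_wpM2l//.
exact: sum_geo_le.
Qed.

End maximal_process.

(** * The dyadic square function on [L^p] *)

Lemma powR_add_le (R : realType) (q a b : R) : 0 <= q -> 0 <= a -> 0 <= b ->
  (a + b) `^ q <= 2 `^ q * (a `^ q + b `^ q).
Proof.
move=> q0 a0 b0; have [ab|/ltW ba] := leP a b.
  rewrite (@le_trans _ _ ((2 * b) `^ q))//.
    by apply: le_powR => //; [rewrite addr_ge0|lra].
  by rewrite powRM// ler_wpM2l ?powR_ge0// lerDr powR_ge0.
rewrite (@le_trans _ _ ((2 * a) `^ q))//.
  by apply: le_powR => //; [rewrite addr_ge0|lra].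
by rewrite powRM// ler_wpM2l ?powR_ge0// lerDl powR_ge0.
Qed.

(** In terms of the ratio [c / a >= 1] the left side is [c ^ (2 - d) * ((c / a) ^ d - 1)], and
    [d < 2 - d] allows the exponent to be raised. For consecutive values of a running maximum the
    right side telescopes. *)
Lemma powR_jump_le (R : realType) (d b a c : R) :
  0 <= d < 1 -> 0 < a -> a <= c -> c <= b * a ->
  c ^+ 2 * (a `^ (- d) - c `^ (- d)) <= b `^ (2 - d) * (c `^ (2 - d) - a `^ (2 - d)).
Proof.
move=> /andP[d0 d1] a0 ac cba; have c0 := lt_le_trans a0 ac.
have b0 : 0 <= b by rewrite -(pmulr_lge0 _ a0); exact: le_trans (ltW c0) cba.
set p := 2 - d; have p0 : 0 <= p by rewrite /p; lra.
have -> : c ^+ 2 * (a `^ (- d) - c `^ (- d)) = c `^ p * ((c / a) `^ d - 1).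
  rewrite -powR_mulrn ?(ltW c0)// mulrBr powR_mulD//.
  have -> : c `^ 2 = c `^ p * c `^ d by rewrite powR_mulD//; congr (_ `^ _); rewrite /p; ring.
  by rewrite powRM ?invr_ge0 ?(ltW c0) ?(ltW a0)// -powR_inv1 ?(ltW a0)// -powRrM mulN1r; ring.
have ca1 : 1 <= c / a by rewrite ler_pdivlMr// mul1r.
have h1 : 0 <= (c / a) `^ d - 1.
  by rewrite subr_ge0 -(powRr0 (c / a)) ler_powR.
apply: (@le_trans _ _ ((b * a) `^ p * ((c / a) `^ d - 1))).
  by rewrite ler_wpM2r// le_powR// ltW.
rewrite powRM ?(ltW a0)// -mulrA ler_wpM2l ?powR_ge0//.
have -> : c `^ p - a `^ p = a `^ p * ((c / a) `^ p - 1).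
  rewrite mulrBr mulr1 -powRM ?(ltW a0) ?(le_trans ler01)//.
  by rewrite mulrC divfK// gt_eqF.
by rewrite ler_wpM2l ?powR_ge0// lerD2r ler_powR// /p; lra.
Qed.

Section square_function_bound.
Context {R : realType} {Om : finType} {I : finType} {c : nat -> rel Om} {b : R}.
Context (F : regular_filtration c b).
Implicit Types (g h w v : Om -> R) (x y : Om) (f : I -> Om -> R).

(** Let [Y] be the average. Since [Y] and the weight of level [j] are adapted, one factor [Y] may be
    replaced by [|h|]. The product is split by the arithmetic-geometric mean with the weights
    [cmax c m g ^ (- d)] and [cmax c m g ^ d]; Kolmogorov's inequality brings the latter back to
    level [j], where its term is absorbed. *)
Lemma weighted_cexp_le d j m g h : (j <= m)%N -> 0 <= d < 1 ->
  (forall x, 0 < g x) ->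
  \sum_x cmax c j g x `^ (- d) * cexp c j (fun y => `|h y|) x ^+ 2 <=
  (1 - d)^-1 * \sum_x cmax c m g x `^ (- d) * h x ^+ 2.
Proof.
move=> jm d01 g0; set K := (1 - d)^-1; set Y := cexp c j _.
have K0 : 0 < K by rewrite invr_gt0; lra.
have G0 i x := cmax_gt0 F i x g0.
have YE : \sum_x cmax c j g x `^ (- d) * Y x ^+ 2 =
    \sum_x cmax c j g x `^ (- d) * Y x * `|h x|.
  rewrite -[RHS](sum_cexp F (j := j)); last first.
    by move=> x y xy; rewrite (adapted_cmax F g xy) /Y (adapted_cexp F _ xy).
  by apply: eq_bigr => x _; rewrite expr2 mulrA.
have := @kolmogorov_maximal _ _ _ _ F d j m g
  (fun x => cmax c j g x `^ (- (2 * d)) * Y x ^+ 2) jm d01 g0.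
move=> /(_ _ _)/le_trans; move: YE; rewrite -/K.
set A := \sum_x _ => AE H.
have {}H : \sum_x cmax c j g x `^ (- (2 * d)) * Y x ^+ 2 * cmax c m g x `^ d <=
    K * A.
  apply: H; first by move=> x y xy; rewrite (adapted_cmax F g xy) /Y (adapted_cexp F _ xy).
    by move=> x; rewrite mulr_ge0 ?powR_ge0 ?sqr_ge0.
  rewrite ler_pM2l//; apply: ler_sum => x _.
  rewrite mulrAC powR_mulD//.
  by have -> : - (2 * d) + d = - d by ring.
have : 2 * A <= K * (\sum_x cmax c m g x `^ (- d) * h x ^+ 2) + K^-1 *
   \sum_x cmax c j g x `^ (- (2 * d)) * Y x ^+ 2 * cmax c m g x `^ d.
  rewrite AE !mulr_sumr -big_split/=; apply: ler_sum => x _.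
  have -> : cmax c m g x `^ (- d) = (cmax c m g x `^ d)^-1 by rewrite powRN.
  have -> : cmax c j g x `^ (- (2 * d)) = (cmax c j g x `^ (- d)) ^+ 2.
    by rewrite -powR_mulrn ?powR_ge0// -powRrM; congr (_ `^ _); ring.
  rewrite -[h x ^+ 2]real_normK ?num_real//.
  move: (cmax c j g x `^ (- d)) (powR_gt0 d (G0 m x)) => u; move: (cmax c m g x `^ d) => s s0.
  have : 0 <= (K * `|h x| - u * Y x * s) ^+ 2 by rewrite sqr_ge0.
  rewrite -(@ler_pM2l _ (K * s)) ?mulr_gt0// => H'; rewrite -subr_ge0.
  rewrite [leRHS](_ : _ = (K * `|h x| - u * Y x * s) ^+ 2)//.
  by field; rewrite !gt_eqF.
have : K^-1 * (\sum_x cmax c j g x `^ (- (2 * d)) * Y x ^+ 2 * cmax c m g x `^ d) <= A.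
  by rewrite -(@ler_pM2l _ K)// mulVKf// gt_eqF.
lra.
Qed.

(* With the weights [cmax m g ^ (p - 2)] on the energies of [mdiff m], summation
   by parts leaves only [\sum_x cmax N g x ^ p]. *)
Lemma sum_square_function_small p t N f g : 1 < p <= 2 -> 0 < t < 1 ->
  (forall x, 0 < g x) -> (forall x, \sum_i f i x ^+ 2 <= g x ^+ 2) ->
  \sum_x (\sum_i square_function c t N (f i) x) `^ (p / 2) <=
  ((p - 1)^-1 * (1 - t) ^- 2 * (1 + b `^ p) + 1) *
    (2 * (p / (p - 1))) `^ p * \sum_x g x `^ p.
Proof.
move=> /andP[p1 p2] t01 g0 fg; set d := 2 - p.
have d01 : 0 <= d < 1 by rewrite /d; lra.
have g0' x : 0 <= g x by exact: ltW.
have G0 i x := cmax_gt0 F i x g0.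
set U := fun x => \sum_i square_function c t N (f i) x.
have U0 x : 0 <= U x by apply: sumr_ge0 => i _; exact: square_function_ge0.
pose e i m := \sum_x cmax c m g x `^ (- d) * mdiff c m (f i) x ^+ 2.
have K0 : 0 < (p - 1)^-1 by rewrite invr_gt0; lra.
have dE : (1 - d)^-1 = (p - 1)^-1 by rewrite /d; congr (_^-1); ring.
have GG x i : cmax c i g x `^ (- d) * cmax c i g x ^+ 2 = cmax c i g x `^ p.
  rewrite -powR_mulrn ?(ltW (G0 _ _))// powR_mulD//.
  by congr (_ `^ _); rewrite /d; ring.
have FG m x : \sum_i cexp c m (f i) x ^+ 2 <= cmax c m g x ^+ 2.
  apply: (le_trans (sum_sqr_cexp_le F m x fg g0')).
  by rewrite ler_sqr ?nnegrE ?cexp_le_cmax_self// ?(ltW (G0 _ _))// cexp_ge0.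
have parts k : \sum_(m < k) \sum_i e i m <=
    \sum_x cmax c k g x `^ (- d) * (\sum_i cexp c k (f i) x ^+ 2) +
    b `^ p * \sum_x (cmax c k g x `^ p - cmax c 0 g x `^ p).
  elim: k => [|k IH].
    rewrite big_ord0 [X in _ + _ * X]big1 => [|x _]; last by rewrite subrr.
    rewrite mulr0 addr0.
    apply: sumr_ge0 => x _; rewrite mulr_ge0 ?powR_ge0// sumr_ge0// => i _.
    exact: sqr_ge0.
  rewrite big_ord_recr/=.
  have -> : \sum_i e i k =
      \sum_x cmax c k g x `^ (- d) * (\sum_i cexp c k.+1 (f i) x ^+ 2) -
      \sum_x cmax c k g x `^ (- d) * (\sum_i cexp c k (f i) x ^+ 2).
    under eq_bigr => i _.
      rewrite /e (energy_identity F); last first.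
        by move=> x y xy; rewrite (adapted_cmax F g xy).
      over.
    by rewrite sumrB; congr (_ - _); rewrite exchange_big/=;
      apply: eq_bigr => x _; rewrite mulr_sumr.
  (* Replacing the weight of level [k] by that of level [k.+1] costs an increment of [cmax ^ p];
     regularity supplies the bound [b] on the ratio of consecutive maxima. *)
  have jump : \sum_x cmax c k g x `^ (- d) * (\sum_i cexp c k.+1 (f i) x ^+ 2) <=
      \sum_x cmax c k.+1 g x `^ (- d) * (\sum_i cexp c k.+1 (f i) x ^+ 2) +
      b `^ p * \sum_x (cmax c k.+1 g x `^ p - cmax c k g x `^ p).
    rewrite mulr_sumr -big_split; apply: ler_sum => x _.
    rewrite -lerBlDl -mulrBl.
    have pE : p = 2 - d by rewrite /d; ring.
    apply: (@le_trans _ _ ((cmax c k g x `^ (- d) - cmax c k.+1 g x `^ (- d)) *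
        cmax c k.+1 g x ^+ 2)).
      rewrite ler_wpM2l ?FG// subr_ge0 le_powRN ?cmax_homo//.
      by rewrite oppr_le0; case/andP: d01.
    rewrite mulrC pE; apply: powR_jump_le => //; first exact: cmax_homo.
    exact: (cmax_reg F).
  move: IH jump; rewrite !sumrB !mulrBr; lra.
have weighted : \sum_x cmax c N g x `^ (- d) * U x <=
    (p - 1)^-1 * (1 - t) ^- 2 * (1 + b `^ p) * \sum_x cmax c N g x `^ p.
  apply: (@le_trans _ _ (\sum_i ((p - 1)^-1 * (1 - t) ^- 2 * \sum_(m < N) e i m))).
    under eq_bigr do rewrite mulr_sumr; rewrite exchange_big/=.
    apply: ler_sum => i _; apply: sum_square_function_le => //.
    - exact: ltW.
    - by move=> m; apply: sumr_ge0 => x _; rewrite mulr_ge0 ?powR_ge0 ?sqr_ge0.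
    - by move=> x; exact: powR_ge0.
    move=> j m /andP[jm mN]; rewrite -dE.
    apply: le_trans (weighted_cexp_le _ jm d01 g0).
    apply: ler_sum => x _; rewrite ler_wpM2r ?sqr_ge0// le_powRN//.
      by rewrite oppr_le0; case/andP: d01.
    by rewrite cmax_homo// (leq_trans jm)// ltnW.
  rewrite -mulr_sumr exchange_big/= -[leRHS]mulrA ler_wpM2l//.
    by rewrite mulr_ge0 ?(ltW K0)// invr_ge0 sqr_ge0.
  apply: (le_trans (parts N)); rewrite mulrDl mul1r lerD//.
    by apply: ler_sum => x _; rewrite -GG ler_wpM2l ?powR_ge0.
  rewrite ler_wpM2l ?powR_ge0//; apply: ler_sum => x _.
  by rewrite gerBl powR_ge0.
(* [U ^ (p / 2)] is [(G ^ (- d) * U) ^ (p / 2) * (G ^ p) ^ (1 - p / 2)], where the powers of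
   [G = cmax c N g] cancel because [d = 2 - p]. *)
have interp : \sum_x U x `^ (p / 2) <=
    \sum_x cmax c N g x `^ (- d) * U x + \sum_x cmax c N g x `^ p.
  rewrite -big_split; apply: ler_sum => x _.
  have p2' : 0 <= p / 2 <= 1 by lra.
  have := interpolate_le_add p2' (mulr_ge0 (powR_ge0 (cmax c N g x) (- d)) (U0 x))
    (powR_ge0 (cmax c N g x) p).
  apply: le_trans.
  rewrite powRM ?powR_ge0// -!powRrM mulrAC powR_mulD//.
  rewrite (_ : - d * (p / 2) + p * (1 - p / 2) = 0) ?powRr0 ?mul1r//.
  by rewrite /d; field.
apply: (le_trans interp); apply: (le_trans (lerD weighted (lexx _))).
rewrite -{2}[\sum_x cmax c N g x `^ p]mul1r -mulrDl -[leRHS]mulrA ler_wpM2l//.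
  by rewrite addr_ge0// mulr_ge0 ?addr_ge0 ?powR_ge0// mulr_ge0 ?(ltW K0)// invr_ge0 sqr_ge0.
exact: (doob_maximal F).
Qed.

(** A Fefferman-Stein inequality. The average [Y] is known at level [j], so [v] may be replaced by
    its expectation [E], then one factor [Y] by [|h|], and half of the sum is absorbed. [cmax c m v]
    dominates [E] for all [j <= m] at once. *)
Lemma maximal_cexp_le j m v h : (j <= m)%N -> (forall x, 0 <= v x) ->
  \sum_x v x * cexp c j (fun y => `|h y|) x ^+ 2 <=
  \sum_x cmax c m v x * h x ^+ 2.
Proof.
move=> jm v0; set Y := cexp c j _; set E := cexp c j v.
have Ej : adapted c j E by exact: (adapted_cexp F).
have Yj : adapted c j Y by exact: (adapted_cexp F).
have E0 x : 0 <= E x by exact: cexp_ge0.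
have vE : \sum_x v x * Y x ^+ 2 = \sum_x E x * Y x ^+ 2.
  under eq_bigr do rewrite mulrC; rewrite -[LHS](sum_cexp F (j := j)).
    by apply: eq_bigr => x _; rewrite mulrC.
  by move=> x y xy; rewrite (Yj x y).
have EE : \sum_x E x * Y x ^+ 2 = \sum_x E x * Y x * `|h x|.
  rewrite -[RHS](sum_cexp F (j := j)); last by move=> x y xy; rewrite (Ej x y)// (Yj x y).
  by apply: eq_bigr => x _; rewrite expr2 mulrA.
rewrite vE; apply: (@le_trans _ _ (\sum_x E x * h x ^+ 2)); last first.
  by apply: ler_sum => x _; rewrite ler_wpM2r ?sqr_ge0// cexp_le_cmax.
have : 2 * (\sum_x E x * Y x * `|h x|) <=
    \sum_x E x * h x ^+ 2 + \sum_x E x * Y x ^+ 2.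
  rewrite mulr_sumr -big_split; apply: ler_sum => x _.
  rewrite -[h x ^+ 2]real_normK ?num_real//= -mulrDr.
  rewrite [leLHS](_ : _ = E x * (2 * (Y x * `|h x|))); last by ring.
  rewrite ler_wpM2l//.
  have : 0 <= (Y x - `|h x|) ^+ 2 by rewrite sqr_ge0.
  by rewrite sqrrB; lra.
by rewrite -EE; lra.
Qed.

(* Write [U ^ (p / 2) = V * U] with [V = U ^ (p / 2 - 1)]: by Doob's inequality
   for [V] and Young's inequality, part of the bound is absorbed in the left
   side. *)
Lemma sum_square_function_large p t N f g
    (K := (1 - t) ^- 2) (q := p / 2 / (p / 2 - 1)) : 2 < p -> 0 < t < 1 ->
  (forall x, 0 <= g x) -> (forall x, \sum_i f i x ^+ 2 <= g x ^+ 2) ->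
  \sum_x (\sum_i square_function c t N (f i) x) `^ (p / 2) <=
  2 * K * (2 * K * (2 * (q / (q - 1))) `^ q)^-1 `^ (1 - p / 2) *
    (2 * (p / (p - 1))) `^ p * \sum_x g x `^ p.
Proof.
move=> p2 t01 g0 fg; set r := p / 2.
have r1 : 1 < r by rewrite /r; lra.
have qE : q = r / (r - 1) by [].
have q1 : 1 < q by rewrite qE ltr_pdivlMr; lra.
have K0 : 0 < K by rewrite invr_gt0 exprn_gt0//; lra.
set Dq := (2 * (q / (q - 1))) `^ q.
have Dq0 : 0 < Dq by rewrite powR_gt0// mulr_gt0// divr_gt0//; lra.
set U := fun x => \sum_i square_function c t N (f i) x.
have U0 x : 0 <= U x by apply: sumr_ge0 => i _; exact: square_function_ge0.
pose V x := U x `^ (r - 1).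
have V0 x : 0 <= V x by exact: powR_ge0.
have Vm0 m x : 0 <= cmax c m V x by exact: cmax_ge0.
pose e i m := \sum_x cmax c m V x * mdiff c m (f i) x ^+ 2.
have FG m x : \sum_i cexp c m (f i) x ^+ 2 <= cmax c m g x ^+ 2.
  apply: (le_trans (sum_sqr_cexp_le F m x fg g0)).
  by rewrite ler_sqr ?nnegrE ?cexp_le_cmax_self ?cexp_ge0// cmax_ge0.
(* The weight [cmax c k V] increases with [k], so its change has the favourable sign in the
   summation by parts. *)
have parts k : \sum_(m < k) \sum_i e i m <=
    \sum_x cmax c k V x * (\sum_i cexp c k (f i) x ^+ 2).
  elim: k => [|k IH].
    rewrite big_ord0; apply: sumr_ge0 => x _; rewrite mulr_ge0//.
    by apply: sumr_ge0 => i _; exact: sqr_ge0.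
  rewrite big_ord_recr/=.
  have -> : \sum_i e i k =
      \sum_x cmax c k V x * (\sum_i cexp c k.+1 (f i) x ^+ 2) -
      \sum_x cmax c k V x * (\sum_i cexp c k (f i) x ^+ 2).
    under eq_bigr => i _.
      by rewrite /e (energy_identity F); [over|exact: (adapted_cmax F)].
    by rewrite sumrB; congr (_ - _); rewrite exchange_big/=;
      apply: eq_bigr => x _; rewrite mulr_sumr.
  apply: (@le_trans _ _ (\sum_x cmax c k V x * (\sum_i cexp c k.+1 (f i) x ^+ 2))).
    by move: IH; lra.
  apply: ler_sum => x _; rewrite ler_wpM2r ?le_max ?lexx//.
  by apply: sumr_ge0 => i _; exact: sqr_ge0.
have VU : \sum_x V x * U x = \sum_x U x `^ r.
  by apply: eq_bigr => x _; rewrite mulrC mulr_powRB1//; lra.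
(* [q] is conjugate to [r], that is [(r - 1) * q = r]; hence Doob's inequality for [V] leads back to
   the sum to be bounded. *)
have Vq : \sum_x V x `^ q = \sum_x U x `^ r.
  apply: eq_bigr => x _; rewrite -powRrM; congr (_ `^ _).
  by rewrite qE; field; apply/eqP; lra.
have main : \sum_x U x `^ r <= K * \sum_x cmax c N V x * cmax c N g x ^+ 2.
  rewrite -VU; apply: (@le_trans _ _ (\sum_i (1 * K * \sum_(m < N) e i m))).
    under eq_bigr do rewrite mulr_sumr; rewrite exchange_big/=.
    apply: ler_sum => i _; apply: sum_square_function_le => //.
      by move=> m; apply: sumr_ge0 => x _; rewrite mulr_ge0 ?sqr_ge0.
    by move=> j m /andP[jm mN]; rewrite mul1r maximal_cexp_le.
  rewrite -mulr_sumr exchange_big/= mul1r ler_wpM2l ?(ltW K0)//.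
  apply: (le_trans (parts N)); apply: ler_sum => x _.
  by rewrite ler_wpM2l.
(* Chosen so that [K * eps * Dq = 1 / 2], for the absorption at the end. *)
set eps := (2 * K * Dq)^-1.
have eps0 : 0 < eps by rewrite invr_gt0 !mulr_gt0.
have split : \sum_x cmax c N V x * cmax c N g x ^+ 2 <=
    eps * \sum_x cmax c N V x `^ q + eps `^ (1 - r) * \sum_x cmax c N g x `^ p.
  rewrite !mulr_sumr -big_split; apply: ler_sum => x _.
  have := young_eps r1 eps0 (sqr_ge0 (cmax c N g x)) (powR_ge0 (cmax c N V x) (r - 1)^-1).
  rewrite -!powRrM mulVf ?powRr1//; last by apply/eqP; lra.
  rewrite mulrC -powR_mulrn ?cmax_ge0// -powRrM.
  rewrite (_ : 2 * r = p); last by rewrite /r; field.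
  by rewrite (_ : (r - 1)^-1 * r = q)// qE mulrC.
have DV : \sum_x cmax c N V x `^ q <= Dq * \sum_x U x `^ r.
  by rewrite -Vq; apply: (doob_maximal F).
have Dg : \sum_x cmax c N g x `^ p <= (2 * (p / (p - 1))) `^ p * \sum_x g x `^ p.
  by apply: (doob_maximal F) => //; lra.
set S := \sum_x U x `^ r in VU Vq main DV *.
have : eps * \sum_x cmax c N V x `^ q <= (2 * K)^-1 * S.
  apply: (le_trans (ler_wpM2l (ltW eps0) DV)).
  rewrite le_eqVlt; apply/orP; left; apply/eqP; rewrite /eps.
  by field; rewrite !gt_eqF.
set X := \sum_x cmax c N V x `^ q in split DV *.
set Y := \sum_x cmax c N g x `^ p in split Dg *.
move=> epsX.
have : S <= K * ((2 * K)^-1 * S + eps `^ (1 - r) * Y).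
  apply: (le_trans main); rewrite ler_wpM2l ?(ltW K0)//.
  by apply: (le_trans split); rewrite lerD2r.
rewrite mulrDr mulrA (_ : K * (2 * K)^-1 = 2^-1); last by field; rewrite gt_eqF.
move=> SY; have {}SY : S <= 2 * K * eps `^ (1 - r) * Y by lra.
apply: (le_trans SY); rewrite -[leRHS]mulrA ler_wpM2l// mulr_ge0 ?powR_ge0//.
by rewrite mulr_ge0// ltW.
Qed.

End square_function_bound.

(** [C] is chosen before the set, the family and the depth, so it is uniform in all of them. For
    [p <= 2] negative powers of the maximum occur, so the dominating function is made positive by a
    small perturbation. *)
Theorem square_function_Lp (R : realType) (p t b : R) :
  1 < p -> 0 < t < 1 ->
  exists2 C : R, 0 < C & forall (Om I : finType) (c : nat -> rel Om) N
      (f : I -> Om -> R), regular_filtration c b ->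
    \sum_x (\sum_i square_function c t N (f i) x) `^ (p / 2) <=
    C * \sum_x (\sum_i f i x ^+ 2) `^ (p / 2).
Proof.
move=> p1 t01; have p0 : 0 < p by lra.
have sqrtE (a : R) : 0 <= a -> Num.sqrt a `^ p = a `^ (p / 2).
  by move=> a0; rewrite -powR12_sqrt// -powRrM mulrC.
have D0 : 0 < (2 * (p / (p - 1))) `^ p.
  by rewrite powR_gt0// mulr_gt0// divr_gt0//; lra.
have K0 : 0 < (1 - t) ^- 2 by rewrite invr_gt0 exprn_gt0//; lra.
have [p2|p2] := leP p 2; last first.
  have r1 : 1 < p / 2 by lra.
  set C := (2 * (1 - t) ^- 2 * (2 * (1 - t) ^- 2 *
    (2 * (p / 2 / (p / 2 - 1) / (p / 2 / (p / 2 - 1) - 1)))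
    `^ (p / 2 / (p / 2 - 1)))^-1 `^ (1 - p / 2) * (2 * (p / (p - 1))) `^ p).
  have q1 : 1 < p / 2 / (p / 2 - 1) by rewrite ltr_pdivlMr; lra.
  have C0 : 0 < C.
    rewrite !mulr_gt0// powR_gt0// invr_gt0 !mulr_gt0// powR_gt0// mulr_gt0//.
    by rewrite divr_gt0//; lra.
  exists C => // Om I c N f F.
  have f0 x : 0 <= \sum_i f i x ^+ 2 by apply: sumr_ge0 => i _; exact: sqr_ge0.
  have := @sum_square_function_large R Om I c b F p t N f
    (fun x => Num.sqrt (\sum_i f i x ^+ 2)) p2 t01 (fun x => sqrtr_ge0 _).
  move=> /(_ _)/le_trans; apply.
    by move=> x; rewrite sqr_sqrtr.
  rewrite -/C ler_wpM2l ?(ltW C0)//.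
  by apply: ler_sum => x _; rewrite sqrtE.
set C0 := ((p - 1)^-1 * (1 - t) ^- 2 * (1 + b `^ p) + 1) * (2 * (p / (p - 1))) `^ p.
have C00 : 0 < C0.
  rewrite mulr_gt0// ltr_wpDl// mulr_ge0 ?addr_ge0 ?powR_ge0// mulr_ge0 ?(ltW K0)//.
  by rewrite invr_ge0; lra.
have C1 : 0 < C0 * 2 `^ p by rewrite mulr_gt0 ?powR_gt0.
exists (C0 * 2 `^ p) => // Om I c N f F.
have f0 x : 0 <= \sum_i f i x ^+ 2 by apply: sumr_ge0 => i _; exact: sqr_ge0.
apply/ler_addgt0Pr => e e0.
have n0 : 0 < #|Om|%:R + 1 :> R by rewrite ltr_wpDl.
have eC0 : 0 < e / (C0 * 2 `^ p * (#|Om|%:R + 1)) by rewrite divr_gt0// mulr_gt0.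
(* The terms [eta ^ p], summed over [Om], must contribute at most [e]; the [+ 1] covers an empty
   [Om]. *)
pose eta := (e / (C0 * 2 `^ p * (#|Om|%:R + 1))) `^ p^-1.
have eta0 : 0 < eta by rewrite powR_gt0.
have etap : eta `^ p = e / (C0 * 2 `^ p * (#|Om|%:R + 1)).
  by rewrite -powRrM mulVf ?gt_eqF// powRr1// ltW.
have := @sum_square_function_small R Om I c b F p t N f
  (fun x => Num.sqrt (\sum_i f i x ^+ 2) + eta).
rewrite p1 p2 t01 => /(_ erefl erefl _ _)/le_trans; apply.
- by move=> x; rewrite ltr_wpDl ?sqrtr_ge0.
- move=> x; rewrite -{1}(sqr_sqrtr (f0 x)) ler_sqr ?nnegrE ?addr_ge0 ?sqrtr_ge0 ?(ltW eta0)//.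
  by rewrite lerDl ltW.
rewrite -/C0.
apply: (@le_trans _ _ (C0 * \sum_x 2 `^ p * ((\sum_i f i x ^+ 2) `^ (p / 2) + eta `^ p))).
  rewrite ler_wpM2l ?(ltW C00)//; apply: ler_sum => x _; rewrite -sqrtE//.
  by apply: powR_add_le; rewrite ?sqrtr_ge0 ?(ltW eta0) ?(ltW p0).
rewrite -mulr_sumr mulrA big_split/= mulrDr lerD2l sumr_const.
rewrite -(mulr_natr (eta `^ p)) etap.
rewrite [leLHS](_ : _ = e * (#|Om|%:R / (#|Om|%:R + 1))); last first.
  by field; rewrite !gt_eqF ?powR_gt0.
by rewrite ler_piMr ?(ltW e0)// ler_pdivrMr// mul1r lerDl.
Qed.

(** * Lebesgue measure of boxes *)

Section esum_lemmas.
Local Open Scope ereal_scope.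
Context {R : realType}.

Lemma esum_subset (T : choiceType) (D E : set T) (a : T -> \bar R) :
  (forall x, 0 <= a x) -> D `<=` E ->
  \esum_(x in D) a x <= \esum_(x in E) a x.
Proof.
move=> a0 DE; rewrite esum_mkcond [leRHS]esum_mkcond; apply: le_esum => x _.
case: ifPn => [/set_mem/DE/mem_set ->//|_].
by case: ifPn.
Qed.

(** As [e] may identify points, one preimage is chosen for each value and the other terms are
    dropped. *)
Lemma esum_image_le (T T' : choiceType) (D : set T) (e : T -> T')
    (a : T' -> \bar R) : (forall y, 0 <= a y) ->
  \esum_(y in e @` D) a y <= \esum_(x in D) a (e x).
Proof.
move=> a0; have [->|/set0P[x0 Dx0]] := eqVneq D set0; first by rewrite image_set0 !esum_set0.
  have /choice[s sP] y : exists x, (e @` D) y -> D x /\ e x = y.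
    have [[x Dx exy]|nDy] := pselect ((e @` D) y); first by exists x.
    by exists x0.
rewrite (@reindex_esum _ _ _ (s @` (e @` D)) (e @` D) e).
  apply: esum_subset => // _ [y yD <-].
  exact: (sP y yD).1.
split => [_ [y yD <-]|_ _ /set_mem[y yD <-] /set_mem[z zD <-]|y yD].
- by rewrite (sP y yD).2.
- by rewrite !(sP _ _).2// => ->.
- by exists (s y); [exists y|exact: (sP y yD).2].
Qed.

Lemma countable_esum (T : pointedType) (D : set T) (a : T -> \bar R) :
  countable D -> (forall x, 0 <= a x) ->
  exists e : nat -> T, exists B : set nat, [/\ set_bij B D e &
   \esum_(x in D) a x = \sum_(k <oo) (if k \in B then a (e k) else 0)].
Proof.
move=> /countable_bijP[B]; rewrite card_eq_sym => /card_set_bijP[e eB] a0.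
exists e, B; split => //; rewrite (@reindex_esum _ _ _ _ _ _ a eB) esum_mkcond.
by rewrite -nneseries_esumT// => k; case: ifP.
Qed.

End esum_lemmas.

Section box_measure.
Context {R : realType}.

(* The weights allow an induction on the dimension: slicing along the last
   coordinate multiplies the weight of a box by an indicator. *)
Lemma weighted_box_cover_le n (a b : nat -> R) (A B : nat -> nat -> R)
    (w : nat -> R) (c : R) : (forall k, 0 <= w k) -> 0 <= c ->
  (forall x : nat -> R, (forall i, (i < n)%N -> a i < x i <= b i) ->
    (c%:E <= \sum_(k <oo) (w k * \prod_(i < n) (A k i < x i <= B k i)%R%:R)%:E)%E) ->
  ((c * \prod_(i < n) Num.max 0 (b i - a i))%:E <=
    \sum_(k <oo) (w k * \prod_(i < n) Num.max 0 (B k i - A k i))%:E)%E.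
Proof.
elim: n w c => [|n IH] w c w0 c0 H.
  rewrite big_ord0 mulr1; apply: (le_trans (H a _)) => //.
  by apply: lee_nneseries => k _; rewrite ?lee_fin !big_ord0 ?mulr1.
have P0 m (u v : nat -> R) : 0 <= \prod_(i < m) Num.max 0 (u i - v i).
  by apply: prodr_ge0 => i _; rewrite le_max lexx.
have [ba|ab] := leP (b n) (a n).
  rewrite big_ord_recr/= (max_idPl _) ?subr_le0// !mulr0.
  by apply: nneseries_ge0 => k *; rewrite lee_fin mulr_ge0// (P0 _ (B k) (A k)).
have Pk k := mulr_ge0 (w0 k) (P0 n (B k) (A k)).
have Pc := mulr_ge0 c0 (P0 n b a).
(* For a fixed last coordinate [z] the induction hypothesis applies to the weights multiplied by the
   indicator of the last side of each box; integration over [z] then turns the indicators into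
   lengths. *)
have slice z : a n < z <= b n ->
    ((c * \prod_(i < n) Num.max 0 (b i - a i))%:E <= \sum_(k <oo)
      ((w k * \prod_(i < n) Num.max 0 (B k i - A k i)) *
        \1_(`]A k n, B k n]%classic) z)%:E)%E.
  move=> zab; have := IH (fun k => w k * (A k n < z <= B k n)%R%:R) c _ c0.
  move=> /(_ _ _)/le_trans; apply.
  - by move=> k; rewrite mulr_ge0 ?ler0n.
  - move=> x xab; have := H (fun i => if i == n then z else x i) _.
    move=> /(_ _)/le_trans; apply.
      move=> i; rewrite ltnS leq_eqVlt; case: eqVneq => [->|_]//=.
      exact: xab.
    apply: lee_nneseries => k _.
      by rewrite lee_fin mulr_ge0// prodr_ge0// => i _; rewrite ler0n.
    rewrite lee_fin big_ord_recr/= eqxx -mulrA ler_wpM2l//.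
    rewrite mulrC ler_wpM2l//; rewrite le_eqVlt; apply/orP; left; apply/eqP.
    by apply: eq_bigr => i _; rewrite (ltn_eqF (ltn_ord i)).
  - apply: lee_nneseries => k _; rewrite lee_fin.
      by rewrite !mulr_ge0// (P0 n (B k) (A k)).
    by rewrite indicE mem_setE/= in_itv/= mulrAC.
pose mu := @lebesgue_measure R; have muE u v : mu `]u, v]%classic = (Num.max 0 (v - u))%:E.
  rewrite [LHS]lebesgue_measure_itv/= lte_fin.
  case: ltP => uv; last by rewrite (max_idPl _)// subr_le0.
  by rewrite -EFinB (max_idPr _)// subr_ge0 ltW.
pose I : set (measurableTypeR R) := `]a n, b n]%classic.
have mI : measurable I by exact: measurable_itv.
have -> : (c * \prod_(i < n.+1) Num.max 0 (b i - a i))%:E =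
    (\int[mu]_(z in I) (c * \prod_(i < n) Num.max 0 (b i - a i))%:E)%E.
  by rewrite integral_cst// [X in (_ * X)%E]muE big_ord_recr/= -EFinM mulrA.
have mf k : measurable_fun I (fun z => ((w k * \prod_(i < n) Num.max 0 (B k i - A k i)) *
        \1_(`]A k n, B k n]%classic) z)%:E).
  by apply/measurable_EFinP; apply: measurable_funM => //; exact: measurable_indic.
apply: (@le_trans _ _ (\int[mu]_(z in I) (\sum_(k <oo)
      ((w k * \prod_(i < n) Num.max 0 (B k i - A k i)) *
        \1_(`]A k n, B k n]%classic) z)%:E))%E).
  apply: ge0_le_integral => //.
  by apply: ge0_emeasurable_sum => // k z *; rewrite lee_fin mulr_ge0.
rewrite integral_nneseries//; last by move=> k z _; rewrite lee_fin mulr_ge0.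
apply: lee_nneseries => [k *|k _].
  by apply: integral_ge0 => z *; rewrite lee_fin mulr_ge0.
under eq_integral do rewrite EFinM.
rewrite ge0_integralZl_EFin//; last first.
  by apply/measurable_EFinP; exact: measurable_indic.
rewrite integral_indic// big_ord_recr/= mulrA [leRHS]EFinM lee_wpmul2l ?lee_fin//.
apply: (@le_trans _ _ (mu `]A k n, B k n]%classic)).
  by apply: le_measure; rewrite ?inE//; exact: measurableI.
by rewrite muE.
Qed.

End box_measure.

Section lebesgue_box.
Context {R : realType} {n : nat}.
Implicit Types (q : 'rV[R]_n * 'rV[R]_n).
Local Open Scope ereal_scope.

Lemma box_volume_ge0 q : 0 <= box_volume q.
Proof. by rewrite lee_fin prodr_ge0// => i _; rewrite le_max lexx. Qed.

Lemma lebesgue_outer_le (A : set 'rV[R]_n) (Q : set ('rV[R]_n * 'rV[R]_n))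
    (h : 'rV[R]_n * 'rV[R]_n -> 'rV[R]_n * 'rV[R]_n) :
  countable Q -> A `<=` \bigcup_(q in Q) box (h q) ->
  lebesgue_outer A <= \esum_(q in Q) box_volume (h q).
Proof.
move=> cQ AQ; apply: le_trans (esum_image_le _ _ box_volume_ge0).
apply: ereal_inf_lbound; exists (h @` Q) => //; split.
  exact: sub_countable (card_image_le _ _) cQ.
by move=> x /AQ[q Qq qx]; exists (h q) => //; exists q.
Qed.

(** Caratheodory's criterion: the hyperplane cuts each box [q] of a cover into [lo q] and [up q],
    whose volumes add up to that of [q]; if it misses the box, one of them has volume zero. *)
Lemma measurable_halfspace (i : 'I_n) (c : R) :
  measurable [set x : 'rV[R]_n | (x ord0 i <= c)%R].
Proof.
apply: le_caratheodory_measurable => X.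
pose lo q : 'rV[R]_n * 'rV[R]_n :=
  (q.1, \row_j if j == i then Num.min (q.2 ord0 j) c else q.2 ord0 j).
pose up q : 'rV[R]_n * 'rV[R]_n :=
  (\row_j if j == i then Num.max (q.1 ord0 j) c else q.1 ord0 j, q.2).
have volE q : box_volume (lo q) + box_volume (up q) = box_volume q.
  rewrite /box_volume -EFinD; congr EFin.
  rewrite (bigD1 i)//= [X in (_ + X)%R](bigD1 i)//= [RHS](bigD1 i)//= !mxE eqxx.
  rewrite (eq_bigr (fun j => Num.max 0 (q.2 ord0 j - q.1 ord0 j))%R); last first.
    by move=> j /negbTE ji; rewrite mxE ji.
  rewrite [X in (_ + _ * X)%R](eq_bigr (fun j => Num.max 0 (q.2 ord0 j - q.1 ord0 j))%R); last first.
    by move=> j /negbTE ji; rewrite mxE ji.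
  rewrite -mulrDl; congr *%R.
  move: (q.1 ord0 i) (q.2 ord0 i) => a b; rewrite /Num.max /Num.min.
  by case: (ltP b c) => ?; case: (ltP a c) => ?; do ?[case: ltP => ?]; lra.
apply: le_ereal_inf_tmp => _ [Q [cQ XQ] <-].
rewrite (eq_esum (b := fun q => box_volume (lo q) + box_volume (up q))); last first.
  by move=> q _; rewrite volE.
rewrite esumD; [|by move=> *; exact: box_volume_ge0..].
apply: leeD; apply: lebesgue_outer_le => // x [Xx /=].
  move=> xc; have [q Qq qx] := XQ _ Xx; exists q => // j.
  rewrite mxE; case: eqP => [->|_]; last exact: qx.
  by rewrite le_min xc andbT; exact: qx.
move=> /negP; rewrite -ltNge => xc; have [q Qq qx] := XQ _ Xx; exists q => // j.
rewrite mxE; case: eqP => [->|_]; last exact: qx.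
by rewrite gt_max xc andbT; exact: qx.
Qed.

Lemma measurable_box q : measurable (box q).
Proof.
have -> : box q = \bigcap_(i in [set: 'I_n])
    ([set x | (x ord0 i <= q.2 ord0 i)%R] `\` [set x | (x ord0 i <= q.1 ord0 i)%R]).
  apply/seteqP; split => x qx i.
    by move=> _; have /andP[? ?] := qx i; split => //=; apply/negP; rewrite -ltNge.
  by have [/= -> /negP] := qx i I; rewrite -ltNge => ->.
apply: fin_bigcap_measurable => // i _.
by apply: measurableD; exact: measurable_halfspace.
Qed.

Lemma lebesgue_box q : lebesgue (box q) = box_volume q.
Proof.
apply/eqP; rewrite eq_le; apply/andP; split.
  have := @lebesgue_outer_le (box q) [set q] id (countable1 _).
  rewrite esum_set1 ?box_volume_ge0//; apply.
  by move=> x qx; exists q.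
apply: le_ereal_inf_tmp => _ [Q [cQ qQ] <-].
have [e [B [eB ->]]] := countable_esum cQ box_volume_ge0.
(* Row vectors are continued by 0 to sequences, the form that suits the induction on the dimension;
   the weights below are the indicator of [B]. *)
pose co (v : 'rV[R]_n) (i : nat) : R := if insub i is Some j then v ord0 j else 0%R.
have coE v (i : 'I_n) : co v i = v ord0 i by rewrite /co valK.
have := @weighted_box_cover_le R n (co q.1) (co q.2)
  (fun k => co (e k).1) (fun k => co (e k).2) (fun k => (k \in B)%:R%R) 1%R
  (fun k => ler0n _ _) ler01.
rewrite mul1r; under eq_bigr do rewrite !coE; move=> /(_ _)/le_trans; apply.
  move=> x qx; have [|q' Qq' qx'] := qQ (\row_i x i).
    by move=> i; rewrite mxE -!coE qx.
  have [_ _ /(_ _ Qq')[k Bk ekq']] := eB.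
  rewrite (nneseriesD1 (n := k))//; last by move=> *; rewrite lee_fin mulr_ge0 ?ler0n ?prodr_ge0.
  rewrite mem_set// mul1r big1 => [|i _].
    by rewrite leeDl// nneseries_ge0// => *; rewrite lee_fin mulr_ge0 ?ler0n ?prodr_ge0.
  by have := qx' i; rewrite mxE !coE ekq' => ->.
apply: lee_nneseries => [*|k _].
  by rewrite lee_fin mulr_ge0 ?ler0n ?prodr_ge0// => i _; rewrite le_max lexx.
under eq_bigr do rewrite !coE.
by case: ifP => _; rewrite ?mul1r ?mul0r.
Qed.

End lebesgue_box.

(** * Cubes and Riemann sums *)

(* No measurability is required: for a nonnegative function the integral is by
   definition a supremum over the simple functions below it. *)
Lemma ge0_subset_le_integral d (T : measurableType d) (R : realType)
    (mu : {measure set T -> \bar R}) (D E : set T) (f g : T -> \bar R) :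
  D `<=` E -> (forall x, D x -> 0 <= f x)%E -> (forall x, E x -> 0 <= g x)%E ->
  (forall x, D x -> f x <= g x)%E ->
  (\int[mu]_(x in D) f x <= \int[mu]_(x in E) g x)%E.
Proof.
move=> DE f0 g0 fg; rewrite !ge0_integralE//.
apply: le_ereal_sup => _ [h /= hf <-]; exists h => //= x.
apply: (le_trans (hf x)); rewrite !patchE; case: ifPn => [/set_mem Dx|_].
  by rewrite mem_set ?fg//; exact: DE.
by case: ifPn => // /set_mem/g0.
Qed.

Lemma integrable_sumr d (T : measurableType d) (R : realType)
    (mu : {measure set T -> \bar R}) (D : set T) (I : Type) (s : seq I)
    (f : I -> T -> R) : measurable D ->
  (forall i, mu.-integrable D (EFin \o f i)) ->
  mu.-integrable D (EFin \o (fun x => \sum_(i <- s) f i x)).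
Proof.
move=> mD fi.
have -> : EFin \o (fun x => \sum_(i <- s) f i x) =
    (fun x => (\sum_(i <- s) (f i x)%:E)%E).
  by apply/funext => x /=; rewrite sumEFin.
by apply: integrable_sum => // j _; exact: fi.
Qed.

Lemma Rintegral_sum d (T : measurableType d) (R : realType)
    (mu : {measure set T -> \bar R}) (D : set T) (I : Type) (s : seq I)
    (f : I -> T -> R) : measurable D ->
  (forall i, mu.-integrable D (EFin \o f i)) ->
  \int[mu]_(x in D) (\sum_(i <- s) f i x) = \sum_(i <- s) \int[mu]_(x in D) f i x.
Proof.
move=> mD fi; elim: s => [|i s IH].
  under eq_Rintegral do rewrite big_nil.
  by rewrite big_nil Rintegral_cst// mul0r.
under eq_Rintegral do rewrite big_cons.
rewrite big_cons RintegralD//; first by rewrite IH.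
exact: integrable_sumr.
Qed.

Lemma Rintegral_subset_le d (T : measurableType d) (R : realType)
    (mu : {measure set T -> \bar R}) (D E : set T) (f : T -> R) :
  measurable D -> measurable E -> D `<=` E -> mu.-integrable E (EFin \o f) ->
  \int[mu]_(x in D) `|f x| <= \int[mu]_(x in E) `|f x|.
Proof.
move=> mD mE DE fE; have fD := integrableS mE mD DE fE.
apply: fine_le; [exact: integrable_fin_num (integrable_norm fD)|
  exact: integrable_fin_num (integrable_norm fE)|].
by apply: ge0_subset_le_integral => // x _; rewrite lee_fin.
Qed.

Section euclidean_norm.
Context {R : realType} {n : nat}.
Implicit Types v : 'rV[R]_n.

Lemma enorm_ge0 v : 0 <= enorm v.
Proof. exact: sqrtr_ge0. Qed.

Lemma coord_le_enorm v i : `|v ord0 i| <= enorm v.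
Proof.
have s0 (P : pred 'I_n) : 0 <= \sum_(j | P j) v ord0 j ^+ 2.
  by apply: sumr_ge0 => j _; exact: sqr_ge0.
rewrite -sqrtr_sqr ler_sqrt ?s0//.
by rewrite [leRHS](bigD1 i)//= lerDl.
Qed.

Lemma enorm_le_coord v s : 0 <= s -> (forall i, `|v ord0 i| <= s) ->
  enorm v <= n%:R * s.
Proof.
move=> s0 vs; rewrite -(ger0_norm (mulr_ge0 (ler0n R n) s0)) -sqrtr_sqr.
rewrite ler_sqrt ?sqr_ge0//.
apply: (@le_trans _ _ (\sum_(i < n) s ^+ 2)).
  by apply: ler_sum => i _; rewrite -real_normK ?num_real// lerXn2r ?nnegrE.
rewrite sumr_const card_ord -(mulr_natl (s ^+ 2)) exprMn ler_wpM2r ?sqr_ge0//.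
by rewrite -natrX ler_nat; case: n => // m; rewrite leq_pmulr.
Qed.

Lemma enormZ a v : enorm (a *: v) = `|a| * enorm v.
Proof.
rewrite /enorm; under eq_bigr do rewrite mxE exprMn.
by rewrite -mulr_sumr sqrtrM ?sqr_ge0// sqrtr_sqr.
Qed.

Lemma enormN v : enorm (- v) = enorm v.
Proof. by rewrite -scaleN1r enormZ normrN1 mul1r. Qed.

End euclidean_norm.

Section cubes.
Context {R : realType} {n : nat}.
Implicit Types (o x : 'rV[R]_n) (s h : R).

(** Half-open, so that the cells of a grid partition the cube they fill. *)
Definition cube o s : set 'rV[R]_n := box (o, \row_i (o ord0 i + s)).

Lemma cubeP o s x : cube o s x <-> forall i, o ord0 i < x ord0 i <= o ord0 i + s.
Proof. by split => H i; have := H i; rewrite /= mxE. Qed.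

Lemma measurable_cube o s : measurable (cube o s).
Proof. exact: measurable_box. Qed.

Lemma lebesgue_cube o s : 0 <= s -> lebesgue (cube o s) = (s ^+ n)%:E.
Proof.
move=> s0; rewrite lebesgue_box /box_volume/=; congr EFin.
rewrite (eq_bigr (fun=> s)) ?prodr_const ?card_ord// => i _.
by rewrite mxE addrAC subrr add0r (max_idPr _).
Qed.

(** The lower corner of the cell of index [k], a point outside the half-open cell when [n > 0]. *)
Definition grid_point M o h (k : {ffun 'I_n -> 'I_M}) : 'rV[R]_n :=
  \row_i (o ord0 i + h * (k i)%:R).

Definition cell M o h (k : {ffun 'I_n -> 'I_M}) := cube (grid_point o h k) h.

Section cells.
Context {M : nat} {o : 'rV[R]_n} {h : R} (h0 : 0 < h).
Implicit Types (k : {ffun 'I_n -> 'I_M}).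

Lemma cellP k x : cell o h k x <->
  forall i, o ord0 i + h * (k i)%:R < x ord0 i <= o ord0 i + h * (k i).+1%:R.
Proof.
split => [/cubeP H|H]; [|apply/cubeP] => i; have := H i.
  by rewrite mxE -[(k i).+1]addn1 natrD mulrDr mulr1 addrA.
by rewrite mxE -[(k i).+1]addn1 natrD mulrDr mulr1 addrA.
Qed.

Lemma sub_cell_cube k : cell o h k `<=` cube o (h * M%:R).
Proof.
move=> x /cellP H; apply/cubeP => i; have /andP[H1 H2] := H i; apply/andP; split.
  by apply: le_lt_trans H1; rewrite lerDl mulr_ge0 ?ler0n// ltW.
by apply: (le_trans H2); rewrite lerD2l ler_pM2l// ler_nat ltn_ord.
Qed.

Lemma cell_inj k k' x : cell o h k x -> cell o h k' x -> k = k'.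
Proof.
move=> /cellP H /cellP H'; apply/ffunP => i; apply/val_inj/eqP => /=.
have /andP[a1 a2] := H i; have /andP[b1 b2] := H' i.
rewrite eqn_leq; apply/andP.
split; rewrite -ltnS -(ltr_nat R) -(ltr_pM2l h0) -(ltrD2l (o ord0 i)).
  exact: lt_le_trans a1 b2.
exact: lt_le_trans b1 a2.
Qed.

Lemma cube_cell x : cube o (h * M%:R) x -> exists k, cell o h k x.
Proof.
move=> /cubeP H.
have slot i : exists j : 'I_M,
    o ord0 i + h * j%:R < x ord0 i <= o ord0 i + h * j.+1%:R.
  move: (H i); elim: M => [|m IH].
    by rewrite mulr0 addr0 => /andP[/lt_le_trans /[apply]]; rewrite ltxx.
  move=> /andP[H1 H2]; have [xm|mx] := leP (x ord0 i) (o ord0 i + h * m%:R).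
    have [|j jx] := IH; first by rewrite H1.
    by exists (widen_ord (leqnSn m) j).
  by exists ord_max; rewrite mx.
have /choice[k kP] := slot.
by exists [ffun i => k i]; apply/cellP => i; rewrite ffunE.
Qed.

Lemma measurable_cell k : measurable (cell o h k).
Proof. exact: measurable_cube. Qed.

Lemma lebesgue_cell k : lebesgue (cell o h k) = (h ^+ n)%:E.
Proof. by rewrite lebesgue_cube// ltW. Qed.

Lemma integrable_step (a : {ffun 'I_n -> 'I_M} -> R) (f : 'rV[R]_n -> R) :
  lebesgue.-integrable (cube o (h * M%:R)) (EFin \o f) ->
  lebesgue.-integrable (cube o (h * M%:R))
    (EFin \o (fun x => \sum_k a k * (f \_ (cell o h k)) x)) /\
  \int[lebesgue]_(x in cube o (h * M%:R)) (\sum_k a k * (f \_ (cell o h k)) x) =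
  \sum_k a k * \int[lebesgue]_(x in cell o h k) f x.
Proof.
move=> fi; have mC := @measurable_cube o (h * M%:R).
have fk k : lebesgue.-integrable (cube o (h * M%:R)) (EFin \o (f \_ (cell o h k))).
  rewrite -restrict_EFin; apply/(integrable_restrict _ (measurable_cell k) mC).
  have mk := measurable_cell k.
  by apply: integrableS fi => //; exact: measurableI.
have afk k : lebesgue.-integrable (cube o (h * M%:R))
    (EFin \o (fun x => a k * (f \_ (cell o h k)) x)).
  by have := integrableZl mC (a k) (fk k).
split; first exact: integrable_sumr.
rewrite Rintegral_sum//; apply: eq_bigr => k _; rewrite RintegralZl//.
by rewrite -Rintegral_mkcondr setIidr//; exact: sub_cell_cube.
Qed.

Lemma step_cell (a : {ffun 'I_n -> 'I_M} -> R) (f : 'rV[R]_n -> R) k x :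
  cell o h k x -> \sum_k a k * (f \_ (cell o h k)) x = a k * f x.
Proof.
move=> kx; rewrite (bigD1 k)//= patchE mem_set// big1 ?addr0// => k' k'k.
rewrite patchE memNset ?mulr0// => k'x.
by move: k'k; rewrite (cell_inj kx k'x) eqxx.
Qed.

Lemma Rintegral_cells (f : 'rV[R]_n -> R) :
  lebesgue.-integrable (cube o (h * M%:R)) (EFin \o f) ->
  \int[lebesgue]_(x in cube o (h * M%:R)) f x =
  \sum_(k : {ffun 'I_n -> 'I_M}) \int[lebesgue]_(x in cell o h k) f x.
Proof.
move=> fi; have [_ stepE] := integrable_step (fun=> 1) fi.
transitivity (\sum_(k : {ffun 'I_n -> 'I_M}) 1 * \int[lebesgue]_(x in cell o h k) f x).
  rewrite -stepE; apply: eq_Rintegral => x; rewrite inE => /cube_cell[k kx].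
  by rewrite (step_cell _ _ kx) mul1r.
by apply: eq_bigr => k _; rewrite mul1r.
Qed.

(** On each cell [g * f] is within [e * |f|] of [a k * f]. Integrability of [g * f] follows as well:
    it is an integrable step combination plus a perturbation dominated by [e * |f|]. *)
Lemma riemann_sum (g f : 'rV[R]_n -> R) (a : {ffun 'I_n -> 'I_M} -> R) (e : R) :
  measurable_fun (cube o (h * M%:R)) g -> 0 <= e ->
  lebesgue.-integrable (cube o (h * M%:R)) (EFin \o f) ->
  (forall k x, cell o h k x -> `|g x - a k| <= e) ->
  lebesgue.-integrable (cube o (h * M%:R)) (EFin \o (fun x => g x * f x)) /\
  `|\int[lebesgue]_(x in cube o (h * M%:R)) (g x * f x) -
    \sum_k a k * \int[lebesgue]_(x in cell o h k) f x| <=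
  e * \int[lebesgue]_(x in cube o (h * M%:R)) `|f x|.
Proof.
move=> mg e0 fi ga; set Q := cube _ _; have mQ : measurable Q by exact: measurable_cube.
have [si sE] := integrable_step a fi.
pose s x := \sum_k a k * (f \_ (cell o h k)) x.
have gs x : Q x -> `|g x * f x - s x| <= e * `|f x|.
  move=> /cube_cell[k kx]; rewrite /s (step_cell _ _ kx) -mulrBl normrM.
  by rewrite ler_wpM2r//; exact: ga kx.
have mf : measurable_fun Q f by exact/measurable_EFinP/(measurable_int _ fi).
have ms : measurable_fun Q s by exact/measurable_EFinP/(measurable_int _ si).
have afi : lebesgue.-integrable Q (EFin \o (fun x => `|f x|)) by exact: integrable_norm.
have di : lebesgue.-integrable Q (EFin \o (fun x => g x * f x - s x)).
  apply: (le_integrable mQ _ _ (integrableZl mQ e afi)).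
    by apply/measurable_EFinP; exact: (measurable_funB (measurable_funM mg mf) ms).
  by move=> x /gs; rewrite /= lee_fin (ger0_norm (mulr_ge0 e0 _)).
have gfi : lebesgue.-integrable Q (EFin \o (fun x => g x * f x)).
  have -> : (fun x => g x * f x) = (fun x => (g x * f x - s x) + s x).
    by apply/funext => x; rewrite subrK.
  exact: (integrableD mQ di si).
split => //; rewrite -sE -RintegralB//.
apply: (le_trans (le_normr_Rintegral mQ di)).
rewrite -RintegralZl//; apply: le_Rintegral => //.
- exact: integrable_norm.
- exact: (integrableZl mQ e afi).
Qed.

End cells.

End cubes.

(** * Hoelder continuous functions on fine grids *)

Lemma powR_half_lt1 (R : realType) (al : R) : 0 < al -> 0 < (2^-1 : R) `^ al < 1.
Proof.
move=> al0; rewrite powR_gt0//=.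
have : (2^-1 : R) `^ al < 1 `^ al by apply: gt0_ltr_powR; rewrite ?nnegrE; lra.
by rewrite powR1.
Qed.

Lemma powR_div_exp2 (R : realType) (al d : R) N : 0 <= d ->
  (d / 2 ^+ N) `^ al = d `^ al * (2^-1 `^ al) ^+ N.
Proof.
move=> d0; rewrite powRM// ?invr_ge0 ?exprn_ge0//; congr (_ * _).
by rewrite -exprVn -powR_mulrn// -powRrM mulrC powRrM powR_mulrn ?powR_ge0.
Qed.

Lemma cvg_powR_div_exp2 (R : realType) (al c d : R) : 0 < al -> 0 <= d ->
  c * (d / 2 ^+ N) `^ al @[N --> \oo] --> 0.
Proof.
move=> al0 d0; under eq_fun do rewrite powR_div_exp2// mulrA.
have /andP[t0 t1] := powR_half_lt1 al0.
have cv : ((2^-1 : R) `^ al) ^+ N @[N --> \oo] --> (0 : R).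
  by apply: cvg_expr; rewrite ger0_norm// ltW.
by rewrite -(mulr0 (c * d `^ al)); apply: cvgM => //; exact: cvg_cst.
Qed.

Section holder.
Context {R : realType} {n : nat}.
Implicit Types (o x y : 'rV[R]_n) (g : 'rV[R]_n -> R).

Definition holder (A al : R) g :=
  forall x y, `|g x - g y| <= A * enorm (x - y) `^ al.

Lemma cell_dist M o h (k : {ffun 'I_n -> 'I_M}) x : 0 < h -> cell o h k x ->
  enorm (x - grid_point o h k) <= n%:R * h.
Proof.
move=> h0 /cubeP kx; apply: enorm_le_coord => [|i]; first exact: ltW.
rewrite !mxE; have := kx i; rewrite mxE; set u := _ + _ => ?.
by rewrite ler_norml; lra.
Qed.

Lemma cell_dist_upper M o h (k : {ffun 'I_n -> 'I_M}) x : 0 < h -> cell o h k x ->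
  enorm (x - (grid_point o h k + const_mx h)) <= n%:R * h.
Proof.
move=> h0 /cubeP kx; apply: enorm_le_coord => [|i]; first exact: ltW.
rewrite !mxE; have := kx i; rewrite mxE; set u := _ + _ => ?.
by rewrite ler_norml; lra.
Qed.

(** The dyadic step functions that sample [g] at lower corners are measurable and converge to [g]
    pointwise on the cube. *)
Lemma measurable_holder A al g o s : 0 < al -> 0 <= A -> 0 < s -> holder A al g ->
  measurable_fun (cube o s) g.
Proof.
move=> al0 A0 s0 gH.
pose h N := s / 2 ^+ N.
have h0 N : 0 < h N by rewrite divr_gt0// exprn_gt0.
have hs N : h N * (2 ^ N)%:R = s by rewrite /h natrX divfK// gt_eqF// exprn_gt0.
pose sN N x := \sum_(k : {ffun 'I_n -> 'I_(2 ^ N)})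
  g (grid_point o (h N) k) * ((fun=> 1 : R) \_ (cell o (h N) k)) x.
apply: (@measurable_fun_cvg _ _ _ _ sN).
  move=> N; apply: measurable_sum => k; apply: measurable_funM => //.
  apply: measurable_funTS; apply/(measurable_restrictT _ (measurable_cell _)).
  exact: measurable_cst.
move=> x sx; apply/cvgrPdist_le => e e0.
have := @cvg_powR_div_exp2 R al A (n%:R * s) al0 (mulr_ge0 (ler0n _ _) (ltW s0)).
move=> /cvgrPdist_le/(_ _ e0); apply: filterS => N.
rewrite sub0r normrN; apply: le_trans.
have [k kx] : exists k : {ffun 'I_n -> 'I_(2 ^ N)}, cell o (h N) k x.
  by apply: cube_cell; rewrite hs.
rewrite /sN (step_cell (h0 N) _ _ kx) mulr1; apply: (le_trans (gH _ _)).
rewrite ger0_norm ?mulr_ge0 ?powR_ge0// ler_wpM2l// le_powR ?enorm_ge0 ?(ltW al0)//.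
by rewrite -[n%:R * s / _]mulrA; exact: (cell_dist (h0 N) kx).
Qed.

End holder.

(** * Small scales *)

Section martingale_pairing.
Context {R : realType} {Om : finType} {c : nat -> rel Om} {b : R}.
Context (F : regular_filtration c b).
Implicit Types (u v : Om -> R) (x y : Om).

Lemma sum_mdiff j N v x : (j <= N)%N ->
  cexp c N v x = cexp c j v x + \sum_(m < N | (j <= m)%N) mdiff c m v x.
Proof.
elim: N => [|N IH]; first by rewrite leqn0 => /eqP ->; rewrite big_ord0 addr0.
rewrite leq_eqVlt => /predU1P[->|jN].
  by rewrite big1 ?addr0// => i; rewrite leqNgt ltn_ord.
rewrite big_mkcond big_ord_recr -big_mkcond/= -ltnS jN addrA -IH//.
by rewrite /mdiff addrC subrK.
Qed.

(** On the class carrying [u], [v] is its average plus the differences of levels [m >= j]. The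
    average is constant there and meets only the sum of [u], which need not vanish after
    discretization. A difference of level [m] does not see [cexp c m u], so [u] may be replaced by
    [u - cexp c m u], which is at most the oscillation [w m]. *)
Lemma martingale_pairing_le N j u v x0 (w : nat -> R) : (j <= N)%N ->
  (forall x y, c N x y -> x = y) ->
  (forall x, ~~ c j x0 x -> u x = 0) ->
  (forall m x y, (m < N)%N -> c m x y -> `|u x - u y| <= w m) ->
  `|\sum_x u x * v x| <= `|cexp c j v x0| * `|\sum_x u x| +
    #|c j x0|%:R * \sum_(m < N | (j <= m)%N) w m * cexp c j (fun y => `|mdiff c m v y|) x0.
Proof.
move=> jN finest supp osc.
have vE x : v x = cexp c N v x.
  rewrite /cexp (big_pred1 x) => [|y]; last first.
    by apply/idP/eqP => [/finest->//|->]; exact: (filt_refl F).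
  rewrite (@eq_card _ _ (pred1 x)) ?card1 ?divr1// => y; rewrite !inE.
  by apply/idP/eqP => [/finest->//|->]; exact: (filt_refl F).
have -> : \sum_x u x * v x = cexp c j v x0 * \sum_x u x +
    \sum_(m < N | (j <= m)%N) \sum_x u x * mdiff c m v x.
  rewrite exchange_big/= mulr_sumr -big_split/=; apply: eq_bigr => x _.
  rewrite -mulr_sumr vE (sum_mdiff _ _ jN) mulrDr; congr (_ + _).
  have [x0x|/supp ->] := boolP (c j x0 x); last by rewrite mul0r mulr0.
  by rewrite (adapted_cexp F _ x0x) mulrC.
apply: (le_trans (ler_normD _ _)); rewrite normrM lerD2l mulr_sumr.
apply: (le_trans (ler_norm_sum _ _ _)); apply: ler_sum => m jm.
have -> : \sum_x u x * mdiff c m v x = \sum_x (u x - cexp c m u x) * mdiff c m v x.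
  under [RHS]eq_bigr do rewrite mulrBl.
  rewrite sumrB [X in _ - X](_ : _ = 0) ?subr0//.
  under eq_bigr do rewrite mulrBr.
  rewrite sumrB !(sum_cexp F) ?subrr//; first exact: (adapted_cexp F).
  exact: (adapted_le F (leqnSn _) (adapted_cexp F _)).
apply: (le_trans (ler_norm_sum _ _ _)).
have -> : #|c j x0|%:R * (w m * cexp c j (fun y => `|mdiff c m v y|) x0) =
    \sum_(y | c j x0 y) w m * `|mdiff c m v y|.
  by rewrite /cexp -mulr_sumr mulrCA [_%:R * _]mulrC divfK// gt_eqF// (card_class_gt0 F).
rewrite [leRHS]big_mkcond/=; apply: ler_sum => x _.
have cu y : c m x y -> c j x0 x = c j x0 y.
  by move=> /(filt_le F jm) xy; rewrite (filt_sym F) (filt_trans_eq F xy) (filt_sym F).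
have C0 := card_class_gt0 F m x.
case: ifPn => x0x; last first.
  rewrite supp// [cexp c m u x](_ : _ = 0) ?subrr ?mul0r ?normr0//.
  rewrite /cexp big1 ?mul0r// => y xy.
  by rewrite supp// -(cu _ xy).
rewrite normrM ler_wpM2r//.
have -> : u x - cexp c m u x = (\sum_(y | c m x y) (u x - u y)) / #|c m x|%:R.
  by rewrite sumrB mulrBl sumr_const -(mulr_natr (u x)) mulfK// gt_eqF.
rewrite normrM normfV (ger0_norm (ltW C0)) ler_pdivrMr//.
apply: (le_trans (ler_norm_sum _ _ _)).
by rewrite mulr_natr -sumr_const; apply: ler_sum => y; exact: osc.
Qed.

End martingale_pairing.

(** * Dyadic cubes as a finite filtration *)

Section dyadic_classes.
Context {n : nat}.

(** A dyadic cube of level [j] is a class of finest cells with the same quotients by [2 ^ (N - j)].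
    For [j >= N] the truncated subtraction makes all classes singletons. *)
Definition dyadic_class N j : rel {ffun 'I_n -> 'I_(2 ^ N)} :=
  fun k k' => [forall i, (k i %/ 2 ^ (N - j) == k' i %/ 2 ^ (N - j))%N].

Lemma dyadic_classP N j (k k' : {ffun 'I_n -> 'I_(2 ^ N)}) :
  reflect (forall i, (k i %/ 2 ^ (N - j) = k' i %/ 2 ^ (N - j))%N) (dyadic_class j k k').
Proof. exact: 'forall_eqP. Qed.

Lemma card_quotient_class P M d q : P = (M * d)%N -> (q < M)%N -> (0 < d)%N ->
  #|[pred k : 'I_P | (k %/ d)%N == q]| = d.
Proof.
move=> -> qM d0.
have lt (e : 'I_d) : (q * d + e < M * d)%N.
  apply: (@leq_trans (q.+1 * d)); first by rewrite mulSnr ltn_add2l.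
  by rewrite leq_mul2r qM orbT.
rewrite -[RHS]card_ord -(card_codom (f := fun e : 'I_d => Ordinal (lt e))); last first.
  by move=> e e' [] /addnI/val_inj.
apply: eq_card => k; rewrite inE; apply/eqP/codomP => [kq|[e ->]]/=.
  have kd : (k %% d < d)%N by rewrite ltn_mod.
  by exists (Ordinal kd); apply/val_inj; rewrite /= -kq -divn_eq.
by rewrite divnMDl// divn_small ?addn0// ltn_ord.
Qed.

Lemma card_dyadic_class N j (k : {ffun 'I_n -> 'I_(2 ^ N)}) :
  #|dyadic_class j k| = ((2 ^ (N - j)) ^ n)%N.
Proof.
pose Q i := [pred l : 'I_(2 ^ N) | (k i %/ 2 ^ (N - j) == l %/ 2 ^ (N - j))%N].
have -> : #|dyadic_class j k| = #|family Q|.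
  by apply: eq_card => l; apply/forallP/familyP => H i; exact: H.
rewrite -sum1_card.
have := @bigA_distr_big_dep _ 0%N 1%N muln addn _ _ Q (fun _ _ => 1%N).
under [in RHS]eq_bigr do rewrite big1_eq.
move=> <-; under eq_bigr => i _.
  rewrite sum1_card (_ : #|_| = 2 ^ (N - j))%N; last first.
    have e2 : (2 ^ N = 2 ^ (N - (N - j)) * 2 ^ (N - j))%N by rewrite -expnD subnK// leq_subr.
    have kq : (k i %/ 2 ^ (N - j) < 2 ^ (N - (N - j)))%N.
      by rewrite ltn_divLR ?expn_gt0// -e2.
    rewrite -[RHS](card_quotient_class e2 kq) ?expn_gt0//.
    by apply: eq_card => l; rewrite !inE eq_sym.
  over.
by rewrite prod_nat_const card_ord.
Qed.

Lemma dyadic_filtration (R : realType) N :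
  regular_filtration (dyadic_class (N := N)) (2 ^+ n : R).
Proof.
split => [j x y z|j x y /dyadic_classP xy|j x].
- split; first by apply/dyadic_classP.
  move=> /dyadic_classP xy; apply/dyadic_classP/dyadic_classP => H i.
    by rewrite -xy.
  by rewrite xy.
- apply/dyadic_classP => i; have := xy i.
  have [jN|Nj] := ltnP j N; last first.
    by rewrite (eqP (Nj : N - j == 0)%N) (eqP (leqW Nj : N - j.+1 == 0)%N).
  by move=> xyi; rewrite -(subnSK jN) expnSr !divnMA xyi.
- rewrite !card_dyadic_class -natrX -natrM ler_nat -expnMn.
  have mono a b : (a <= b)%N -> (a ^ n <= b ^ n)%N.
    by move=> ab; elim: n => // m IH; rewrite !expnS leq_mul.
  by apply: mono; rewrite subnS -expnS leq_exp2l// leqSpred.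
Qed.

Lemma dyadic_class_finest N (k k' : {ffun 'I_n -> 'I_(2 ^ N)}) :
  dyadic_class N k k' -> k = k'.
Proof.
move=> /dyadic_classP kk; apply/ffunP => i; apply/val_inj.
by have := kk i; rewrite subnn expn0 !divn1.
Qed.

End dyadic_classes.

(** * Test functions sampled on a grid *)

Section small_scale.
Context {R : realType} {n : nat}.
Implicit Types (o y z : 'rV[R]_n) (f phi : 'rV[R]_n -> R).

Definition cell_avg N o L f (k : {ffun 'I_n -> 'I_(2 ^ N)}) : R :=
  (L / 2 ^+ N) ^- n * \int[lebesgue]_(x in cell o (L / 2 ^+ N) k) f x.

Lemma integral_supp (D : set 'rV[R]_n) f :
  (forall x, ~ D x -> f x = 0) ->
  (\int[lebesgue]_x (f x)%:E = \int[lebesgue]_(x in D) (f x)%:E)%E.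
Proof.
move=> f0; rewrite [RHS]integral_mkcond; apply: eq_integral => x _.
by rewrite patchE; case: ifPn => // /negP; rewrite inE => /f0 ->.
Qed.

Lemma test_function_coord alpha phi x i : test_functions alpha phi -> phi x != 0 ->
  `|x ord0 i| <= 1.
Proof.
move=> [supp _ _]; apply: contra_neqT; rewrite -ltNge => xi.
by rewrite supp// (lt_le_trans xi)// coord_le_enorm.
Qed.

Lemma holder_dilate alpha phi t y : 0 < t -> test_functions alpha phi ->
  holder (t ^- n * t^-1 `^ alpha) alpha (fun z => dilate phi t (y - z)).
Proof.
move=> t0 [_ _ phiH] z z'; rewrite /dilate -mulrBr normrM.
have tn : 0 < t ^- n by rewrite invr_gt0 exprn_gt0.
have tV : 0 <= t^-1 by rewrite invr_ge0 ltW.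
rewrite (ger0_norm (ltW tn)) -mulrA ler_wpM2l//; first exact: ltW.
apply: (le_trans (phiH _ _)); rewrite -(powRM _ tV (enorm_ge0 _)).
rewrite -scalerBr enormZ (ger0_norm tV).
rewrite (_ : y - z - (y - z') = - (z - z')) ?enormN//.
by apply/matrixP => a b; rewrite !mxE; ring.
Qed.

Lemma integrable_cube_cst o s (c : R) : 0 <= s ->
  lebesgue.-integrable (cube o s) (EFin \o (fun=> c)).
Proof.
move=> s0; apply/integrableP; split; first exact: measurable_cst.
rewrite integral_cst; last exact: measurable_cube.
by rewrite [X in (_ * X)%E](lebesgue_cube _ s0) -EFinM ltry.
Qed.

Lemma Rintegral_cube_cst o s (c : R) : 0 <= s ->
  \int[lebesgue]_(x in cube o s) c = c * s ^+ n.
Proof.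
move=> s0; rewrite Rintegral_cst; last exact: measurable_cube.
by rewrite [X in fine X](lebesgue_cube _ s0).
Qed.

(** The Riemann sum nearly vanishes because the integral does. Upper corners are sampled because the
    reflection [z |-> y - z] turns lower corners into upper ones. *)
Lemma riemann_test_function alpha phi M o h : 0 < alpha -> 0 < h -> (0 < M)%N ->
  test_functions alpha phi ->
  (forall i, o ord0 i < -1 /\ 1 < o ord0 i + h * M%:R) ->
  `|\sum_(k : {ffun 'I_n -> 'I_M}) phi (grid_point o h k + const_mx h)| * h ^+ n <=
  (n%:R * h) `^ alpha * (h * M%:R) ^+ n.
Proof.
move=> al0 h0 M0 tphi oM; have [supp phi0 phiH] := tphi.
have hM0 : 0 < h * M%:R by rewrite mulr_gt0// ltr0n.
set Q := cube o (h * M%:R).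
have mQ : measurable Q by exact: measurable_cube.
have oneI : lebesgue.-integrable Q (EFin \o (fun=> 1)).
  by apply: integrable_cube_cst; exact: ltW.
have mphi : measurable_fun Q phi.
  apply: (@measurable_holder _ _ 1 alpha) => // x y; rewrite mul1r; exact: phiH.
have close (k : {ffun 'I_n -> 'I_M}) x : cell o h k x ->
    `|phi x - phi (grid_point o h k + const_mx h)| <= (n%:R * h) `^ alpha.
  move=> kx; apply: (le_trans (phiH _ _)).
  by apply: le_powR; [exact: ltW|exact: enorm_ge0|exact: cell_dist_upper].
have [] := riemann_sum h0 mphi (powR_ge0 _ _) oneI close.
rewrite -/Q => _.
have -> : (fun x => phi x * 1) = phi by apply/funext => x; rewrite mulr1.
have -> : \int[lebesgue]_(x in Q) phi x = 0.
  rewrite /Rintegral -(integral_supp (f := phi)) ?phi0// => x Qx.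
  apply/eqP/negPn/negP => px; apply: Qx; apply/cubeP => i.
  have := test_function_coord i tphi px; rewrite ler_norml => /andP[x1 x2].
  by have [lo up] := oM i; rewrite (lt_le_trans lo x1) ltW// (le_lt_trans x2 up).
have E1 (k : {ffun 'I_n -> 'I_M}) : \int[lebesgue]_(x in cell o h k) 1 = h ^+ n :> R.
  by rewrite Rintegral_cube_cst ?mul1r// ltW.
have -> : \int[lebesgue]_(x in Q) `|1| = (h * M%:R) ^+ n :> R.
  by rewrite normr1 Rintegral_cube_cst ?mul1r// ltW.
under eq_bigr do rewrite E1.
rewrite sub0r normrN -mulr_suml normrM.
by rewrite (ger0_norm (exprn_ge0 _ (ltW h0))).
Qed.

End small_scale.

Section small_scale.
Context {R : realType} {n : nat}.
Implicit Types (o y z : 'rV[R]_n) (f phi : 'rV[R]_n -> R).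

Lemma dyadic_class_dist N j o h (k k' : {ffun 'I_n -> 'I_(2 ^ N)}) : 0 <= h ->
  dyadic_class j k k' ->
  enorm (grid_point o h k - grid_point o h k') <= n%:R * (h * 2 ^+ (N - j)).
Proof.
move=> h0 /dyadic_classP kk; apply: enorm_le_coord => [|i].
  by rewrite mulr_ge0// exprn_ge0.
rewrite !mxE opprD addrACA subrr add0r -mulrBr normrM ger0_norm// ler_wpM2l//.
have d0 : (0 < 2 ^ (N - j))%N by rewrite expn_gt0.
have := kk i; rewrite -natrX; move: (2 ^ (N - j))%N d0 => d d0 q.
rewrite (divn_eq (k i) d) (divn_eq (k' i) d) q !natrD opprD addrACA subrr add0r.
have := ltn_pmod (k i) d0; have := ltn_pmod (k' i) d0.
rewrite -!(ltr_nat R); have := ler0n R (k i %% d)%N; have := ler0n R (k' i %% d)%N.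
by move=> *; rewrite ler_norml; lra.
Qed.

Lemma dyadic_sideE (L : R) j N : (j <= N)%N -> L / 2 ^+ N * 2 ^+ (N - j) = L / 2 ^+ j.
Proof.
move=> jN; have -> : 2 ^+ N = 2 ^+ j * 2 ^+ (N - j) :> R by rewrite -exprD subnKC.
by field; rewrite !expf_neq0.
Qed.

(** A crude bound suffices here: this average enters only the error term, multiplied by a factor
    that vanishes as [N] grows. *)
Lemma norm_cexp_cell_avg_le N j o L f (k0 : {ffun 'I_n -> 'I_(2 ^ N)}) :
  0 < L -> (j <= N)%N -> lebesgue.-integrable (cube o L) (EFin \o f) ->
  (L / 2 ^+ j) ^+ n * `|cexp (dyadic_class (N := N)) j (cell_avg o L f) k0| <=
  \int[lebesgue]_(x in cube o L) `|f x|.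
Proof.
move=> L0 jN fi; set h := L / 2 ^+ N.
have h0 : 0 < h by rewrite divr_gt0// exprn_gt0.
have hL : h * (2 ^ N)%:R = L by rewrite /h natrX divfK// gt_eqF// exprn_gt0.
have fi' : lebesgue.-integrable (cube o (h * (2 ^ N)%:R)) (EFin \o f) by rewrite hL.
have afi := integrable_norm fi'.
have fk (k : {ffun 'I_n -> 'I_(2 ^ N)}) : lebesgue.-integrable (cell o h k) (EFin \o f).
  by apply: integrableS fi' => //; [exact: measurable_cube|exact: measurable_cell|exact: sub_cell_cube].
have -> : \int[lebesgue]_(x in cube o L) `|f x| =
    \sum_(k : {ffun 'I_n -> 'I_(2 ^ N)}) \int[lebesgue]_(x in cell o h k) `|f x|.
  by rewrite -(Rintegral_cells h0 afi) hL.
have c0 := card_class_gt0 (@dyadic_filtration n R N) j k0.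
rewrite /cexp normrM normfV (ger0_norm (ltW c0)) mulrA ler_pdivrMr//.
have -> : (L / 2 ^+ j) ^+ n = h ^+ n * #|dyadic_class j k0|%:R.
  by rewrite card_dyadic_class !natrX -exprMn dyadic_sideE.
rewrite mulrAC ler_pM2r// (le_trans (ler_wpM2l _ (ler_norm_sum _ _ _)))//.
  by rewrite exprn_ge0// ltW.
rewrite mulr_sumr big_mkcond/=; apply: ler_sum => k _.
have I0 : 0 <= \int[lebesgue]_(x in cell o h k) `|f x| by apply: Rintegral_ge0.
case: ifP => // _; rewrite /cell_avg -/h normrM mulrA ger0_norm ?invr_ge0 ?exprn_ge0 ?(ltW h0)//.
rewrite mulfV ?gt_eqF ?exprn_gt0// mul1r.
by apply: le_normr_Rintegral => //; exact: measurable_cell.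
Qed.

(** The error has two sources: sampling the dilated test function on cells gives the term with
    [t ^- n], and the nonzero sum of the samples, times the average of [f] over the class, gives the
    term with [(2 ^+ j / t) ^+ n]. *)
Lemma maximal_average_pairing alpha phi N j o L f y t
    (k0 : {ffun 'I_n -> 'I_(2 ^ N)}) :
  0 < alpha -> 0 < L -> 0 < t -> (j <= N)%N ->
  test_functions alpha phi ->
  lebesgue.-integrable (cube o L) (EFin \o f) ->
  (forall i, o ord0 i < y ord0 i - t /\ y ord0 i + t < o ord0 i + L) ->
  (forall k : {ffun 'I_n -> 'I_(2 ^ N)},
    (forall i, `|y ord0 i - grid_point o (L / 2 ^+ N) k ord0 i| <= t) ->
    dyadic_class j k0 k) ->
  (`| \int[lebesgue]_z (dilate phi t (y - z) * f z)%:E | <=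
   (t ^- n * (L / 2 ^+ j) ^+ n * \sum_(m < N | (j <= m)%N)
      (n%:R * (L / 2 ^+ m) / t) `^ alpha *
      cexp (dyadic_class (N := N)) j
        (fun k => `|mdiff (dyadic_class (N := N)) m (cell_avg o L f) k|) k0 +
    (t ^- n + (2 ^+ j / t) ^+ n) * (n%:R * (L / 2 ^+ N) / t) `^ alpha *
      \int[lebesgue]_(x in cube o L) `|f x|)%:E)%E.
Proof.
move=> al0 L0 t0 jN tphi fi oy cls; have [supp phi0 phiH] := tphi.
set h := L / 2 ^+ N; set v := cell_avg o L f.
have h0 : 0 < h by rewrite divr_gt0// exprn_gt0.
have hL : h * (2 ^ N)%:R = L by rewrite /h natrX divfK// gt_eqF// exprn_gt0.
pose psi z := dilate phi t (y - z).
set A' := t ^- n * t^-1 `^ alpha.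
have tV : 0 <= t^-1 by rewrite invr_ge0 ltW.
have tnV : 0 <= t ^- n by rewrite invr_ge0 exprn_ge0// ltW.
have A'0 : 0 <= A' by rewrite mulr_ge0// powR_ge0.
have psiH : holder A' alpha psi by exact: holder_dilate.
have A'E a : 0 <= a -> A' * a `^ alpha = t ^- n * (a / t) `^ alpha.
  by move=> a0; rewrite /A' -mulrA -powRM// (mulrC _ a).
have psiN0 z : psi z != 0 -> forall i, `|y ord0 i - z ord0 i| <= t.
  rewrite /psi /dilate mulf_eq0 negb_or => /andP[_ pz] i.
  have := test_function_coord i tphi pz; rewrite !mxE normrM (ger0_norm tV).
  by rewrite mulrC ler_pdivrMr// mul1r.
have psi0 z : ~ cube o L z -> psi z * f z = 0.
  move=> zo; have [->|/psiN0 yz] := eqVneq (psi z) 0; first by rewrite mul0r.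
  exfalso; apply: zo; apply/cubeP => i; have := yz i; rewrite ler_norml.
  by have [? ?] := oy i => ?; apply/andP; lra.
have mpsi : measurable_fun (cube o (h * (2 ^ N)%:R)) psi.
  by rewrite hL; exact: (measurable_holder al0 A'0 L0 psiH).
have fi' : lebesgue.-integrable (cube o (h * (2 ^ N)%:R)) (EFin \o f) by rewrite hL.
pose u (k : {ffun 'I_n -> 'I_(2 ^ N)}) := psi (grid_point o h k).
have e0 : 0 <= A' * (n%:R * h) `^ alpha by rewrite mulr_ge0// powR_ge0.
have close (k : {ffun 'I_n -> 'I_(2 ^ N)}) x : cell o h k x ->
    `|psi x - u k| <= A' * (n%:R * h) `^ alpha.
  move=> kx; apply: (le_trans (psiH _ _)); rewrite ler_wpM2l//.
  by apply: le_powR; [exact: ltW|exact: enorm_ge0|exact: cell_dist].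
have [psifi riem] := riemann_sum h0 mpsi e0 fi' close.
rewrite hL in psifi riem.
rewrite (integral_supp psi0) -[X in (`|X|)%E]fineK; last first.
  by apply: integrable_fin_num => //; exact: measurable_cube.
rewrite abse_EFin lee_fin -/(Rintegral _ _ _).
have sumE : \sum_k u k * \int[lebesgue]_(x in cell o h k) f x =
    h ^+ n * \sum_k u k * v k.
  rewrite mulr_sumr; apply: eq_bigr => k _; rewrite mulrCA /v /cell_avg -/h.
  by rewrite mulVKf// gt_eqF// exprn_gt0.
have oscu m (k k' : {ffun 'I_n -> 'I_(2 ^ N)}) : (m < N)%N -> dyadic_class m k k' ->
    `|u k - u k'| <= A' * (n%:R * (L / 2 ^+ m)) `^ alpha.
  move=> mN kk; apply: (le_trans (psiH _ _)); rewrite ler_wpM2l//.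
  apply: le_powR; [exact: ltW|exact: enorm_ge0|].
  apply: (le_trans (dyadic_class_dist _ (ltW h0) kk)).
  by rewrite (dyadic_sideE _ (ltnW mN)).
have suppu k : ~~ dyadic_class j k0 k -> u k = 0.
  by apply: contraNeq => /psiN0; exact: cls.
have := @martingale_pairing_le R _ _ _ (@dyadic_filtration n R N) N j u v k0
  (fun m => A' * (n%:R * (L / 2 ^+ m)) `^ alpha) jN
  (@dyadic_class_finest n N) suppu oscu.
have sumu : h ^+ n * `|\sum_k u k| <= (n%:R * h / t) `^ alpha * (L / t) ^+ n.
  (* The lower corner of the image of the grid under [z |-> (y - z) / t], which reverses the order
     of the cells; hence [rev_ord]. *)
  pose o' : 'rV[R]_n := \row_i ((y ord0 i - o ord0 i - L) / t).
  have ht0 : 0 < h / t by rewrite divr_gt0.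
  have htL : h / t * (2 ^ N)%:R = L / t by rewrite mulrAC hL.
  have phiE : \sum_(k : {ffun 'I_n -> 'I_(2 ^ N)})
      phi (grid_point o' (h / t) k + const_mx (h / t)) = t ^+ n * \sum_k u k.
    pose r (k : {ffun 'I_n -> 'I_(2 ^ N)}) := [ffun i => rev_ord (k i)].
    have rK : involutive r by move=> k; apply/ffunP => i; rewrite !ffunE rev_ordK.
    rewrite (reindex_inj (inv_inj rK)) mulr_sumr; apply: eq_bigr => k _.
    rewrite /u /psi /dilate mulVKf ?gt_eqF ?exprn_gt0//; congr phi.
    apply/rowP => i; rewrite !mxE ffunE/= natrB// -(addn1 (k i)) natrD mulrBr htL.
    by field; rewrite gt_eqF.
  have -> : h ^+ n * `|\sum_k u k| = `|\sum_(k : {ffun 'I_n -> 'I_(2 ^ N)})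
      phi (grid_point o' (h / t) k + const_mx (h / t))| * (h / t) ^+ n.
    rewrite phiE normrM (ger0_norm (exprn_ge0 _ (ltW t0))) [(h / t) ^+ n]expr_div_n.
    move: (`|_|) (h ^+ n) => a c'; by field; rewrite expf_neq0// gt_eqF.
  have := @riemann_test_function R n alpha phi (2 ^ N) o' (h / t) al0 ht0
    (expn_gt0 _ _) tphi.
  rewrite htL mulrA; apply=> i; have [? ?] := oy i; rewrite mxE; split.
    by rewrite ltr_pdivrMr//; lra.
  by rewrite -mulrDl subrK ltr_pdivlMr//; lra.
have hcard : h ^+ n * #|dyadic_class j k0|%:R = (L / 2 ^+ j) ^+ n.
  by rewrite card_dyadic_class !natrX -exprMn dyadic_sideE.
set I := \int[lebesgue]_(x in cube o L) `|f x|.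
have Cc : (L / t) ^+ n * `|cexp (dyadic_class (N := N)) j v k0| <= (2 ^+ j / t) ^+ n * I.
  have -> : L / t = 2 ^+ j / t * (L / 2 ^+ j).
    by field; rewrite expf_neq0// gt_eqF.
  rewrite exprMn -mulrA ler_wpM2l ?exprn_ge0 ?divr_ge0 ?(ltW t0)//.
  exact: norm_cexp_cell_avg_le.
move=> pairing.
have {}pairing : h ^+ n * `|\sum_k u k * v k| <=
    (2 ^+ j / t) ^+ n * I * (n%:R * h / t) `^ alpha +
    t ^- n * (L / 2 ^+ j) ^+ n * \sum_(m < N | (j <= m)%N)
      (n%:R * (L / 2 ^+ m) / t) `^ alpha *
      cexp (dyadic_class (N := N)) j
        (fun k => `|mdiff (dyadic_class (N := N)) m v k|) k0.
  apply: (le_trans (ler_wpM2l (exprn_ge0 n (ltW h0)) pairing)).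
  rewrite mulrDr lerD//.
    rewrite mulrCA (le_trans (ler_wpM2l (normr_ge0 _) sumu))//.
    rewrite mulrCA [leRHS]mulrC ler_wpM2l ?powR_ge0//.
    by rewrite mulrC.
  rewrite mulrA hcard [t ^- n * _]mulrC -[leRHS]mulrA ler_wpM2l//.
    by rewrite exprn_ge0// divr_ge0 ?exprn_ge0// ltW.
  rewrite mulr_sumr; apply: ler_sum => m _.
  rewrite A'E ?mulrA//.
  by rewrite divr_ge0 ?exprn_ge0// mulr_ge0 ?ler0n ?(ltW L0).
rewrite sumE in riem.
have := ler_distD (h ^+ n * \sum_k u k * v k) (\int[lebesgue]_(x in cube o L) (psi x * f x)) 0.
rewrite !subr0 => /le_trans; apply.
apply: (le_trans (lerD riem (lexx _))).
rewrite [X in _ + X]normrM (ger0_norm (exprn_ge0 n (ltW h0))).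
rewrite A'E; last by rewrite mulr_ge0// ltW.
apply: (le_trans (lerD (lexx _) pairing)).
rewrite -/I le_eqVlt; apply/orP; left; apply/eqP; ring.
Qed.

End small_scale.

(** * Adjacent dyadic grids *)

Section adjacent_grids.
Context {R : realType} {n : nat}.
Implicit Types (o x y : 'rV[R]_n) (f phi : 'rV[R]_n -> R).

(* The one-third trick: [L / 3] is not within [S / 3] of a multiple of [S] if
   [L = 2 ^ j * S], as [3] does not divide [2 ^ j]. *)
Lemma one_third_trick (a S y t : R) j : 0 < S -> 6 * t < S ->
  exists b : bool, forall q : nat,
    ~ `|y - (a + (if b then 2 ^+ j * S / 3 else 0) + S * q%:R)| <= t.
Proof.
move=> S0 tS; have [[q yq]|/forallNP yq] :=
    pselect (exists q : nat, `|y - (a + 0 + S * q%:R)| <= t); last by exists false.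
exists true => q' yq'.
(* The faces of the two grids near [y] differ by a multiple of [S / 3] that is at most
   [2 * t < S / 3], hence zero. *)
have : `|(2 ^+ j + 3 * q'%:R - 3 * q%:R) * (S / 3)| < S / 3.
  move: yq yq'; rewrite !ler_norml ltr_norml => yq yq'.
  rewrite (_ : (2 ^+ j + 3 * q'%:R - 3 * q%:R) * (S / 3) =
    2 ^+ j * S / 3 + S * q'%:R - S * q%:R); first by lra.
  by field.
have S3 : 0 < S / 3 by lra.
rewrite normrM (gtr0_norm S3) gtr_pMl// ltr_norml => /andP[lo up].
have : (3 * q)%N = (2 ^ j + 3 * q')%N.
  apply/eqP; rewrite eqn_leq; apply/andP.
  by split; rewrite -ltnS -(ltr_nat R) -[ltRHS]natr1 natrD !natrM natrX; lra.
move=> /(congr1 (fun k => k %% 3)%N); rewrite modnMr addnC mulnC modnMDl => /esym/eqP.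
by rewrite -/(dvdn _ _) Euclid_dvdX// => /andP[].
Qed.

(** If the quotients differed in coordinate [i], a face of level [j] would lie between [x] and the
    corner of cell [k]; both are within [t] of [y] there, and so would be the face. *)
Lemma same_dyadic_class N j o h t x y (k0 k : {ffun 'I_n -> 'I_(2 ^ N)}) : 0 < h ->
  cell o h k0 x -> (forall i, `|y ord0 i - x ord0 i| <= t) ->
  (forall i, `|y ord0 i - grid_point o h k ord0 i| <= t) ->
  (forall i (q : nat), ~ `|y ord0 i - (o ord0 i + h * 2 ^+ (N - j) * q%:R)| <= t) ->
  dyadic_class j k0 k.
Proof.
move=> h0 /cellP k0x yx yk sep; apply/dyadic_classP => i.
have /andP[x1 x2] := k0x i; have := yx i; have := yk i; rewrite mxE.
have := sep i; rewrite -natrX; move: (2 ^ (N - j))%N (expn_gt0 2 (N - j)) => d d0 {}sep.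
rewrite !ler_norml => yki yxi.
have between (q : nat) (u v : R) : - t <= y ord0 i - u <= t -> - t <= y ord0 i - v <= t ->
    u <= o ord0 i + h * d%:R * q%:R <= v -> False.
  by move=> yu yv uv; apply: (sep q); rewrite ler_norml; lra.
have scale (u v : nat) : (u <= v)%N -> o ord0 i + h * u%:R <= o ord0 i + h * v%:R.
  by move=> uv; rewrite lerD2l ler_pM2l// ler_nat.
have E (q : nat) : o ord0 i + h * d%:R * q%:R = o ord0 i + h * (q * d)%:R.
  by rewrite natrM; ring.
have [lt|lt|//] := ltngtP (k0 i %/ d)%N (k i %/ d)%N; exfalso.
  apply: (between (k i %/ d)%N _ _ yxi yki); rewrite E.
  rewrite (le_trans x2) ?scale ?leq_trunc_div//.
  by rewrite (leq_trans (ltn_ceil _ d0))// leq_mul2r lt orbT.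
apply: (between (k0 i %/ d)%N _ _ yki yxi); rewrite E.
apply/andP; split; last by apply: le_trans (ltW x1); apply: scale; exact: leq_trunc_div.
by apply: scale; rewrite (leq_trans (ltnW (ltn_ceil _ d0)))// leq_mul2r lt orbT.
Qed.

(** For either choice the side of length [12 * r] reaches at least [4 * r] beyond [x] on both sides,
    enough for supports within [3 * r] of [x]. *)
Definition shifted_corner x r (e : {ffun 'I_n -> bool}) : 'rV[R]_n :=
  \row_i (x ord0 i - 8 * r + if e i then 4 * r else 0).

Lemma shifted_corner_bound x r e i : 0 < r ->
  x ord0 i - 8 * r <= shifted_corner x r e ord0 i <= x ord0 i - 4 * r.
Proof. by move=> r0; rewrite mxE; case: ifP => _; lra. Qed.

Lemma adjacent_grid x0 r j t x y : 0 < r -> t <= r / 2 ^+ j ->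
  (forall i, `|x ord0 i - x0 ord0 i| <= r) -> (forall i, `|y ord0 i - x ord0 i| <= t) ->
  exists e, (forall i, shifted_corner x0 r e ord0 i < y ord0 i - t /\
                       y ord0 i + t < shifted_corner x0 r e ord0 i + 12 * r) /\
    forall N (k0 k : {ffun 'I_n -> 'I_(2 ^ N)}), (j <= N)%N ->
      cell (shifted_corner x0 r e) (12 * r / 2 ^+ N) k0 x ->
      (forall i, `|y ord0 i -
        grid_point (shifted_corner x0 r e) (12 * r / 2 ^+ N) k ord0 i| <= t) ->
      dyadic_class j k0 k.
Proof.
move=> r0 tr xx yx; set S := 12 * r / 2 ^+ j.
have p0 : 0 < 2 ^+ j :> R by rewrite exprn_gt0.
have S0 : 0 < S by rewrite divr_gt0// mulr_gt0.
have rj0 : 0 < r / 2 ^+ j by rewrite divr_gt0.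
have tS : 6 * t < S.
  have -> : S = 12 * (r / 2 ^+ j) by rewrite /S mulrA.
  by lra.
have /choice[b bP] i := one_third_trick (x0 ord0 i - 8 * r) (y ord0 i) j S0 tS.
have SE : 2 ^+ j * S / 3 = 4 * r by rewrite /S; field; rewrite gt_eqF.
have rj : r / 2 ^+ j <= r.
  by rewrite ler_pdivrMr// ler_peMr ?(ltW r0)// exprn_ege1//; lra.
exists [ffun i => b i]; split => [i|N k0 k jN k0x yk].
  have := shifted_corner_bound x0 [ffun i => b i] i r0.
  have := yx i; have := xx i; rewrite !ler_norml => ? ? ?; split; lra.
apply: (same_dyadic_class _ k0x yx yk).
  by rewrite divr_gt0 ?mulr_gt0// exprn_gt0.
move=> i q; rewrite dyadic_sideE// mxE ffunE -SE; exact: bP.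
Qed.

Definition dyadic_sum alpha N j o L f (k : {ffun 'I_n -> 'I_(2 ^ N)}) : R :=
  \sum_(m < N | (j <= m)%N) (2^-1 `^ alpha) ^+ (m - j) *
    cexp (dyadic_class (N := N)) j
      (fun k' => `|mdiff (dyadic_class (N := N)) m (cell_avg o L f) k'|) k.

Lemma dyadic_sum_ge0 alpha N j o L f (k : {ffun 'I_n -> 'I_(2 ^ N)}) :
  0 <= dyadic_sum alpha j o L f k.
Proof.
by apply: sumr_ge0 => m _; rewrite mulr_ge0 ?exprn_ge0 ?powR_ge0 ?cexp_ge0.
Qed.

Definition big_cube x r := cube (x - const_mx (8 * r) : 'rV[R]_n) (16 * r).

Lemma sub_big_cube x r e : 0 < r ->
  cube (shifted_corner x r e) (12 * r) `<=` big_cube x r.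
Proof.
move=> r0 z /cubeP H; apply/cubeP => i; have := H i.
by have := shifted_corner_bound x e i r0; rewrite !mxE => ? ?; lra.
Qed.

(** The suitable grid varies with [y] and [t]; the sum over all grids makes the bound depend on [x]
    only, through its cells. The constant 24 bounds [12 * r / 2 ^ j / t], since
    [t > r / 2 ^ (j + 1)]. *)
Lemma small_scale_bound alpha f x0 r N j x y t
    (k : {ffun 'I_n -> bool} -> {ffun 'I_n -> 'I_(2 ^ N)}) :
  0 < alpha -> 0 < r -> (j <= N)%N ->
  lebesgue.-integrable (big_cube x0 r) (EFin \o f) ->
  (forall i, `|x ord0 i - x0 ord0 i| <= r) -> (forall i, `|y ord0 i - x ord0 i| <= t) ->
  r / 2 ^+ j.+1 < t <= r / 2 ^+ j ->
  (forall e, cell (shifted_corner x0 r e) (12 * r / 2 ^+ N) (k e) x) ->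
  (maximal_average alpha f y t <=
   (24 ^+ n * (24 * n%:R) `^ alpha *
     \sum_e dyadic_sum alpha j (shifted_corner x0 r e) (12 * r) f (k e) +
    ((r / 2 ^+ j.+1) ^- n + (2 ^+ j / (r / 2 ^+ j.+1)) ^+ n) *
    (n%:R * (12 * r) / (r / 2 ^+ j.+1) / 2 ^+ N) `^ alpha *
    \int[lebesgue]_(z in big_cube x0 r) `|f z|)%:E)%E.
Proof.
move=> al0 r0 jN fi xx yx /andP[rt tr] kx.
set tau := r / 2 ^+ j.+1 in rt *.
have tau0 : 0 < tau by rewrite divr_gt0// exprn_gt0.
have t0 : 0 < t by exact: lt_trans rt.
have [e [oy cls]] := adjacent_grid r0 tr xx yx.
set o := shifted_corner x0 r e in oy cls *.
have L0 : 0 < 12 * r by rewrite mulr_gt0.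
have mC : measurable (cube o (12 * r)) by exact: measurable_cube.
have mB : measurable (big_cube x0 r) by exact: measurable_cube.
have sub : cube o (12 * r) `<=` big_cube x0 r by exact: sub_big_cube.
have foi : lebesgue.-integrable (cube o (12 * r)) (EFin \o f).
  exact: integrableS fi.
apply: ge_ereal_sup => _ [phi tphi <-].
apply: (le_trans (maximal_average_pairing al0 L0 t0 jN tphi foi oy
  (fun k' => cls N (k e) k' jN (kx e)))).
rewrite lee_fin; apply: lerD.
  apply: (@le_trans _ _ (24 ^+ n * (24 * n%:R) `^ alpha *
      dyadic_sum alpha j o (12 * r) f (k e))); last first.
    rewrite ler_wpM2l ?mulr_ge0 ?exprn_ge0 ?powR_ge0//.
    rewrite (bigD1 e)//= lerDl; apply: sumr_ge0 => e' _; exact: dyadic_sum_ge0.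
  have ratio : 12 * r / 2 ^+ j / t <= 24.
    rewrite ler_pdivrMr//; have : 24 * tau <= 24 * t by rewrite ler_pM2l// ltW.
    apply: le_trans; rewrite /tau exprS le_eqVlt; apply/orP; left; apply/eqP.
    by field; rewrite expf_neq0.
  have ratio0 : 0 <= 12 * r / 2 ^+ j / t.
    by rewrite !divr_ge0 ?exprn_ge0 ?(ltW t0) ?(ltW L0).
  have lead : t ^- n * (12 * r / 2 ^+ j) ^+ n <= 24 ^+ n.
    by rewrite mulrC -expr_div_n lerXn2r ?nnegrE.
  have decay m : (j <= m)%N -> (n%:R * (12 * r / 2 ^+ m) / t) `^ alpha <=
      (24 * n%:R) `^ alpha * (2^-1 `^ alpha) ^+ (m - j).
    move=> jm; rewrite -powR_div_exp2 ?mulr_ge0 ?ler0n//.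
    apply: le_powR; [exact: ltW| |].
      by rewrite divr_ge0 ?(ltW t0)// mulr_ge0 ?ler0n// divr_ge0 ?exprn_ge0 ?(ltW L0).
    rewrite ler_pdivlMr ?exprn_gt0// [leRHS]mulrC.
    have -> : n%:R * (12 * r / 2 ^+ m) / t * 2 ^+ (m - j) =
        n%:R * (12 * r / 2 ^+ j / t).
      by rewrite -(dyadic_sideE (12 * r) jm) !mulrA [LHS]mulrAC.
    by rewrite ler_wpM2l ?ler0n.
  rewrite /dyadic_sum !mulr_sumr; apply: ler_sum => m jm.
  have C0 : 0 <= cexp (dyadic_class (N := N)) j
    (fun k' => `|mdiff (dyadic_class (N := N)) m (cell_avg o (12 * r) f) k'|) (k e).
    by apply: cexp_ge0.
  have tS0 : 0 <= t ^- n * (12 * r / 2 ^+ j) ^+ n.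
    by rewrite mulr_ge0 ?invr_ge0 ?exprn_ge0 ?divr_ge0 ?exprn_ge0 ?(ltW t0) ?(ltW L0).
  apply: (le_trans (ler_pM tS0 _ lead (ler_wpM2r C0 (decay _ jm)))).
    by rewrite mulr_ge0 ?powR_ge0.
  by rewrite !mulrA.
have inv_le : t^-1 <= tau^-1 by rewrite lef_pV2 ?posrE// ltW.
have tV0 : 0 <= t^-1 by rewrite invr_ge0 ltW.
have p0 : 0 <= 2 ^+ j :> R by rewrite exprn_ge0.
have I0 : 0 <= \int[lebesgue]_(z in cube o (12 * r)) `|f z| by apply: Rintegral_ge0.
apply: ler_pM => //.
- by rewrite mulr_ge0 ?powR_ge0// addr_ge0 ?exprn_ge0 ?mulr_ge0// invr_ge0 exprn_ge0// ltW.
- apply: ler_pM; rewrite ?powR_ge0//.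
  + by rewrite addr_ge0 ?exprn_ge0 ?mulr_ge0// invr_ge0 exprn_ge0// ltW.
  + rewrite lerD//; first by rewrite -!exprVn lerXn2r ?nnegrE// (le_trans tV0).
    rewrite lerXn2r ?nnegrE ?mulr_ge0 ?(le_trans tV0 inv_le)//.
    by rewrite ler_wpM2l.
  + apply: le_powR; [exact: ltW| |].
      by rewrite mulr_ge0// mulr_ge0 ?ler0n// divr_ge0 ?exprn_ge0 ?(ltW L0).
    rewrite [leRHS]mulrAC !mulrA ler_wpM2l//.
    by rewrite divr_ge0 ?exprn_ge0// !mulr_ge0 ?ler0n// ltW.
exact: Rintegral_subset_le.
Qed.

End adjacent_grids.

(** * The cone integral *)

Lemma dyadic_scale (R : realType) (r t : R) : 0 < r -> 0 < t ->
  (exists k, r / 2 ^+ k.+1 < t <= r / 2 ^+ k) \/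
  (exists k, r * 2 ^+ k < t <= r * 2 ^+ k.+1).
Proof.
move=> r0 t0.
have big (u : R) : 0 <= u -> exists k, u < 2 ^+ k.
  move=> u0; exists (Num.bound u); apply: (lt_le_trans (archi_boundP u0)).
  by rewrite -natrX ler_nat ltnW// ltn_expl.
have p0 k : 0 < 2 ^+ k :> R by rewrite exprn_gt0.
have [tr|rt] := leP t r.
  left; have [|k rk] := big (r / t); first by rewrite divr_ge0// ltW.
  have ex : exists k, r / 2 ^+ k.+1 < t.
    exists k; rewrite ltr_pdivrMr// mulrC -ltr_pdivrMr//.
    by apply: (lt_trans rk); rewrite exprS ltr_pMl// ltr1n.
  case: (ex_minnP ex) => -[|m] mt min; first by exists 0%N; rewrite mt expr0 divr1.
  exists m.+1; rewrite mt leNgt; apply/negP => /min; by rewrite ltnn.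
right; have [|k rk] := big (t / r); first by rewrite divr_ge0// ltW.
have ex : exists k, t <= r * 2 ^+ k.+1.
  exists k; rewrite mulrC -ler_pdivrMr// ltW//.
  by apply: (lt_trans rk); rewrite exprS ltr_pMl// ltr1n.
case: (ex_minnP ex) => -[|m] mt min; first by exists 0%N; rewrite mt expr0 mulr1 rt.
by exists m.+1; rewrite mt andbT ltNge; apply/negP => /min; rewrite ltnn.
Qed.

Section cone_integral.
Context {R : realType} {n : nat}.
Local Open Scope ereal_scope.
Implicit Types (x y : 'rV[R]_n) (G : 'rV[R]_n -> R -> \bar R).

Local Notation mu := (@lebesgue R n \x @lebesgue_measure R).

(** A product containing the part of the cone over [x] with [t] in [(s / 2, s]], of explicit
    measure. *)
Definition scale_box x (s : R) : set ('rV[R]_n * measurableTypeR R) :=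
  cube (x - const_mx s) (2 * s)%R `*` [set` `](s / 2)%R, s]].

Lemma measurable_scale_box x s : measurable (scale_box x s).
Proof. by apply: measurableX; [exact: measurable_cube|exact: measurable_itv]. Qed.

Lemma scale_box_cone x y t s : (enorm (x - y) < t)%R -> (s / 2 < t <= s)%R ->
  scale_box x s (y, t).
Proof.
move=> xy /andP[st ts]; split => /=; last by rewrite in_itv/= st.
apply/cubeP => i; have := le_lt_trans (coord_le_enorm (x - y) i) xy.
by rewrite !mxE ltr_norml => ?; lra.
Qed.

(** Scale invariance: [(2 * s) ^ n * (s / 2) * (s / 2) ^ (- n - 1) = 4 ^ n]. *)
Lemma integral_scale_box x s (B : \bar R) : (0 < s)%R -> 0 <= B ->
  \int[mu]_(u in scale_box x s) (B ^+ 2 * ((s / 2) ^- n.+1)%R%:E) =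
  (4 ^+ n)%R%:E * B ^+ 2.
Proof.
move=> s0 B0; rewrite integral_cst; last exact: measurable_scale_box.
rewrite [X in _ * X]product_measure1E; [|exact: measurable_cube|exact: measurable_itv].
have s20 : (0 <= 2 * s)%R by rewrite mulr_ge0// ltW.
rewrite [X in _ * (X * _)](lebesgue_cube _ s20).
rewrite [X in _ * (_ * X)](lebesgue_measure_itv `]s / 2, s]%R)/= lte_fin.
rewrite ifT; last by rewrite ltr_pdivrMr// ltr_pMr// ltr1n.
rewrite -EFinB -EFinM -muleA -EFinM muleC; congr (_%:E * _).
rewrite exprMn [in LHS]exprS.
rewrite (_ : 4 = 2 * 2)%R ?exprMn; last by ring.
by rewrite exprVn exprS; field; rewrite !expf_neq0 ?gt_eqF.
Qed.

(** [G] carries no measurability assumption: at each scale it is dominated by a constant on a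
    [scale_box], and only the sum of these step functions is integrated termwise. *)
Lemma cone_integral_le G x (r : R) (Bs Bl : nat -> \bar R) : (0 < r)%R ->
  (forall y t, 0 <= G y t) -> (forall k, 0 <= Bs k) -> (forall k, 0 <= Bl k) ->
  (forall k y t, enorm (x - y) < t -> r / 2 ^+ k.+1 < t <= r / 2 ^+ k ->
    (G y t <= Bs k)%E)%R ->
  (forall k y t, enorm (x - y) < t -> r * 2 ^+ k < t <= r * 2 ^+ k.+1 ->
    (G y t <= Bl k)%E)%R ->
  \int[mu]_(u in cone x) (G u.1 u.2 ^+ 2 * (u.2 ^- n.+1)%R%:E) <=
  (4 ^+ n)%R%:E * (\sum_(k <oo) Bs k ^+ 2 + \sum_(k <oo) Bl k ^+ 2).
Proof.
move=> r0 G0 Bs0 Bl0 GBs GBl.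
pose w s (B : \bar R) := B ^+ 2 * ((s / 2) ^- n.+1)%R%:E.
pose H (s : nat -> R) (B : nat -> \bar R) u :=
  \sum_(k <oo) (cst (w (s k) (B k)) \_ (scale_box x (s k))) u.
have w0 s B : (0 < s)%R -> 0 <= w s B.
  by move=> s0; rewrite mule_ge0 ?sqre_ge0// lee_fin invr_ge0 exprn_ge0// divr_ge0// ltW.
have H0 s B u : (forall k, 0 < s k)%R -> 0 <= H s B u.
  by move=> s0; apply: nneseries_ge0 => k *; rewrite patchE; case: ifP => // _; exact: w0.
have mP s B k : measurable_fun setT (cst (w (s k) (B k)) \_ (scale_box x (s k))).
  by apply/(measurable_restrictT _ (measurable_scale_box _ _)); exact: measurable_cst.
have mH s B : (forall k, 0 < s k)%R -> measurable_fun setT (H s B).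
  move=> s0; apply: ge0_emeasurable_sum => k *; last exact: mP.
  by rewrite patchE; case: ifP => // _; exact: w0.
have intH s B : (forall k, 0 < s k)%R -> (forall k, 0 <= B k) ->
    \int[mu]_u H s B u = (4 ^+ n)%R%:E * \sum_(k <oo) B k ^+ 2.
  move=> s0 B0; rewrite integral_nneseries//; last first.
    by move=> k u _; rewrite patchE; case: ifP => // _; exact: w0.
  rewrite -nneseriesZl; last by move=> k _; exact: sqre_ge0.
  by apply: eq_eseriesr => k _; rewrite -integral_mkcond integral_scale_box.
have HP s B k u : (forall k, 0 < s k)%R -> scale_box x (s k) u -> w (s k) (B k) <= H s B u.
  move=> s0 su; rewrite /H (nneseriesD1 (n := k))//.
    rewrite patchE mem_set// leeDl// nneseries_ge0// => *.
    by rewrite patchE; case: ifP => // _; exact: w0.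
  by move=> i _; rewrite patchE; case: ifP => // _; exact: w0.
pose ss k := (r / 2 ^+ k)%R; pose sl k := (r * 2 ^+ k.+1)%R.
have ss0 k : (0 < ss k)%R by rewrite divr_gt0// exprn_gt0.
have sl0 k : (0 < sl k)%R by rewrite mulr_gt0// exprn_gt0.
apply: (@le_trans _ _ (\int[mu]_u (H ss Bs u + H sl Bl u))).
  apply: ge0_subset_le_integral => //.
  - move=> u [u0 _]; rewrite mule_ge0 ?sqre_ge0// lee_fin invr_ge0 exprn_ge0//; exact: ltW.
  - by move=> u _; rewrite adde_ge0// H0.
  move=> [y t] [/= t0 xy].
  have Gw s B : (0 < s)%R -> G y t <= B -> (s / 2 < t)%R ->
      G y t ^+ 2 * (t ^- n.+1)%R%:E <= w s B.
    move=> s0 GB st; apply: lee_pmul; rewrite ?sqre_ge0//.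
    - by rewrite lee_fin invr_ge0 exprn_ge0// ltW.
    - by rewrite lee_sqr// ?nnegrE// (le_trans (G0 y t)).
    - rewrite lee_fin lef_pV2 ?posrE ?exprn_gt0 ?divr_gt0// lerXn2r ?nnegrE ?divr_ge0 ?(ltW s0) ?(ltW t0)//.
      exact: ltW.
  have [[k kt]|[k kt]] := dyadic_scale r0 t0.
    have kt' : (ss k / 2 < t <= ss k)%R.
      rewrite (_ : ss k / 2 = r / 2 ^+ k.+1)%R//.
      by rewrite /ss exprSr invfM mulrA.
    apply: (@le_trans _ _ (H ss Bs (y, t))); last by rewrite leeDl// H0.
    apply: le_trans (HP ss Bs k _ ss0 (scale_box_cone xy kt')).
    by apply: Gw => //; [exact: GBs kt|case/andP: kt'].
  have kt' : (sl k / 2 < t <= sl k)%R.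
    rewrite (_ : sl k / 2 = r * 2 ^+ k)%R//.
    by rewrite /sl exprSr mulrA mulfK.
  apply: (@le_trans _ _ (H sl Bl (y, t))); last by rewrite leeDr// H0.
  apply: le_trans (HP sl Bl k _ sl0 (scale_box_cone xy kt')).
  by apply: Gw => //; [exact: GBl kt|case/andP: kt'].
rewrite ge0_integralD//; [|by move=> *; exact: H0|exact: mH|by move=> *; exact: H0|exact: mH].
rewrite !intH// -ge0_muleDr//; by apply: nneseries_ge0 => *; exact: sqre_ge0.
Qed.

End cone_integral.

(** * Minkowski and power mean inequalities for integrals *)

Section integral_inequalities.
Context {d : measure_display} {T : measurableType d} {R : realType}.
Context (mu : {measure set T -> \bar R}) (D : set T) (mD : measurable D).

(** The duality argument of [sum_sqr_cexp_le]: the vector of integrals is paired with itself under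
    the integral sign. *)
Lemma minkowski_integral (I : finType) (f : I -> T -> R) (g : T -> R) :
  (forall i, mu.-integrable D (EFin \o f i)) -> mu.-integrable D (EFin \o g) ->
  (forall x, 0 <= g x) -> (forall x, \sum_i f i x ^+ 2 <= g x ^+ 2) ->
  \sum_i (\int[mu]_(x in D) f i x) ^+ 2 <= (\int[mu]_(x in D) g x) ^+ 2.
Proof.
move=> fi gi g0 fg; set s := \sum_i _.
have s0 : 0 <= s by apply: sumr_ge0 => i _; exact: sqr_ge0.
pose a i := \int[mu]_(x in D) f i x.
have CS x : \sum_i a i * f i x <= Num.sqrt s * g x.
  rewrite (le_trans (ler_norm _))// -[leRHS]ger0_norm ?mulr_ge0//.
  rewrite -ler_sqr ?nnegrE// !real_normK ?num_real// exprMn sqr_sqrtr//.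
  have := @cauchy_schwarz_sum R I (index_enum I) xpredT (fun=> 1)
    a (fun i => f i x) (fun=> ler01).
  have E (h : I -> R) : \sum_i 1 * h i = \sum_i h i.
    by apply: eq_bigr => i _; rewrite mul1r.
  rewrite !E => /le_trans; apply.
  by rewrite ler_wpM2l.
have afi i : mu.-integrable D (EFin \o (fun x => a i * f i x)).
  exact: (integrableZl mD (a i) (fi i)).
have afs : mu.-integrable D (EFin \o (fun x => \sum_i a i * f i x)).
  exact: integrable_sumr.
have sE : s = \int[mu]_(x in D) (\sum_i a i * f i x).
  by rewrite Rintegral_sum//; apply: eq_bigr => i _; rewrite RintegralZl// expr2.
have : s <= Num.sqrt s * \int[mu]_(x in D) g x.
  rewrite -RintegralZl// {1}sE.
  by apply: le_Rintegral => //; exact: (integrableZl mD (Num.sqrt s) gi).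
have := sqr_sqrtr s0; move: (Num.sqrt s) (sqrtr_ge0 s) => u u0 <- uE.
have : 0 <= \int[mu]_(x in D) g x by apply: Rintegral_ge0.
move: uE.
by move: (\int[mu]_(x in D) g x) => v uE v0; have [uv|vu] := leP u v; nra.
Qed.

(** For [g > s] one has [g = g ^ (1 - p) * g ^ p] with a negative exponent [1 - p]. Integrated and
    optimized over [s], this stands in for Hoelder's inequality. *)
Lemma le_add_powR (p s g : R) : 1 < p -> 0 < s -> 0 <= g ->
  g <= s + s `^ (1 - p) * g `^ p.
Proof.
move=> p1 s0 g0; have [gs|sg] := leP g s.
  by rewrite (le_trans gs)// lerDl mulr_ge0 ?powR_ge0.
rewrite (@le_trans _ _ (s `^ (1 - p) * g `^ p))//; last by rewrite lerDr ltW.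
have g0' : 0 < g by exact: lt_trans sg.
rewrite -[leLHS](powRr1 g0) -[X in g `^ X](subrK p 1) -powR_mulD//.
by rewrite ler_wpM2r ?powR_ge0// le_powRN ?(ltW sg)//; lra.
Qed.

Lemma integrable_of_powR (p : R) (f : T -> R) (g : T -> R) : 1 < p ->
  (mu D < +oo)%E -> measurable_fun D f -> measurable_fun D g ->
  (forall x, `|f x| <= g x) -> (\int[mu]_(x in D) (g x `^ p)%:E < +oo)%E ->
  mu.-integrable D (EFin \o f).
Proof.
move=> p1 muD mf mg fg gp.
have mgp : measurable_fun D (fun x => g x `^ p).
  apply: (@measurableT_comp _ _ _ _ _ _ (fun y : R => y `^ p) D g _ mg).
  exact: measurable_powR.
have gpi : mu.-integrable D (EFin \o (fun x => g x `^ p)).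
  apply/integrableP; split; first exact/measurable_EFinP.
  by under eq_integral => x _ do rewrite /= ger0_norm ?powR_ge0//.
have onei : mu.-integrable D (EFin \o (fun=> 1)).
  apply/integrableP; split; first exact: measurable_cst.
  by rewrite integral_cst// normr1 mul1e.
apply: (le_integrable mD _ _ (integrableD mD onei gpi)); first exact/measurable_EFinP.
move=> x _; rewrite /= lee_fin (le_trans (fg x))//.
rewrite (le_trans (le_add_powR p1 ltr01 _))//; first exact: le_trans (normr_ge0 _) (fg x).
by rewrite powR1 mul1r ler_norm.
Qed.

(** With [a] the mean of [g ^ p], the choice [s = a ^ p^-1] makes both terms of [le_add_powR] equal
    on average, whence the factor [2 ^ p]. If [a = 0], every [s > 0] bounds the mean of [g]. *)
Lemma power_mean (p V : R) (g : T -> R) : 1 < p -> 0 < V -> mu D = V%:E ->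
  (forall x, 0 <= g x) -> mu.-integrable D (EFin \o g) ->
  mu.-integrable D (EFin \o (fun x => g x `^ p)) ->
  (V^-1 * \int[mu]_(x in D) g x) `^ p <=
  2 `^ p * (V^-1 * \int[mu]_(x in D) g x `^ p).
Proof.
move=> p1 V0 muV g0 gi gpi; have p0 : 0 < p by lra.
set a := V^-1 * \int[mu]_(x in D) g x `^ p; set m := V^-1 * _.
have a0 : 0 <= a.
  by rewrite mulr_ge0 ?invr_ge0 ?(ltW V0)//; apply: Rintegral_ge0 => x _; exact: powR_ge0.
have m0 : 0 <= m.
  by rewrite mulr_ge0 ?invr_ge0 ?(ltW V0)//; apply: Rintegral_ge0 => x _.
have onei s : mu.-integrable D (EFin \o (fun=> s)).
  apply/integrableP; split; first exact: measurable_cst.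
  by rewrite integral_cst// muV -EFinM ltry.
have key s : 0 < s -> m <= s + s `^ (1 - p) * a.
  move=> s0; rewrite /m /a mulrCA -[X in X + _](mulKf (lt0r_neq0 V0)) -mulrDr.
  rewrite ler_wpM2l ?invr_ge0 ?(ltW V0)//.
  have -> : V * s = \int[mu]_(x in D) s by rewrite Rintegral_cst// muV mulrC.
  rewrite -RintegralZl// -RintegralD//; last exact: (integrableZl mD _ gpi).
  apply: le_Rintegral => //.
    exact: (integrableD mD (onei s) (integrableZl mD _ gpi)).
  by move=> x _; exact: le_add_powR.
have [a00|aN0] := eqVneq a 0.
  suff -> : m = 0 by rewrite powR0 ?gt_eqF// a00 mulr0.
  apply/eqP; rewrite eq_le m0 andbT; apply/ler_addgt0Pr => e e0.
  by have := key _ e0; rewrite a00 mulr0 addr0 add0r.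
have a1 : 0 < a by rewrite lt0r aN0.
have := key _ (powR_gt0 p^-1 a1).
rewrite -powRrM -[X in _ + _ * X](powRr1 a0) powR_mulD//.
have -> : p^-1 * (1 - p) + 1 = p^-1 by field; rewrite gt_eqF.
rewrite -mulr2n -(mulr_natl (a `^ _)) => ma.
apply: (le_trans (le_powR (ltW p0) m0 ma)).
by rewrite powRM ?powR_ge0// -powRrM mulVf ?powRr1// gt_eqF.
Qed.

End integral_inequalities.

Section extended_limits.
Local Open Scope ereal_scope.
Context {R : realType}.

Lemma limn_einf_ge (u : (\bar R)^nat) z N0 :
  (forall N, (N0 <= N)%N -> z <= u N) -> z <= limn_einf u.
Proof.
move=> zu; rewrite limn_einf_lim (cvg_lim _ (@cvg_einfs_sup _ u))//.
apply: (@le_trans _ _ (einfs u N0)); last by apply: ereal_sup_ubound; exists N0.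
by apply: le_ereal_inf_tmp => _ [N /= N0N <-]; exact: zu.
Qed.

Lemma limn_einf_le (u : (\bar R)^nat) z : (forall N, u N <= z) -> limn_einf u <= z.
Proof.
move=> uz; rewrite limn_einf_lim (cvg_lim _ (@cvg_einfs_sup _ u))//.
apply: ge_ereal_sup => _ [N _ <-]; apply: le_trans (uz N).
by apply: ereal_inf_lbound; exists N => /=.
Qed.

Lemma nneseries2_le (a : nat -> nat -> \bar R) S : (forall l j, 0 <= a l j) ->
  (forall M J, \sum_(0 <= l < M) \sum_(0 <= j < J) a l j <= S) ->
  \sum_(0 <= l <oo) \sum_(0 <= j <oo) a l j <= S.
Proof.
move=> a0 aS; apply: lime_le.
  by apply: is_cvg_nneseries => l *; apply: nneseries_ge0 => j *; exact: a0.
apply: nearW => M; rewrite -nneseries_sum_nat//; apply: lime_le.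
  by apply: is_cvg_nneseries => j *; apply: sume_ge0 => l _; exact: a0.
by apply: nearW => J; rewrite exchange_big/=; exact: aS.
Qed.

End extended_limits.

Lemma powR_sum_le (R : realType) (I : finType) (a : I -> R) (s : R) : 0 < s ->
  (forall i, 0 <= a i) ->
  (\sum_i a i) `^ s <= #|I|%:R `^ s * \sum_i a i `^ s.
Proof.
move=> s0 a0; have [i0 _|I0] := @pickP I predT; last first.
  by rewrite !big_pred0// powR0 ?gt_eqF// mulr0.
have [i _ imax] := @arg_maxP _ R I i0 xpredT a isT.
apply: (@le_trans _ _ ((#|I|%:R * a i) `^ s)).
  apply: le_powR; [exact: ltW|by apply: sumr_ge0|].
  rewrite mulr_natl -sumr_const; apply: ler_sum => j _; exact: imax.
rewrite powRM ?ler0n// ler_wpM2l ?powR_ge0//.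
by rewrite (bigD1 i)//= lerDl sumr_ge0// => j _; exact: powR_ge0.
Qed.

Lemma ler_sum_ord (R : realType) (M N : nat) (a : nat -> R) : (M <= N)%N ->
  (forall l, 0 <= a l) -> \sum_(l < M) a l <= \sum_(l < N) a l.
Proof.
move=> MN a0; rewrite (big_ord_widen N a MN) big_mkcond/=.
by apply: ler_sum => l _; case: ifP.
Qed.

Lemma le_poweR (R : realType) (s : R) (x y : \bar R) : 0 <= s ->
  (0 <= x -> x <= y -> x `^ s <= y `^ s)%E.
Proof.
move=> s0 x0 xy; apply: gt0_ler_poweR => //.
  by rewrite in_itv/= leey x0.
by rewrite in_itv/= leey (le_trans x0).
Qed.

(** * Local estimates under a Morrey bound *)

Lemma doubling_pow (R : realType) (Theta : R -> R) (D s : R) k : 0 <= D ->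
  doubling Theta D -> 0 < s -> Theta (2 ^+ k * s) <= D ^+ k * Theta s.
Proof.
move=> D0 dbl s0; elim: k => [|k IH]; first by rewrite !expr0 !mul1r.
rewrite !exprS -!mulrA; apply: (le_trans (dbl _ _)).
  by rewrite mulr_gt0// exprn_gt0.
by rewrite ler_wpM2l.
Qed.

(** A step of length 3 along the first axis leaves the unit ball, so Hoelder continuity gives
    [3 ^ alpha <= 3]. *)
Lemma test_function_le3 (R : realType) n (alpha : R) (phi : 'rV[R]_n -> R) x :
  (0 < n)%N -> 0 < alpha <= 1 -> test_functions alpha phi -> `|phi x| <= 3.
Proof.
case: n phi x => // n phi x _ /andP[a0 a1] [supp _ phiH].
have [x1|x1] := ltP 1 (enorm x); first by rewrite supp// normr0.
pose e : 'rV[R]_n.+1 := \row_i (if i == ord0 then 3 else 0).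
have ee : enorm e = 3.
  rewrite /enorm (bigD1 ord0)//= mxE eqxx big1 ?addr0 ?sqrtr_sqr ?ger0_norm//.
  by move=> i /negbTE i0; rewrite mxE i0 expr0n.
have := phiH x (x + e); rewrite (supp (x + e)); last first.
  apply: lt_le_trans (coord_le_enorm (x + e) ord0).
  have := le_trans (coord_le_enorm x ord0) x1.
  by rewrite !mxE eqxx ler_norml ltr_normr => ?; apply/orP; left; lra.
rewrite subr0 (_ : x - (x + e) = - e); last by rewrite opprD addrA subrr add0r.
rewrite enormN ee => /le_trans; apply.
by rewrite -[leRHS]powRr1// ler_powR//; lra.
Qed.

Section local_estimates.
Context {R : realType} {n : nat} (n0 : (0 < n)%N).
Context {alpha p : R} (a01 : 0 < alpha <= 1) (p1 : 1 < p).
Context {Theta : R -> R} {D : R} (gr : growth_function Theta)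
  (dbl : doubling Theta D) (D2n : 1 <= D < 2 ^+ n).
Context {f : nat -> 'rV[R]_n -> R} (mf : forall l, measurable_fun setT (f l)).
(** [N1] is a positive upper bound of the Morrey norm of the family, in the unfolded form of
    [morrey_f]. *)
Context {N1 : R} (N10 : 0 < N1).
Context (morrey_f : forall x (s : R), 0 < s ->
  (\int[lebesgue]_(y in eball x s)
     ((\sum_(0 <= l <oo) `|(f l y)%:E| ^+ 2) `^ (p / 2)) <= (Theta s * N1 `^ p)%:E)%E).
Implicit Types (x y : 'rV[R]_n) (r s : R).

Definition vnorm M y : R := Num.sqrt (\sum_(l < M) f l y ^+ 2).

Let ss0 M y : 0 <= \sum_(l < M) f l y ^+ 2.
Proof. by apply: sumr_ge0 => l _; exact: sqr_ge0. Qed.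

Lemma vnorm_ge0 M y : 0 <= vnorm M y.
Proof. exact: sqrtr_ge0. Qed.

Lemma vnorm_sqr M y : vnorm M y ^+ 2 = \sum_(l < M) f l y ^+ 2.
Proof. by rewrite sqr_sqrtr. Qed.

Lemma vnorm_powR M y : vnorm M y `^ p = (\sum_(l < M) f l y ^+ 2) `^ (p / 2).
Proof. by rewrite /vnorm -powR12_sqrt// -powRrM mulrC. Qed.

Lemma norm_le_vnorm M y (l : 'I_M) : `|f l y| <= vnorm M y.
Proof.
rewrite -sqrtr_sqr ler_sqrt//.
by rewrite (bigD1 l)//= lerDl sumr_ge0// => i _; exact: sqr_ge0.
Qed.

Lemma measurable_vnorm M : measurable_fun setT (vnorm M).
Proof.
have -> : vnorm M = fun y => (\sum_(l < M) f l y ^+ 2) `^ (2^-1).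
  by apply/funext => y; rewrite powR12_sqrt.
apply: (@measurableT_comp _ _ _ _ _ _ (fun u : R => u `^ 2^-1)).
  exact: measurable_powR.
by apply: measurable_sum => l; exact: measurable_funX.
Qed.

Let p0 : 0 < p. Proof. exact: lt_trans ltr01 p1. Qed.

Lemma integral_vnorm_le M (Q : set 'rV[R]_n) x s : 0 < s -> Q `<=` eball x s ->
  (\int[lebesgue]_(y in Q) (vnorm M y `^ p)%:E <= (Theta s * N1 `^ p)%:E)%E.
Proof.
move=> s0 Qx; apply: le_trans (morrey_f x s0).
apply: ge0_subset_le_integral => //.
- by move=> y _; rewrite lee_fin powR_ge0.
- by move=> y _; exact: poweR_ge0.
move=> y _; rewrite vnorm_powR -poweR_EFin.
have S0 : (0 <= \sum_(0 <= l <oo) `|(f l y)%:E| ^+ 2)%E.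
  by apply: nneseries_ge0 => *; exact: sqre_ge0.
apply: gt0_ler_poweR.
- by rewrite divr_ge0// ltW.
- by rewrite in_itv/= leey lee_fin ss0.
- by rewrite in_itv/= leey S0.
rewrite -sumEFin -(big_mkord xpredT (fun l => (f l y ^+ 2)%:E)).
apply: le_trans (nneseries_lim_ge M _) => //; last by move=> *; exact: sqre_ge0.
by apply: lee_sum => l _; rewrite abse_EFin -EFin_expe lee_fin real_normK// num_real.
Qed.

Lemma sub_big_cube_eball x s : 0 < s -> big_cube x s `<=` eball x (16 * n%:R * s).
Proof.
move=> s0 y /cubeP yQ; rewrite /eball/=.
have : enorm (y - x) <= n%:R * (8 * s).
  apply: enorm_le_coord => [|i]; first by rewrite mulr_ge0// ltW.
  by have := yQ i; rewrite !mxE ler_norml => ?; lra.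
move=> /le_lt_trans; apply.
have : 0 < n%:R * s by rewrite mulr_gt0// ltr0n.
by rewrite mulrCA; lra.
Qed.

Let D0 : 0 < D. Proof. by case/andP: D2n => D1 _; exact: lt_le_trans ltr01 D1. Qed.

Lemma Theta_ge0 s : 0 < s -> 0 <= Theta s.
Proof. by move=> s0; apply: ltW; exact: gr.1. Qed.

Lemma integral_vnorm_big_cube_le M x s : 0 < s ->
  (\int[lebesgue]_(y in big_cube x s) (vnorm M y `^ p)%:E <=
   (D ^+ (n + 4) * Theta s * N1 `^ p)%:E)%E.
Proof.
move=> s0.
have s0' : 0 < 16 * n%:R * s by rewrite !mulr_gt0// ltr0n.
apply: (le_trans (integral_vnorm_le M s0' (sub_big_cube_eball s0))).
rewrite lee_fin ler_wpM2r ?powR_ge0//.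
apply: le_trans (doubling_pow _ (ltW D0) dbl s0).
(* [16 * n <= 2 ^ (n + 4)], which accounts for the exponent of [D]. *)
apply: gr.2 => //; rewrite ler_wpM2r ?(ltW s0)// exprD mulrC.
have -> : 2 ^+ 4 = 16 :> R by ring.
by rewrite ler_wpM2r// -natrX ler_nat ltnW// ltn_expl.
Qed.

Let mQ x s : measurable (big_cube x s). Proof. exact: measurable_cube. Qed.

Let lQ x s : 0 < s -> lebesgue (big_cube x s) = ((16 * s) ^+ n)%:E.
Proof. by move=> s0; rewrite lebesgue_cube// mulr_ge0// ltW. Qed.

Lemma integrable_big_cube M x s (g : 'rV[R]_n -> R) : 0 < s -> measurable_fun setT g ->
  (forall y, `|g y| <= vnorm M y) ->
  lebesgue.-integrable (big_cube x s) (EFin \o g).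
Proof.
move=> s0 mg gv; apply: (integrable_of_powR _ p1 _ _ _ gv) => //.
- by rewrite [X in (X < _)%E](lQ x s0) ltry.
- exact: measurable_funTS.
- by apply: measurable_funTS; exact: measurable_vnorm.
- by apply: le_lt_trans (integral_vnorm_big_cube_le M x s0) _; rewrite ltry.
Qed.

Lemma integrable_vnorm M x s : 0 < s ->
  lebesgue.-integrable (big_cube x s) (EFin \o vnorm M).
Proof.
move=> s0; apply: (@integrable_big_cube M) => // [|y]; first exact: measurable_vnorm.
by rewrite ger0_norm// vnorm_ge0.
Qed.

Lemma integrable_coord l x s : 0 < s ->
  lebesgue.-integrable (big_cube x s) (EFin \o f l).
Proof.
move=> s0; apply: (@integrable_big_cube l.+1) => // y.
exact: (norm_le_vnorm y ord_max).
Qed.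

Lemma integrable_vnorm_powR M x s : 0 < s ->
  lebesgue.-integrable (big_cube x s) (EFin \o (fun y => vnorm M y `^ p)).
Proof.
move=> s0; apply/integrableP; split.
  apply/measurable_EFinP/measurable_funTS.
  apply: (@measurableT_comp _ _ _ _ _ _ (fun u : R => u `^ p)).
    exact: measurable_powR.
  exact: measurable_vnorm.
under eq_integral => y _ do rewrite /= ger0_norm ?powR_ge0//.
by apply: le_lt_trans (integral_vnorm_big_cube_le M x s0) _; rewrite ltry.
Qed.

Lemma Rintegral_vnorm_powR_le M x s : 0 < s ->
  \int[lebesgue]_(y in big_cube x s) vnorm M y `^ p <= D ^+ (n + 4) * Theta s * N1 `^ p.
Proof.
move=> s0; rewrite -lee_fin fineK; first exact: integral_vnorm_big_cube_le.
exact: (integrable_fin_num (mQ x s) (integrable_vnorm_powR M x s0)).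
Qed.

(** * Large scales *)

Definition large_bound x r l k : R :=
  3 * (r * 2 ^+ k) ^- n * \int[lebesgue]_(y in big_cube x (r * 2 ^+ k)) `|f l y|.

Lemma large_bound_ge0 x r l k : 0 < r -> 0 <= large_bound x r l k.
Proof.
move=> r0; rewrite mulr_ge0//; last by apply: Rintegral_ge0.
by rewrite mulr_ge0// invr_ge0 exprn_ge0// mulr_ge0 ?(ltW r0)// exprn_ge0.
Qed.

(** In each coordinate the support of the dilated test function stays within [2 * t + r <= 5 * s] of
    [x0], hence in [big_cube x0 s]; there the dilate is at most [3 * s ^- n]. *)
Lemma large_scale_bound x0 r l k x y t : 0 < r ->
  enorm (x - x0) < r -> enorm (x - y) < t -> r * 2 ^+ k < t <= r * 2 ^+ k.+1 ->
  (maximal_average alpha (f l) y t <= (large_bound x0 r l k)%:E)%E.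
Proof.
move=> r0 xx0 xy /andP[tl tu]; set s := r * 2 ^+ k.
have s0 : 0 < s by rewrite mulr_gt0// exprn_gt0.
have t0 : 0 < t by exact: lt_trans tl.
have tV : 0 <= t^-1 by rewrite invr_ge0 ltW.
have rs : r <= s by rewrite ler_peMr ?(ltW r0)// exprn_ege1//; lra.
have ts : t <= 2 * s by rewrite (le_trans tu)// exprS mulrCA.
have al0 : 0 < alpha by case/andP: a01.
apply: ge_ereal_sup => _ [phi tphi <-].
set Q := big_cube x0 s.
have psi0 z : ~ Q z -> dilate phi t (y - z) * f l z = 0.
  move=> zQ; have [->|pz] := eqVneq (dilate phi t (y - z)) 0; first by rewrite mul0r.
  exfalso; apply: zQ; apply/cubeP => i.
  move: pz; rewrite /dilate mulf_eq0 negb_or => /andP[_ /(test_function_coord i tphi)].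
  rewrite !mxE normrM (ger0_norm tV) mulrC ler_pdivrMr// mul1r ler_norml.
  have := le_lt_trans (coord_le_enorm (x - x0) i) xx0.
  have := le_lt_trans (coord_le_enorm (x - y) i) xy.
  by rewrite !mxE !ltr_norml => ? ? ?; apply/andP; split; lra.
rewrite (integral_supp psi0).
have A0 : 0 <= t ^- n * t^-1 `^ alpha by rewrite mulr_ge0 ?powR_ge0// invr_ge0 exprn_ge0// ltW.
have mpsi : measurable_fun Q (fun z => dilate phi t (y - z)).
  by apply: (measurable_holder al0 A0 _ (holder_dilate y t0 tphi)); rewrite mulr_gt0.
have mpf : measurable_fun Q (fun z => dilate phi t (y - z) * f l z).
  by apply: measurable_funM => //; exact: measurable_funTS.
have afi := integrable_norm (integrable_coord l x0 s0).
have c0 : 0 <= 3 * s ^- n by rewrite mulr_ge0// invr_ge0 exprn_ge0// ltW.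
have le_abs z : `|dilate phi t (y - z) * f l z| <= 3 * s ^- n * `|f l z|.
  rewrite normrM ler_wpM2r// /dilate normrM mulrC ler_pM//.
    exact: test_function_le3 tphi.
  rewrite ger0_norm ?invr_ge0 ?exprn_ge0 ?(ltW t0)//.
  by rewrite lef_pV2 ?posrE ?exprn_gt0// lerXn2r ?nnegrE ?(ltW s0) ?(ltW t0)// ltW.
have pfi : lebesgue.-integrable Q (EFin \o (fun z => dilate phi t (y - z) * f l z)).
  apply: (le_integrable (mQ x0 s) _ _ (integrableZl (mQ x0 s) (3 * s ^- n) afi)).
    exact/measurable_EFinP.
  move=> z _; rewrite /= lee_fin (le_trans (le_abs z))//.
  exact: ler_norm.
rewrite -[X in (`|X|)%E]fineK; last exact: (integrable_fin_num (mQ x0 s) pfi).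
rewrite abse_EFin lee_fin -/(Rintegral _ _ _).
apply: (le_trans (le_normr_Rintegral (mQ x0 s) pfi)).
rewrite /large_bound -/s -RintegralZl//; apply: le_Rintegral => //.
- exact: (integrable_norm pfi).
- exact: (integrableZl (mQ x0 s) _ afi).
Qed.

(** [36 = 3 ^ 2 * 4], with 3 from [large_bound] and 4 from [power_mean]; [16 ^ n] compares the
    volume of a big cube with [s ^ n], and the denominator sums the geometric series. *)
Definition large_const : R :=
  36 * 16 ^+ n ^+ 2 * (D ^+ (n + 4)) `^ (2 / p) / (1 - (D / 2 ^+ n) `^ (2 / p)).

Let q := (D / 2 ^+ n) `^ (2 / p).

Let q01 : 0 < q < 1.
Proof.
have D2 : 0 < D / 2 ^+ n by rewrite divr_gt0// exprn_gt0.
rewrite powR_gt0//=; have : q < 1 `^ (2 / p).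
  apply: gt0_ltr_powR; rewrite ?nnegrE ?(ltW D2)//; first by rewrite divr_gt0.
  by rewrite ltr_pdivrMr ?exprn_gt0// mul1r; case/andP: D2n.
by rewrite powR1.
Qed.

Lemma large_const_gt0 : 0 < large_const.
Proof.
rewrite /large_const -/q; have /andP[_ ?] := q01.
by rewrite divr_gt0 ?subr_gt0// !mulr_gt0 ?powR_gt0 ?exprn_gt0.
Qed.

(** Minkowski's inequality moves the sum over [l] inside the integral, so the bound is independent
    of [M]. At scale [2 ^ k * r] doubling costs [D ^ k] against the volume factor [2 ^ (n * k)]; the
    exponent [2 / p] passes from [p]-th powers to squares. *)
Lemma sum_large_bound_le x r M K : 0 < r ->
  \sum_(l < M) \sum_(k < K) large_bound x r l k ^+ 2 <=
  large_const * (r ^- n * Theta r * N1 `^ p) `^ (2 / p).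
Proof.
move=> r0; set V := r ^- n * Theta r * N1 `^ p.
have V0 : 0 <= V.
  by rewrite !mulr_ge0 ?powR_ge0 ?Theta_ge0// invr_ge0 exprn_ge0// ltW.
set c := 36 * 16 ^+ n ^+ 2 * (D ^+ (n + 4)) `^ (2 / p) * V `^ (2 / p).
have c0 : 0 <= c by rewrite !mulr_ge0 ?powR_ge0// exprn_ge0// exprn_ge0.
have each (k : nat) : \sum_(l < M) large_bound x r l k ^+ 2 <= c * q ^+ k.
  set s := r * 2 ^+ k; have s0 : 0 < s by rewrite mulr_gt0// exprn_gt0.
  set W := (16 * s) ^+ n; have W0 : 0 < W by rewrite exprn_gt0// mulr_gt0.
  pose g y := vnorm M y.
  set Ig := \int[lebesgue]_(y in big_cube x s) g y.
  set Igp := \int[lebesgue]_(y in big_cube x s) g y `^ p.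
  have Ig0 : 0 <= Ig by apply: Rintegral_ge0 => y _; exact: vnorm_ge0.
  have Igp0 : 0 <= Igp by apply: Rintegral_ge0 => y _; exact: powR_ge0.
  have mink : \sum_(l < M) (\int[lebesgue]_(y in big_cube x s) `|f l y|) ^+ 2 <= Ig ^+ 2.
    apply: minkowski_integral => //.
    - by move=> l; exact: integrable_norm (integrable_coord l x s0).
    - exact: integrable_vnorm.
    - by move=> y; exact: vnorm_ge0.
    - by move=> y; rewrite vnorm_sqr; apply: ler_sum => l _; rewrite real_normK// num_real.
  have mean : (W^-1 * Ig) ^+ 2 <= 4 * (W^-1 * Igp) `^ (2 / p).
    have := power_mean (mQ x s) p1 W0 (lQ x s0) (vnorm_ge0 M)
      (integrable_vnorm M x s0) (integrable_vnorm_powR M x s0).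
    have WI0 : 0 <= W^-1 * Ig by rewrite mulr_ge0// invr_ge0 ltW.
    have WIp0 : 0 <= W^-1 * Igp by rewrite mulr_ge0// invr_ge0 ltW.
    have p2 : 0 <= 2 / p by rewrite divr_ge0// ltW.
    move=> /(le_powR p2 (powR_ge0 _ _)); rewrite powRM ?powR_ge0// -!powRrM.
    rewrite (_ : p * (2 / p) = 2); last by field; rewrite gt_eqF.
    by rewrite !powR_mulrn// (_ : 2 ^+ 2 = 4)//; ring.
  have WIp : W^-1 * Igp <= D ^+ (n + 4) * (V * (D / 2 ^+ n) ^+ k).
    have WV : W^-1 <= s ^- n.
      have s16 : 0 < 16 * s by rewrite mulr_gt0.
      rewrite lef_pV2 ?posrE ?exprn_gt0// lerXn2r ?nnegrE ?(ltW s0) ?(ltW s16)//.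
      by rewrite ler_peMl ?(ltW s0)//; lra.
    apply: (@le_trans _ _ (s ^- n * (D ^+ (n + 4) * (D ^+ k * Theta r) * N1 `^ p))).
      apply: ler_pM => //; first by rewrite invr_ge0 ltW.
      apply: (le_trans (Rintegral_vnorm_powR_le M x s0)).
      rewrite ler_wpM2r ?powR_ge0// ler_wpM2l ?exprn_ge0 ?(ltW D0)//.
      by rewrite /s mulrC; exact: doubling_pow (ltW D0) dbl r0.
    rewrite le_eqVlt; apply/orP; left; apply/eqP; rewrite /V /s.
    rewrite exprMn -exprM mulnC exprM [(D / _) ^+ k]expr_div_n; field.
    by rewrite !expf_neq0// gt_eqF.
  have -> : \sum_(l < M) large_bound x r l k ^+ 2 =
      9 * 16 ^+ n ^+ 2 * (W^-1 ^+ 2 *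
      \sum_(l < M) (\int[lebesgue]_(y in big_cube x s) `|f l y|) ^+ 2).
    rewrite !mulr_sumr; apply: eq_bigr => l _; rewrite /large_bound -/s /W exprMn.
    rewrite [(16 * s) ^+ n]exprMn; move: (\int[_]_(_ in _) _) => I.
    by field; rewrite !expf_neq0// gt_eqF.
  apply: (@le_trans _ _ (9 * 16 ^+ n ^+ 2 * (4 * (W^-1 * Igp) `^ (2 / p)))).
    rewrite ler_wpM2l ?mulr_ge0 ?exprn_ge0//.
    by apply: le_trans mean; rewrite exprMn ler_wpM2l// exprn_ge0// invr_ge0 ltW.
  rewrite [leLHS](_ : _ = 36 * 16 ^+ n ^+ 2 * (W^-1 * Igp) `^ (2 / p)); last by ring.
  have -> : c * q ^+ k =
      36 * 16 ^+ n ^+ 2 * (D ^+ (n + 4) * (V * (D / 2 ^+ n) ^+ k)) `^ (2 / p).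
    have Dk : 0 <= D / 2 ^+ n by rewrite divr_ge0 ?exprn_ge0// ltW.
    have -> : q ^+ k = ((D / 2 ^+ n) ^+ k) `^ (2 / p).
      by rewrite /q -(powR_mulrn k (powR_ge0 _ _)) -(powR_mulrn k Dk) powRAC.
    have Dn : 0 <= D ^+ (n + 4) by rewrite exprn_ge0// ltW.
    have Dnk : 0 <= (D / 2 ^+ n) ^+ k by rewrite exprn_ge0.
    by rewrite /c (powRM _ Dn (mulr_ge0 V0 Dnk)) (powRM _ V0 Dnk) !mulrA.
  rewrite ler_wpM2l ?mulr_ge0 ?exprn_ge0//; apply: le_powR => //.
    by rewrite divr_ge0// ltW.
  by rewrite mulr_ge0// invr_ge0 ltW.
rewrite exchange_big/=.
apply: (@le_trans _ _ (\sum_(k < K) c * q ^+ k)); first by apply: ler_sum => k _.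
rewrite -mulr_sumr (_ : large_const * _ = c * (1 - q)^-1); last first.
  by rewrite /large_const -/q /c mulrAC.
rewrite ler_wpM2l//.
have := @sum_geo_ge R q K 0 q01.
by under eq_bigr do rewrite subn0.
Qed.

(** * Pointwise majorants by step functions *)

Local Notation theta := (2^-1 `^ alpha : R).
Local Notation side r N := (12 * r / 2 ^+ N).
Local Notation grids := {ffun 'I_n -> bool}.
Local Notation cells N := {ffun 'I_n -> 'I_(2 ^ N)}.

Let al0 : 0 < alpha. Proof. by case/andP: a01. Qed.

(** The zero function is a test function, so the supremum is not over the empty set. *)
Lemma maximal_average_ge0 g y t : (0 <= maximal_average alpha g y t)%E.
Proof.
apply: (@le_trans _ _ `| \int[lebesgue]_z (dilate (fun=> 0) t (y - z) * g z)%:E |%E).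
  exact: abse_ge0.
apply: ereal_sup_ubound; exists (fun=> 0) => //; split => //.
  by rewrite integral0_eq.
by move=> x x'; rewrite subrr normr0 powR_ge0.
Qed.

(** A supremum over the part of the cone at one dyadic scale: it depends on [x] alone, as
    [cone_integral_le] requires. *)
Definition small_sup r l j x : \bar R :=
  ereal_sup [set a | exists y t, [/\ enorm (x - y) < t,
    r / 2 ^+ j.+1 < t <= r / 2 ^+ j & a = maximal_average alpha (f l) y t]].

Lemma small_sup_ge0 r l j x : 0 < r -> (0 <= small_sup r l j x)%E.
Proof.
move=> r0; apply: le_trans (maximal_average_ge0 (f l) x (r / 2 ^+ j)) _.
have rj : 0 < r / 2 ^+ j by rewrite divr_gt0// exprn_gt0.
apply: ereal_sup_ubound; exists x, (r / 2 ^+ j); split => //.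
  by rewrite subrr -(scale0r x) enormZ normr0 mul0r.
rewrite lexx andbT exprS invfM mulrCA gtr_pMl// invf_lt1//.
by rewrite ltr1n.
Qed.

Definition small_error x0 r l j N : R :=
  ((r / 2 ^+ j.+1) ^- n + (2 ^+ j / (r / 2 ^+ j.+1)) ^+ n) *
    (n%:R * (12 * r) / (r / 2 ^+ j.+1) / 2 ^+ N) `^ alpha *
    \int[lebesgue]_(z in big_cube x0 r) `|f l z|.

Lemma small_error_cvg0 x0 r l j : 0 < r -> small_error x0 r l j N @[N --> \oo] --> 0.
Proof.
move=> r0; rewrite /small_error; under eq_fun do rewrite mulrAC.
apply: cvg_powR_div_exp2 => //.
by rewrite divr_ge0 ?mulr_ge0 ?ler0n ?divr_ge0 ?exprn_ge0 ?(ltW r0).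
Qed.

(** [N] is both the depth of the grid and the number of functions, so that a single limit exhausts
    both. *)
Definition grid_square x0 r N (e : grids) (k : cells N) : R :=
  \sum_(l < N) square_function (dyadic_class (N := N)) theta N
    (cell_avg (shifted_corner x0 r e) (12 * r) (f l)) k.

Lemma grid_square_ge0 x0 r N e (k : cells N) : 0 <= grid_square x0 r e k.
Proof. by apply: sumr_ge0 => l _; exact: square_function_ge0. Qed.

Let K : R := 24 ^+ n * (24 * n%:R) `^ alpha.

Lemma small_sup_le x0 r l j N x (k : grids -> cells N) : 0 < r -> (j <= N)%N ->
  eball x0 r x ->
  (forall e, cell (shifted_corner x0 r e) (side r N) (k e) x) ->
  (small_sup r l j x <= (K * \sum_e
     dyadic_sum alpha j (shifted_corner x0 r e) (12 * r) (f l) (k e) +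
     small_error x0 r l j N)%:E)%E.
Proof.
move=> r0 jN xx0 kx; apply: ge_ereal_sup => _ [y [t [xy tj ->]]].
apply: small_scale_bound => //; first exact: integrable_coord.
  move=> i; have := le_lt_trans (coord_le_enorm (x - x0) i) xx0.
  by rewrite !mxE => /ltW.
move=> i; have := le_lt_trans (coord_le_enorm (x - y) i) xy.
by rewrite !mxE distrC => /ltW.
Qed.

Let E : R := #|grids|%:R.

Lemma sum_small_sup_le x0 r M J N x (k : grids -> cells N) : 0 < r ->
  (M <= N)%N -> (J <= N)%N -> eball x0 r x ->
  (forall e, cell (shifted_corner x0 r e) (side r N) (k e) x) ->
  (\sum_(0 <= l < M) \sum_(0 <= j < J) small_sup r l j x ^+ 2 <=
    (2 * K ^+ 2 * E * (\sum_e grid_square x0 r e (k e)) +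
     2 * \sum_(l < M) \sum_(j < J) small_error x0 r l j N ^+ 2)%:E)%E.
Proof.
move=> r0 MN JN xx0 kx.
pose b l j e := dyadic_sum alpha j (shifted_corner x0 r e) (12 * r) (f l) (k e).
have b0 l j e : 0 <= b l j e by exact: dyadic_sum_ge0.
have CS l j : (\sum_e b l j e) ^+ 2 <= E * \sum_e b l j e ^+ 2.
  have := @cauchy_schwarz_sum R grids (index_enum _) xpredT (fun=> 1) (fun=> 1)
    (b l j) (fun=> ler01).
  have E1 (h : grids -> R) : \sum_i 1 * h i = \sum_i h i.
    by apply: eq_bigr => i _; rewrite mul1r.
  rewrite !E1 => /le_trans; apply; rewrite ler_wpM2r ?sumr_ge0// => [i _|].
    by rewrite sqr_ge0.
  by rewrite (eq_bigr (fun=> 1)) ?sumr_const// => i _; rewrite expr1n.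
have each l j : (j <= N)%N -> (small_sup r l j x ^+ 2 <=
    (2 * K ^+ 2 * E * (\sum_e b l j e ^+ 2) + 2 * small_error x0 r l j N ^+ 2)%:E)%E.
  move=> jN; have := small_sup_le l r0 jN xx0 kx.
  have s0 := small_sup_ge0 l j x r0; rewrite -/(b l j).
  move=> H; apply: (le_trans (_ : _ <= ((K * \sum_e b l j e + small_error x0 r l j N)%:E ^+ 2)%E)%E).
    by rewrite lee_sqr// (le_trans s0).
  rewrite -EFin_expe lee_fin.
  have := CS l j; move: (\sum_e b l j e) (\sum_e b l j e ^+ 2) => u v uv.
  move: (small_error _ _ _ _ _) => w.
  have : K ^+ 2 * u ^+ 2 <= K ^+ 2 * (E * v) by rewrite ler_wpM2l ?sqr_ge0.
  have : 0 <= (K * u - w) ^+ 2 by rewrite sqr_ge0.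
  by nra.
rewrite big_mkord; under eq_bigr do rewrite big_mkord.
apply: (@le_trans _ _ (\sum_(l < M) \sum_(j < J) (2 * K ^+ 2 * E *
    (\sum_e b l j e ^+ 2) + 2 * small_error x0 r l j N ^+ 2)%:E)%E).
  apply: lee_sum => l _; apply: lee_sum => j _; apply: each.
  by rewrite (leq_trans (ltnW (ltn_ord j))).
under eq_bigr do rewrite sumEFin; rewrite sumEFin lee_fin.
under eq_bigr do rewrite big_split/= -!mulr_sumr.
rewrite big_split/= -!mulr_sumr lerD2r ler_wpM2l//.
  by rewrite !mulr_ge0 ?ler0n ?exprn_ge0 ?powR_ge0.
rewrite [leRHS](_ : _ = \sum_(l < N) \sum_(j < N) \sum_e b l j e ^+ 2); last first.
  rewrite exchange_big/=; apply: eq_bigr => l _; rewrite exchange_big/=.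
  by apply: eq_bigr => e _.
have B0 l j : 0 <= \sum_e b l j e ^+ 2 by apply: sumr_ge0 => e _; rewrite sqr_ge0.
apply: (@le_trans _ _ (\sum_(l < M) \sum_(j < N) \sum_e b l j e ^+ 2)).
  apply: ler_sum => l _; exact: (ler_sum_ord JN (B0 l)).
apply: (ler_sum_ord (a := fun l => \sum_(j < N) \sum_e b l j e ^+ 2) MN) => l.
by apply: sumr_ge0 => j _.
Qed.

Let s : R := p / 2.

Let s0 : 0 < s. Proof. by rewrite divr_gt0. Qed.

(** Besides bounding the large scales, this positive number is the threshold below which the
    discretization error is pushed, so the error needs no term of its own. *)
Definition large_level r : R := large_const * (r ^- n * Theta r * N1 `^ p) `^ (2 / p).

Lemma large_level_gt0 r : 0 < r -> 0 < large_level r.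
Proof.
move=> r0; rewrite mulr_gt0 ?large_const_gt0// powR_gt0// !mulr_gt0 ?powR_gt0//.
  by rewrite invr_gt0 exprn_gt0.
exact: gr.1.
Qed.

Let E1 : 1 <= E.
Proof. by rewrite ler1n; apply/card_gt0P; exists [ffun=> true]. Qed.

Let c1 : R := 4 ^+ n * (2 * K ^+ 2 * E + 2).

(** [c1] collects the constants of the cone and of the grids; [2 ^ s] and [E ^ s] come from
    distributing the power [s] over sums. *)
Definition majorant_const : R := c1 `^ s * 2 `^ s * E `^ s.

Lemma majorant_const_ge0 : 0 <= majorant_const.
Proof. by rewrite !mulr_ge0 ?powR_ge0. Qed.

Definition majorant x0 r N x : R := majorant_const *
  (\sum_e \sum_(k : cells N) grid_square x0 r e k `^ s *
     ((fun=> 1 : R) \_ (cell (shifted_corner x0 r e) (side r N) k)) x +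
   large_level r `^ s).

Lemma small_error_sum_eventually x0 r M J : 0 < r ->
  exists N0, forall N, (N0 <= N)%N ->
    2 * \sum_(l < M) \sum_(j < J) small_error x0 r l j N ^+ 2 <= large_level r.
Proof.
move=> r0.
have : (fun N => 2 * \sum_(l < M) \sum_(j < J) small_error x0 r l j N ^+ 2) @ \oo -->
    (2 * \sum_(l < M) \sum_(j < J) (0 : R) ^+ 2).
  apply: cvgM; first exact: cvg_cst.
  apply: cvg_big => [|l _]; first exact: add_continuous.
  apply: cvg_big => [|j _]; first exact: add_continuous.
  by under eq_fun do rewrite expr2; rewrite expr2; apply: cvgM; exact: small_error_cvg0.
rewrite [X in _ --> X](_ : _ = 0); last first.
  by rewrite big1 ?mulr0// => l _; rewrite big1// => j _; rewrite expr0n.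
move=> /cvgrPdist_le/(_ _ (large_level_gt0 r0))[N0 _ H].
exists N0 => N N0N; have := H N N0N.
by rewrite /= sub0r normrN => /(le_trans (ler_norm _)).
Qed.

Lemma side_mul r N : side r N * (2 ^ N)%:R = 12 * r :> R.
Proof. by rewrite natrX divfK// expf_neq0. Qed.

Lemma side_gt0 r N : 0 < r -> 0 < side r N :> R.
Proof. by move=> r0; rewrite divr_gt0 ?mulr_gt0// exprn_gt0. Qed.

Lemma grid_cells_cover x0 r N x : 0 < r -> eball x0 r x ->
  exists k : grids -> cells N, forall e, cell (shifted_corner x0 r e) (side r N) (k e) x.
Proof.
move=> r0 xx0.
have /choice[k kx] e : exists k : cells N, cell (shifted_corner x0 r e) (side r N) k x.
  apply: cube_cell; rewrite side_mul.
  apply/cubeP => i; have := le_lt_trans (coord_le_enorm (x - x0) i) xx0.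
  have := shifted_corner_bound x0 e i r0.
  by rewrite !mxE ltr_norml => ? ?; apply/andP; split; lra.
by exists k.
Qed.

Lemma majorant_cell x0 r N x (k : grids -> cells N) : 0 < r ->
  (forall e, cell (shifted_corner x0 r e) (side r N) (k e) x) ->
  majorant x0 r N x = majorant_const *
    (\sum_e grid_square x0 r e (k e) `^ s + large_level r `^ s).
Proof.
move=> r0 kx; rewrite /majorant; congr (_ * (_ + _)); apply: eq_bigr => e _.
by rewrite (step_cell (side_gt0 N r0) (fun k => grid_square x0 r e k `^ s)
  (fun=> 1 : R) (kx e)) mulr1.
Qed.

(** [N0] depends on [M] and [J], as the error is controlled for finitely many functions and scales
    only; a second copy of [large_level r] absorbs it. *)
Lemma majorant_ge x0 r M J x : 0 < r -> eball x0 r x ->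
  exists N0, forall N, (N0 <= N)%N ->
    (((4 ^+ n)%:E * (\sum_(0 <= l < M) \sum_(0 <= j < J) small_sup r l j x ^+ 2 +
      (large_level r)%:E)) `^ s <= (majorant x0 r N x)%:E)%E.
Proof.
move=> r0 xx0; have [N0 err] := small_error_sum_eventually x0 M J r0.
have lam0 := large_level_gt0 r0.
exists (maxn N0 (maxn M J)) => N; rewrite !geq_max => /and3P[N0N MN JN].
have [k kx] := grid_cells_cover N r0 xx0.
rewrite (majorant_cell r0 kx).
set A := (\sum_(0 <= l < M) _)%E.
have A0 : (0 <= A)%E.
  by apply: sume_ge0 => l _; apply: sume_ge0 => j _; exact: sqre_ge0.
pose U := \sum_e grid_square x0 r e (k e).
have U0 : 0 <= U by apply: sumr_ge0 => e _; exact: grid_square_ge0.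
have K0 : 0 <= 2 * K ^+ 2 * E by rewrite !mulr_ge0 ?ler0n ?exprn_ge0 ?powR_ge0.
have c10 : 0 <= c1 by rewrite mulr_ge0 ?exprn_ge0// addr_ge0.
have step : ((4 ^+ n)%:E * (A + (large_level r)%:E) <=
    (c1 * (U + large_level r))%:E)%E.
  have := sum_small_sup_le r0 MN JN xx0 kx; rewrite -/A -/U => AU.
  apply: (@le_trans _ _ ((4 ^+ n)%:E *
      ((2 * K ^+ 2 * E * U + large_level r)%:E + (large_level r)%:E))%E).
    rewrite lee_wpmul2l ?lee_fin ?exprn_ge0// leeD2r// (le_trans AU)//.
    by rewrite lee_fin lerD2l err.
  rewrite -EFinD -EFinM lee_fin /c1 -[leRHS]mulrA ler_wpM2l ?exprn_ge0//.
  rewrite mulrDl !mulrDr.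
  have : 0 <= 2 * K ^+ 2 * E * large_level r by rewrite mulr_ge0// ltW.
  have : 0 <= 2 * U by rewrite mulr_ge0.
  lra.
have L0 : (0 <= (4 ^+ n)%:E * (A + (large_level r)%:E))%E.
  by rewrite mule_ge0 ?adde_ge0// lee_fin ?exprn_ge0// ltW.
apply: (@le_trans _ _ ((c1 * (U + large_level r))%:E `^ s)%E).
  apply: gt0_ler_poweR => //; first exact: ltW.
    by rewrite in_itv/= leey L0.
  by rewrite in_itv/= leey (le_trans L0).
rewrite poweR_EFin lee_fin powRM ?addr_ge0 ?(ltW lam0)//.
rewrite /majorant_const -!mulrA ler_wpM2l ?powR_ge0//.
apply: (le_trans (powR_add_le (ltW s0) U0 (ltW lam0))).
apply: ler_wpM2l; first exact: powR_ge0.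
rewrite mulrDr; apply: lerD.
  by apply: powR_sum_le => // e; exact: grid_square_ge0.
rewrite ler_peMl ?powR_ge0//; have : 1 `^ s <= E `^ s by apply: le_powR => //; exact: ltW.
by rewrite powR1.
Qed.

Lemma intrinsic_square_sqr_le x0 r l x : 0 < r -> eball x0 r x ->
  (`|intrinsic_square alpha (f l) x| ^+ 2 <=
   (4 ^+ n)%:E * (\sum_(0 <= j <oo) small_sup r l j x ^+ 2 +
     \sum_(0 <= k <oo) (large_bound x0 r l k ^+ 2)%:E))%E.
Proof.
move=> r0 xx0; rewrite /intrinsic_square.
set I := (X in (X `^ 2^-1)%E).
have I0 : (0 <= I)%E.
  apply: integral_ge0 => -[y t] [/= t0 _].
  by rewrite mule_ge0 ?sqre_ge0// lee_fin invr_ge0 exprn_ge0// ltW.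
rewrite (poweR12_sqrt I0) gee0_abs ?sqrte_ge0// sqr_sqrte//.
under [X in (_ * (_ + X))%E]eq_eseriesr do rewrite EFin_expe.
apply: (cone_integral_le r0) => // [y t|k|k|k y t xy kt|k y t xy kt].
- exact: maximal_average_ge0.
- exact: small_sup_ge0.
- by rewrite lee_fin; exact: large_bound_ge0.
- by apply: ereal_sup_ubound; exists y, t.
- exact: large_scale_bound xx0 xy kt.
Qed.

Lemma sum_intrinsic_square_le x0 r x : 0 < r -> eball x0 r x ->
  (\sum_(0 <= l <oo) `|intrinsic_square alpha (f l) x| ^+ 2 <=
   (4 ^+ n)%:E * (\sum_(0 <= l <oo) \sum_(0 <= j <oo) small_sup r l j x ^+ 2 +
     (large_level r)%:E))%E.
Proof.
move=> r0 xx0.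
have S0 l : (0 <= \sum_(0 <= j <oo) small_sup r l j x ^+ 2)%E.
  by apply: nneseries_ge0 => *; exact: sqre_ge0.
have L0 l : (0 <= \sum_(0 <= k <oo) (large_bound x0 r l k ^+ 2)%:E)%E.
  by apply: nneseries_ge0 => *; rewrite lee_fin sqr_ge0.
apply: (@le_trans _ _ (\sum_(0 <= l <oo) (4 ^+ n)%:E *
    (\sum_(0 <= j <oo) small_sup r l j x ^+ 2 +
     \sum_(0 <= k <oo) (large_bound x0 r l k ^+ 2)%:E))%E).
  apply: lee_nneseries => [l _ _|l _]; first exact: sqre_ge0.
  exact: intrinsic_square_sqr_le.
rewrite nneseriesZl => [|l _]; last by rewrite adde_ge0.
rewrite lee_wpmul2l ?lee_fin ?exprn_ge0// nneseriesD// leeD2l//.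
apply: nneseries2_le => [l k|M J]; first by rewrite lee_fin sqr_ge0.
rewrite big_mkord; under eq_bigr do rewrite big_mkord sumEFin.
by rewrite sumEFin lee_fin; exact: sum_large_bound_le.
Qed.

(** The lower limit dominates every finite rectangle of the double series. To pass to the whole
    series, the power [s] is undone on both sides by [s^-1] and restored afterwards. *)
Lemma le_limn_einf_majorant x0 r x : 0 < r -> eball x0 r x ->
  ((\sum_(0 <= l <oo) `|intrinsic_square alpha (f l) x| ^+ 2) `^ s <=
   limn_einf (fun N => (majorant x0 r N x)%:E))%E.
Proof.
move=> r0 xx0; set g := limn_einf _.
have lam0 := large_level_gt0 r0.
have n4 : 0 < 4 ^+ n :> R by rewrite exprn_gt0.
apply: (@le_trans _ _ (((4 ^+ n)%:E * (\sum_(0 <= l <oo) \sum_(0 <= j <oo)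
    small_sup r l j x ^+ 2 + (large_level r)%:E)) `^ s)%E).
  apply: le_poweR; [exact: ltW|by apply: nneseries_ge0 => *; exact: sqre_ge0|].
  exact: (sum_intrinsic_square_le r0 xx0).
have part M J : (((4 ^+ n)%:E * (\sum_(0 <= l < M) \sum_(0 <= j < J)
    small_sup r l j x ^+ 2 + (large_level r)%:E)) `^ s <= g)%E.
  have [N0 H] := majorant_ge M J r0 xx0; exact: limn_einf_ge H.
have A0 M J : (0 <= \sum_(0 <= l < M) \sum_(0 <= j < J) small_sup r l j x ^+ 2)%E.
  by apply: sume_ge0 => l _; apply: sume_ge0 => j _; exact: sqre_ge0.
have g0 : (0 <= g)%E by apply: le_trans (part 0%N 0%N); exact: poweR_ge0.
have inv z : (0 <= z -> (z `^ s) `^ s^-1 = z)%E.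
  move=> z0; rewrite -poweRrM divff ?gt_eqF//; exact: poweRe1.
have inv' z : (0 <= z -> (z `^ s^-1) `^ s = z)%E.
  move=> z0; rewrite -poweRrM mulVf ?gt_eqF//; exact: poweRe1.
rewrite -(inv' g g0); apply: le_poweR; [exact: ltW| |].
  rewrite mule_ge0 ?lee_fin ?exprn_ge0// adde_ge0 ?lee_fin ?(ltW lam0)//.
  by apply: nneseries_ge0 => *; apply: nneseries_ge0 => *; exact: sqre_ge0.
rewrite -lee_pdivlMl// -leeBrDr//; apply: nneseries2_le => [l j|M J].
  exact: sqre_ge0.
rewrite leeBrDr// lee_pdivlMl//.
have ML0 : (0 <= (4 ^+ n)%:E * (\sum_(0 <= l < M) \sum_(0 <= j < J)
    small_sup r l j x ^+ 2 + (large_level r)%:E))%E.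
  by rewrite mule_ge0 ?lee_fin ?exprn_ge0// adde_ge0 ?lee_fin ?(ltW lam0).
rewrite -[leLHS]inv//; apply: le_poweR => //; first by rewrite invr_ge0 ltW.
exact: poweR_ge0.
Qed.

(** * Integration of the majorant over a ball *)

Context {C0 : R} (C0_ge0 : 0 <= C0).
Context (square_C0 : forall (Om I : finType) (c : nat -> rel Om) N (g : I -> Om -> R),
  regular_filtration c (2 ^+ n : R) ->
  \sum_x (\sum_i square_function c theta N (g i) x) `^ (p / 2) <=
  C0 * \sum_x (\sum_i g i x ^+ 2) `^ (p / 2)).

(** The martingale inequality is applied to the cell averages as functions on the index set; the
    cell volume turns counting sums into integrals. On each cell, Minkowski's inequality and
    [power_mean] return from averages to [vnorm N ^ p], so the final bound is free of [N]. *)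
Lemma sum_grid_square_le x0 r N e : 0 < r ->
  side r N ^+ n * (\sum_(k : cells N) grid_square x0 r e k `^ s) <=
  C0 * 2 `^ p * (D ^+ (n + 4) * Theta r * N1 `^ p).
Proof.
move=> r0; set o := shifted_corner x0 r e; set h := side r N.
have h0 : 0 < h by exact: side_gt0.
have hn0 : 0 < h ^+ n by rewrite exprn_gt0.
have hM : h * (2 ^ N)%:R = 12 * r by exact: side_mul.
have subB : cube o (h * (2 ^ N)%:R) `<=` big_cube x0 r.
  by rewrite hM; exact: sub_big_cube.
have mC (k : cells N) : measurable (cell o h k : set 'rV[R]_n) by exact: measurable_cell.
have subC (k : cells N) : cell o h k `<=` big_cube x0 r.
  by apply: subset_trans subB; exact: sub_cell_cube.
have cI g (k : cells N) : lebesgue.-integrable (big_cube x0 r) (EFin \o g) ->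
    lebesgue.-integrable (cell o h k) (EFin \o g).
  by move=> gi; apply: integrableS gi.
have each (k : cells N) :
    h ^+ n * (\sum_(l < N) cell_avg o (12 * r) (f l) k ^+ 2) `^ s <=
    2 `^ p * \int[lebesgue]_(y in cell o h k) vnorm N y `^ p.
  have : \sum_(l < N) (\int[lebesgue]_(y in cell o h k) f l y) ^+ 2 <=
      (\int[lebesgue]_(y in cell o h k) vnorm N y) ^+ 2.
    apply: minkowski_integral => [//|l||y|y].
    - exact: cI (integrable_coord l x0 r0).
    - exact: cI (integrable_vnorm N x0 r0).
    - exact: vnorm_ge0.
    - by rewrite vnorm_sqr.
  have := power_mean (mC k) p1 hn0 (lebesgue_cell h0 k) (vnorm_ge0 N)
    (cI _ k (integrable_vnorm N x0 r0)) (cI _ k (integrable_vnorm_powR N x0 r0)).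
  have : 0 <= \int[lebesgue]_(y in cell o h k) vnorm N y.
    by apply: Rintegral_ge0 => y _; exact: vnorm_ge0.
  move: (\int[lebesgue]_(y in cell o h k) vnorm N y)
    (\int[lebesgue]_(y in cell o h k) vnorm N y `^ p).
  move=> u v u0 uv mink.
  have hnV : 0 <= h ^- n by rewrite invr_ge0 ltW.
  apply: (@le_trans _ _ (h ^+ n * ((h ^- n * u) ^+ 2) `^ s)).
    rewrite ler_pM2l//; apply: le_powR; [exact: ltW| |].
      by apply: sumr_ge0 => l _; exact: sqr_ge0.
    rewrite exprMn (_ : \sum_(l < N) _ = h ^- n ^+ 2 *
      \sum_(l < N) (\int[lebesgue]_(y in cell o h k) f l y) ^+ 2).
      by rewrite ler_wpM2l// exprn_ge0.
    by rewrite mulr_sumr; apply: eq_bigr => l _; rewrite /cell_avg exprMn.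
  have -> : ((h ^- n * u) ^+ 2) `^ s = (h ^- n * u) `^ p.
    rewrite -(powR_mulrn 2); last by rewrite mulr_ge0.
    by rewrite -powRrM; congr (_ `^ _); rewrite /s; field.
  rewrite (le_trans (ler_wpM2l (ltW hn0) uv))// mulrCA ler_wpM2l ?powR_ge0//.
  by rewrite mulVKf ?gt_eqF.
have vi : lebesgue.-integrable (cube o (h * (2 ^ N)%:R))
    (EFin \o (fun y => vnorm N y `^ p)).
  by apply: integrableS (integrable_vnorm_powR N x0 r0) => //; exact: measurable_cube.
apply: (@le_trans _ _ (h ^+ n * (C0 * \sum_(k : cells N)
    (\sum_(l < N) cell_avg o (12 * r) (f l) k ^+ 2) `^ s))).
  by rewrite ler_pM2l//; apply: square_C0; exact: dyadic_filtration.
rewrite mulrCA -mulrA ler_wpM2l// mulr_sumr.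
apply: (le_trans (ler_sum _ (fun k _ => each k))).
rewrite -mulr_sumr ler_wpM2l ?powR_ge0// -(Rintegral_cells h0 vi).
apply: le_trans (Rintegral_vnorm_powR_le N x0 r0).
have := Rintegral_subset_le (measurable_cube o _) (measurable_cube _ _) subB
  (integrable_vnorm_powR N x0 r0).
under eq_Rintegral do rewrite ger0_norm ?powR_ge0//.
by under [leRHS]eq_Rintegral do rewrite ger0_norm ?powR_ge0//.
Qed.

(** [E] counts the grids, and [16 ^ n] is the volume of the big cube times [r ^- n]. *)
Definition local_const : R := majorant_const *
  (E * (C0 * 2 `^ p * D ^+ (n + 4)) + large_const `^ s * 16 ^+ n).

Lemma local_const_ge0 : 0 <= local_const.
Proof.
rewrite mulr_ge0 ?majorant_const_ge0// addr_ge0// mulr_ge0 ?powR_ge0 ?exprn_ge0//.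
by rewrite !mulr_ge0 ?powR_ge0 ?exprn_ge0// ltW.
Qed.

Let indic N x0 r e (k : cells N) : 'rV[R]_n -> R :=
  (fun=> 1 : R) \_ (cell (shifted_corner x0 r e) (side r N) k).

Let integrable_indic N x0 r e (k : cells N) : 0 < r ->
  lebesgue.-integrable (big_cube x0 r) (EFin \o indic x0 r e k).
Proof.
move=> r0; rewrite /indic -restrict_EFin.
have mk : measurable (cell (shifted_corner x0 r e) (side r N) k : set 'rV[R]_n).
  exact: measurable_cell.
apply/(integrable_restrict _ mk (mQ x0 r)).
apply: (@integrableS _ _ _ _ (big_cube x0 r)) => //; first exact: measurableI.
by apply: integrable_cube_cst; rewrite mulr_ge0// ltW.
Qed.

Let Rintegral_indic N x0 r e (k : cells N) : 0 < r ->
  \int[lebesgue]_(y in big_cube x0 r) indic x0 r e k y = side r N ^+ n.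
Proof.
move=> r0; rewrite /indic -Rintegral_mkcondr setIidr.
  by rewrite Rintegral_cube_cst ?mul1r// ltW// side_gt0.
apply: subset_trans (@sub_big_cube _ _ x0 r e r0).
have := @sub_cell_cube R n _ (shifted_corner x0 r e) _ (side_gt0 N r0) k.
by rewrite side_mul.
Qed.

Let steps N x0 r e y := \sum_(k : cells N) grid_square x0 r e k `^ s * indic x0 r e k y.

Let integrable_steps N x0 r e : 0 < r ->
  lebesgue.-integrable (big_cube x0 r) (EFin \o steps N x0 r e).
Proof.
move=> r0; apply: integrable_sumr => // k.
exact: (integrableZl (mQ x0 r) _ (integrable_indic _ _ _ r0)).
Qed.

Let integrable_large x0 r : 0 < r ->
  lebesgue.-integrable (big_cube x0 r) (EFin \o (fun=> large_level r `^ s)).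
Proof. by move=> r0; apply: integrable_cube_cst; rewrite mulr_ge0// ltW. Qed.

Lemma integrable_majorant N x0 r : 0 < r ->
  lebesgue.-integrable (big_cube x0 r) (EFin \o majorant x0 r N).
Proof.
move=> r0; have isteps e := integrable_steps N x0 e r0.
have iss := integrable_sumr (index_enum grids) (mQ x0 r) isteps.
exact: (integrableZl (mQ x0 r) majorant_const
  (integrableD (mQ x0 r) iss (integrable_large x0 r0))).
Qed.

Lemma majorant_ge0 N x0 r y : 0 <= majorant x0 r N y.
Proof.
rewrite mulr_ge0 ?majorant_const_ge0// addr_ge0 ?powR_ge0//.
apply: sumr_ge0 => e _; apply: sumr_ge0 => k _; rewrite mulr_ge0 ?powR_ge0//.
by rewrite patchE; case: ifP.
Qed.

Lemma integral_majorant_le N x0 r : 0 < r ->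
  (\int[lebesgue]_(y in big_cube x0 r) (majorant x0 r N y)%:E <=
   (local_const * (Theta r * N1 `^ p))%:E)%E.
Proof.
move=> r0; have im := integrable_majorant N x0 r0.
rewrite -[leLHS]fineK; last exact: (integrable_fin_num (mQ x0 r) im).
have isteps e := integrable_steps N x0 e r0.
have il := integrable_large x0 r0.
have iss := integrable_sumr (index_enum grids) (mQ x0 r) isteps.
have isl := integrableD (mQ x0 r) iss il.
rewrite lee_fin -/(Rintegral _ _ _) /majorant RintegralZl// RintegralD//.
rewrite Rintegral_cube_cst; last by rewrite mulr_ge0// ltW.
rewrite Rintegral_sum// /local_const -[leRHS]mulrA ler_wpM2l ?majorant_const_ge0//.
rewrite [leRHS]mulrDl lerD//.
  have each e : \int[lebesgue]_(y in big_cube x0 r) steps N x0 r e y <=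
      C0 * 2 `^ p * (D ^+ (n + 4) * Theta r * N1 `^ p).
    apply: le_trans (sum_grid_square_le x0 N e r0).
    rewrite Rintegral_sum// => [|k]; last first.
      exact: (integrableZl (mQ x0 r) _ (integrable_indic _ _ _ r0)).
    rewrite mulr_sumr; apply: ler_sum => k _.
    rewrite (RintegralZl _ (mQ x0 r) (integrable_indic x0 e k r0)).
    by rewrite (Rintegral_indic x0 e k r0) mulrC.
  apply: (le_trans (ler_sum _ (fun e _ => each e))).
  by rewrite sumr_const /E mulr_natl mulrnAl !mulrA.
have V0 : 0 <= r ^- n * Theta r * N1 `^ p.
  by rewrite !mulr_ge0 ?powR_ge0 ?Theta_ge0// invr_ge0 exprn_ge0// ltW.
rewrite /large_level powRM ?powR_ge0 ?(ltW large_const_gt0)// -powRrM.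
rewrite (_ : 2 / p * s = 1); last by rewrite /s; field; rewrite gt_eqF.
rewrite powRr1// exprMn le_eqVlt; apply/orP; left; apply/eqP.
by field; rewrite expf_neq0// gt_eqF.
Qed.

Lemma integral_square_function_le x0 r : 0 < r ->
  (\int[lebesgue]_(x in eball x0 r)
     (\sum_(0 <= l <oo) `|intrinsic_square alpha (f l) x| ^+ 2) `^ (p / 2) <=
   (local_const * (Theta r * N1 `^ p))%:E)%E.
Proof.
move=> r0.
apply: (@le_trans _ _ (\int[lebesgue]_(x in big_cube x0 r)
    limn_einf (fun N => (majorant x0 r N x)%:E))%E).
  apply: ge0_subset_le_integral => [x xx0|x _|x _|x xx0].
  - apply/cubeP => i; have := le_lt_trans (coord_le_enorm (x - x0) i) xx0.
    by rewrite !mxE ltr_norml => ?; lra.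
  - exact: poweR_ge0.
  - by apply: (@limn_einf_ge _ _ _ 0%N) => N _; rewrite lee_fin majorant_ge0.
  - exact: le_limn_einf_majorant.
have mM N : measurable_fun (big_cube x0 r) (EFin \o majorant x0 r N).
  exact: (measurable_int _ (integrable_majorant N x0 r0)).
have M0 N x : big_cube x0 r x -> (0 <= (majorant x0 r N x)%:E)%E.
  by rewrite lee_fin majorant_ge0.
apply: (le_trans (@fatou _ _ _ lebesgue _ (mQ x0 r) _ mM M0)).
by apply: limn_einf_le => N; exact: integral_majorant_le.
Qed.

End local_estimates.

(** * From balls to the Morrey norm *)

Lemma powR_le_root (R : realType) (p : R) (a : \bar R) b : 0 < p -> 0 <= b ->
  (0 <= a -> a `^ p^-1 <= b%:E -> a <= (b `^ p)%:E)%E.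
Proof.
move=> p0 b0 a0 ab; rewrite -(poweRe1 a0) -(mulVf (lt0r_neq0 p0)) poweRrM -poweR_EFin.
by apply: le_poweR => //; [exact: ltW|exact: poweR_ge0].
Qed.

Lemma abse_l2_sum_powR (R : realType) n (p : R) (g : nat -> 'rV[R]_n -> \bar R) x :
  (`|l2_sum g x| `^ p = (\sum_(0 <= j <oo) `|g j x| ^+ 2) `^ (p / 2))%E.
Proof.
by rewrite /l2_sum gee0_abs ?poweR_ge0// -poweRrM mulrC.
Qed.

Lemma morrey_norm_ge0 (R : realType) n (p : R) Theta (g : 'rV[R]_n -> \bar R) :
  (0 <= morrey_norm p Theta g)%E.
Proof.
apply: le_trans (poweR_ge0 _ p^-1) _; last first.
  by apply: ereal_sup_ubound; exists 0 => //; exists 1 => /=.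
Qed.

Theorem corollary2p14 (R : realType) (n : nat) (alpha p : R)
    (Theta : R -> R) (D : R) :
  0 < alpha <= 1 -> 1 < p ->
  growth_function Theta -> doubling Theta D -> 1 <= D < 2 ^+ n ->
  exists2 C : R, 0 < C &
    forall f : nat -> 'rV[R]_n -> R,
      (forall j, locally_integrable_rV (f j)) ->
      (morrey_norm p Theta (l2_sum (fun j => intrinsic_square alpha (f j))) <=
       C%:E * morrey_norm p Theta (l2_sum (fun j x => (f j x)%:E)))%E.
Proof.
move=> a01 p1 gr dbl D2n.
(* In dimension 0 the bounds on [D] would read [1 <= D < 1]. *)
have n0 : (0 < n)%N.
  by case: n D2n => // /andP[D1 /(le_lt_trans D1)]; rewrite expr0 ltxx.
have p0 : 0 < p by exact: lt_trans ltr01 p1.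
have pV0 : 0 <= p^-1 by rewrite invr_ge0 ltW.
have t01 : 0 < (2^-1 : R) `^ alpha < 1 by apply: powR_half_lt1; case/andP: a01.
have [C0 C00 square_C0] := square_function_Lp (2 ^+ n) p1 t01.
set K := @local_const R n alpha p D C0 + 1.
have K0 : 0 < K by rewrite ltr_wpDl// local_const_ge0// ltW.
have C0' : 0 < K `^ p^-1 by rewrite powR_gt0.
exists (K `^ p^-1) => // f fL.
set N0 := morrey_norm p Theta (l2_sum (fun j x => (f j x)%:E)).
have N00 : (0 <= N0)%E by exact: morrey_norm_ge0.
have [->|N0oo] := eqVneq N0 +oo%E.
  by rewrite gt0_muley ?leey// lte_fin.
have N0fin : N0 \is a fin_num by rewrite ge0_fin_numE// ltey.
rewrite -(fineK N0fin) -EFinM; apply/lee_addgt0Pr => e e0.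
(* The norm [N0] may vanish, whereas the local estimates need a positive bound; the excess costs
   exactly [e] after multiplication by the constant. *)
pose N1 := fine N0 + e / K `^ p^-1.
have N0N1 : fine N0 < N1 by rewrite ltrDl divr_gt0.
have N10 : 0 < N1 by apply: le_lt_trans N0N1; exact: fine_ge0.
rewrite -EFinD (_ : _ + e = K `^ p^-1 * N1); last first.
  by rewrite /N1 mulrDr mulrCA divff ?mulr1// gt_eqF.
have morrey_f x s : 0 < s -> (\int[lebesgue]_(y in eball x s)
    ((\sum_(0 <= l <oo) `|(f l y)%:E| ^+ 2) `^ (p / 2)) <= (Theta s * N1 `^ p)%:E)%E.
  move=> s0; have Th0 := gr.1 s s0.
  rewrite EFinM -lee_pdivrMl//; apply: powR_le_root => //; first exact: ltW.
    rewrite mule_ge0 ?lee_fin ?invr_ge0 ?(ltW Th0)//.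
    by apply: integral_ge0 => y _; exact: poweR_ge0.
  apply: (@le_trans _ _ N0); last by rewrite -(fineK N0fin) lee_fin ltW.
  apply: ereal_sup_ubound; exists x => //; exists s => //=.
  by congr ((_ * _) `^ _)%E; apply: eq_integral => y _; rewrite abse_l2_sum_powR.
apply: ge_ereal_sup => _ [x _ [r /= r0 <-]].
have Th0 := gr.1 r r0.
have HI := @integral_square_function_le R n n0 alpha p a01 p1 Theta D gr dbl D2n f
  (fun l => (fL l).1) N1 N10 morrey_f C0 (ltW C00) square_C0 x r r0.
under eq_integral do rewrite abse_l2_sum_powR.
set I := (X in ((_ * X) `^ _)%E) in HI *.
have I0 : (0 <= I)%E by apply: integral_ge0 => y _; exact: poweR_ge0.
rewrite (_ : K `^ p^-1 * N1 = (K * N1 `^ p) `^ p^-1); last first.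
  by rewrite powRM ?powR_ge0 ?(ltW K0)// -powRrM divff ?gt_eqF// powRr1// ltW.
rewrite -poweR_EFin; apply: le_poweR => //.
  by rewrite mule_ge0// lee_fin invr_ge0 ltW.
rewrite lee_pdivrMl//; apply: (le_trans HI); rewrite -EFinM lee_fin mulrCA.
rewrite ler_wpM2l ?(ltW Th0)// ler_wpM2r ?powR_ge0//.
by rewrite lerDl.
Qed.
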